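(* Let the Cantor set $B$ be equipped with a quasiconformal structure by identifying $B=\partial T$ for some bounded valence, bushy tree $T$. Let $G\times B\to B$ be a uniformly quasiconformal action of a group $G$ on $B$, and suppose that the action of $G$ on the triple space of $B$ is cocompact. Then $G$ is the fundamental group of a finite graph of groups $\Gamma$ with finite index edge-to-vertex injections; moreover, a subgroup $H<G$ stabilizes some vertex of the Bass-Serre tree of $\Gamma$ if and only if the action of $H$ on the space of distinct pairs in $B$ has precompact orbits.
   Context: Trees are simplicial with edges of length $1$. Bounded valence means vertices have uniformly finite valence. Bushy means each point is within a uniformly bounded distance of some vertex having at least $3$ unbounded complementary components. $\partial T$ is the Gromov boundary. The triple space of $B$ is the space of ordered triples of pairwise distinct points of $B$; the space of distinct pairs is $\{(a,b)\in B\times B: a\ne b\}$. A graph of groups is a graph with vertex groups, edge groups and injective edge-to-vertex homomorphisms; ''finite index edge-to-vertex injections'' means that each of these has finite index image. For $K\ge1$, $C\ge0$, a map $f\colon X\to Y$ of metric spaces is a $K,C$ quasi-isometry if $\frac1Kd(x,y)-C\le d(f(x),f(y))\le Kd(x,y)+C$ for all $x,y$, and every point of $Y$ is within $C$ of $f(X)$; a quasi-isometry of proper geodesic hyperbolic spaces extends to a homeomorphism of Gromov boundaries. Cross-ratio: for pairwise distinct $a,b,c,d\in\partial X$, $$[a,b,c,d]=\exp\Bigl(\tfrac12\sup\liminf_{i\to\infty}\bigl(d(x_i,t_i)-d(t_i,z_i)+d(z_i,y_i)-d(y_i,x_i)\bigr)\Bigr),$$ the sup taken over sequences in $X$ with $x_i\to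 a$, $y_i\to b$, $z_i\to c$, $t_i\to d$. For a proper increasing function $I\colon[0,\infty)\to[0,\infty)$, a homeomorphism $f\colon\partial X\to\partial Y$ is $I$-quasimobius if $[a,b,c,d]\le I([fa,fb,fc,fd])$ and $[fa,fb,fc,fd]\le I([a,b,c,d])$ for all such $(a,b,c,d)$. A group action on $\partial X$ by homeomorphisms $A_g$ is uniformly quasiconformal if the $A_g$ satisfy one of the following criteria uniformly: (i) for some $K,C$, each $A_g$ is the continuous extension of some $K,C$ quasi-isometry $X\to X$; (ii) for some proper increasing $I$, each $A_g$ is $I$-quasimobius; (iii) when $X$ has cobounded isometry group: for some compact set $\mathcal K$ in the space of homeomorphisms of $\partial X$ with the compact-open topology, for each $g$ and each isometry $\alpha$ of $X$ there is an isometry $\beta$ of $X$ with $\partial\beta\circ A_g\circ\partial\alpha\in\mathcal K$. By a theorem of Paulin these criteria are equivalent, uniformly in the data, for proper, geodesic, Gromov hyperbolic spaces with cobounded isometry groups. *)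

(* Defs.v *)
From HB Require Import structures.
From mathcomp Require Import all_boot all_order all_algebra.
From mathcomp Require Import all_classical all_reals all_analysis.
From mathcomp Require Import ring.

Set Implicit Arguments.
Unset Strict Implicit.
Unset Printing Implicit Defensive.

Import Order.TTheory GRing.Theory Num.Theory.
Local Open Scope classical_set_scope.
Local Open Scope ring_scope.

(* Loops and multiple edges are allowed. *)
Record graph := Graph {
  vertex : Type;
  edge : Type;
  source : edge -> vertex;
  target : edge -> vertex }.

(* An oriented edge; [true] is the orientation from source to target. *)
Definition dart (G : graph) := (edge G * bool)%type.

Section Walks.
Variable G : graph.

Definition origin (d : dart G) := if d.2 then source d.1 else target d.1.
Definition terminus (d : dart G) := if d.2 then target d.1 else source d.1.
Definition reverse (d : dart G) : dart G := (d.1, ~~ d.2).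

Fixpoint walk (u : vertex G) (p : seq (dart G)) (v : vertex G) : Prop :=
  if p is d :: q then origin d = u /\ walk (terminus d) q v else u = v.

Fixpoint reduced (p : seq (dart G)) : Prop :=
  match p with
  | d :: ((d' :: _) as q) => d' <> reverse d /\ reduced q
  | _ => True
  end.

Definition is_tree := inhabited (vertex G) /\
  forall u v, exists! p, walk u p v /\ reduced p.

(* [u] and [v] are the end points of a (possibly degenerate) closed cell. *)
Definition spans (u v : vertex G) :=
  u = v \/ exists d : dart G, origin d = u /\ terminus d = v.

Definition bounded_valence :=
  exists n, forall v, ([set d : dart G | origin d = v] #<= `I_n)%card.

Definition finite_graph :=
  finite_set [set: vertex G] /\ finite_set [set: edge G].

Definition spanning_subgraph (F : set (edge G)) : graph :=
  @Graph (vertex G) {e | F e} (fun e => source (sval e))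
    (fun e => target (sval e)).

Lemma spans_sym u v : spans u v -> spans v u.
Proof.
case=> [->|[[e b] [<- <-]]]; first by left.
by right; exists (e, ~~ b); case: b.
Qed.

End Walks.

Record tree := Tree { tree_graph :> graph; treeP : is_tree tree_graph }.

Section Realization.
Variables (R : realType) (T : tree).
Implicit Types (u v w : vertex T).

Definition on_cell (p : vertex T -> R) u v :=
  exists2 t : R, 0 <= t <= 1 &
    p = (fun w => (1 - t) * \1_[set u] w + t * \1_[set v] w).

(* Points are given by their barycentric coordinates. *)
Record realization := Realization {
  bary :> vertex T -> R;
  baryP : exists u v, spans u v /\ on_cell bary u v }.

HB.instance Definition _ := gen_eqMixin realization.
HB.instance Definition _ := gen_choiceMixin realization.

Implicit Types (p q r : realization).

(* A string is a chain of points, consecutive ones lying on a common closed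
   cell, where they are at distance [`|p u - q u|] from each other. The path
   metric is the infimum of the lengths of strings. *)
Inductive string : realization -> realization -> R -> Prop :=
| string_nil p : string p p 0
| string_cons p q r u v l : spans u v -> on_cell p u v -> on_cell q u v ->
    string q r l -> string p r (`|p u - q u| + l).

Definition path_dist p q : R := inf [set l | string p q l].

Lemma vertex_pointP v :
  exists u w, spans u w /\ on_cell (fun x => \1_[set v] x : R) u w.
Proof.
exists v, v; split; [by left|exists 0; first by rewrite lexx ler01].
by apply/funext => w; rewrite subr0 mul1r mul0r addr0.
Qed.

Definition vertex_point v : realization := Realization (vertex_pointP v).

Lemma bary_inj p q : (bary p = bary q) -> p = q.
Proof.
case: p q => [p Pp] [q Pq] /= e; case: _ / e Pq => Pq.
by congr Realization; exact: Prop_irrelevance.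
Qed.

Lemma string_cat p q r l m : string p q l -> string q r m ->
  string p r (l + m).
Proof.
move=> pql; elim: pql r m => {p q l} [p r m|p q s u v l uv pu qu _ IH r m srm].
  by rewrite add0r.
by rewrite -addrA; apply: string_cons uv pu qu _; exact: IH.
Qed.

Lemma string_rev p q l : string p q l -> string q p l.
Proof.
elim=> {p q l} [p|p q r u v l uv pu qu _ IH]; first exact: string_nil.
rewrite addrC; apply: (string_cat IH).
rewrite -[X in string _ _ X]addr0 distrC.
by apply: string_cons uv qu pu _; exact: string_nil.
Qed.

Lemma string_bary p q l w : string p q l -> `|p w - q w| <= l.
Proof.
elim=> {p q l} [p|p q r u v l uv [s s01 pE] [t t01 qE] _ IH].
  by rewrite subrr normr0.
rewrite (le_trans (ler_distD (q w) _ _))// lerD// pE qE /=.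
have E x : (1 - s) * \1_[set u] x + s * \1_[set v] x -
    ((1 - t) * \1_[set u] x + t * \1_[set v] x) =
    (t - s) * (\1_[set u] x - \1_[set v] x) :> R by ring.
rewrite !E !normrM ler_wpM2l//.
have [<-|uv'] := pselect (u = v); first by rewrite !subrr.
have -> : `|\1_[set u] u - \1_[set v] u| = 1 :> R.
  by rewrite !indicE mem_set// memNset// subr0 normr1.
by rewrite !indicE; do 2 case: (_ \in _);
  rewrite ?subrr ?subr0 ?sub0r ?normrN ?normr0 ?normr1.
Qed.

Lemma string_ge0 p q l : string p q l -> 0 <= l.
Proof.
by elim=> {p q l} [//|p q r u v l uv pu qu _ l0]; rewrite addr_ge0.
Qed.

Lemma string_cell p q u v : spans u v -> on_cell p u v -> on_cell q u v ->
  string p q `|p u - q u|.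
Proof.
move=> uv pu qu; rewrite -[X in string _ _ X]addr0.
by apply: string_cons uv pu qu _; exact: string_nil.
Qed.

Lemma on_cellr u v : on_cell (vertex_point v) u v.
Proof.
exists 1; first by rewrite ler01 lexx.
by apply/funext => w /=; rewrite subrr mul0r add0r mul1r.
Qed.

Lemma on_celll u v : on_cell (vertex_point u) u v.
Proof.
exists 0; first by rewrite lexx ler01.
by apply/funext => w /=; rewrite subr0 mul0r addr0 mul1r.
Qed.

Lemma string_exists p q : exists l, string p q l.
Proof.
have walk_string u v s : walk u s v ->
    exists l, string (vertex_point u) (vertex_point v) l.
  elim: s u => [u <-|d s IH u /= [ou /IH[l dl]]].
    by exists 0; exact: string_nil.
  have ud : spans u (terminus d) by right; exists d.
  have := string_cell ud (on_celll _ _) (on_cellr _ _).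
  by move=> /string_cat /(_ dl); eexists; eauto.
have [u [u' [uu' pu]]] := baryP p; have [v [v' [vv' qv]]] := baryP q.
have [s [[/walk_string[l uv] _] _]] := (treeP T).2 u v.
have pu' := string_cell uu' pu (on_celll _ _).
have qv' := string_rev (string_cell vv' qv (on_celll _ _)).
by have := string_cat (string_cat pu' uv) qv'; eexists; eauto.
Qed.

Lemma path_dist_inf p q : has_inf [set l | string p q l].
Proof.
split; first by have [l pql] := string_exists p q; exists l.
by exists 0 => l; exact: string_ge0.
Qed.

Lemma path_distxx p : path_dist p p = 0.
Proof.
apply/eqP; rewrite eq_le; apply/andP; split.
  by apply: ge_inf; [exact: (path_dist_inf p p).2|exact: string_nil].
apply: lb_le_inf; first by exists 0; exact: string_nil.
by move=> l; exact: string_ge0.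
Qed.

Lemma path_dist_positivity p q : path_dist p q = 0 -> p = q.
Proof.
move=> pq0; apply/bary_inj/funext => w; apply/eqP.
rewrite -subr_eq0 -normr_le0 -pq0; apply: lb_le_inf.
  exact: (path_dist_inf p q).1.
by move=> l; exact: string_bary.
Qed.

Lemma path_dist_sym p q : path_dist p q = path_dist q p.
Proof. by congr inf; apply/seteqP; split=> l; exact: string_rev. Qed.

Lemma path_dist_triangle q p r :
  path_dist p r <= path_dist p q + path_dist q r.
Proof.
rewrite -lerBlDr; apply: lb_le_inf; first exact: (path_dist_inf p q).1.
move=> l pql; rewrite lerBlDr -lerBlDl.
apply: lb_le_inf; first exact: (path_dist_inf q r).1.
move=> m qrm; rewrite lerBlDl; apply: ge_inf; first exact: (path_dist_inf p r).2.
exact: string_cat pql qrm.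
Qed.

HB.instance Definition _ := isMetric.Build R realization
  path_distxx path_dist_positivity path_dist_sym path_dist_triangle.

End Realization.

Section MetricNotions.
Variables (R : realType) (X Y : metricType R).

Definition unbounded (S : set X) :=
  forall M : R, exists x y, [/\ S x, S y & M < mdist x y].

Definition quasi_isometry (K C : R) (f : X -> Y) :=
  (forall x y, K^-1 * mdist x y - C <= mdist (f x) (f y) <=
               K * mdist x y + C) /\
  (forall y, exists x, mdist y (f x) <= C).

Definition isometry (f : X -> Y) :=
  bijective f /\ forall x y, mdist (f x) (f y) = mdist x y.

End MetricNotions.

Definition cobounded_isometries (R : realType) (X : metricType R) :=
  exists D : R, forall x y : X, exists2 a : X -> X,
    isometry a & mdist (a x) y <= D.

Definition bushy (R : realType) (T : tree) :=
  exists D : R, forall x : realization R T, exists v : vertex T,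
    let pv := vertex_point R v in
    let component c := connected_component (~` [set pv]) c in
    mdist x pv <= D /\
    exists c : 'I_3 -> realization R T,
      injective (component \o c) /\ forall i, unbounded (component (c i)).

Section Boundary.
Variables (R : realType) (X : metricType R).
Implicit Types (o x y : X) (s t : nat -> X).

Definition gromov_product o x y : R :=
  (mdist x o + mdist y o - mdist x y) / 2.

(* An equivalence relation on the sequences converging at infinity when [X] is
   Gromov hyperbolic. *)
Definition asymptotic s t := forall o (M : R), exists N, forall i j,
  (N <= i)%N -> (N <= j)%N -> M <= gromov_product o (s i) (t j).

(* A boundary point is a class of asymptotic sequences converging at infinity,
   that is, sequences asymptotic to themselves. *)
Record boundary := Boundary {
  boundary_class : set (nat -> X);
  boundaryP : exists2 s, asymptotic s s &
    boundary_class = [set t | asymptotic t t /\ asymptotic s t] }.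

HB.instance Definition _ := gen_eqMixin boundary.
HB.instance Definition _ := gen_choiceMixin boundary.

Definition tends_to s (a : boundary) := boundary_class a s.

(* As [r] grows these form a basis of neighbourhoods of [a]; the sets themselves
   need not be open. *)
Definition boundary_nbhd o (a : boundary) (r : R) : set boundary :=
  [set b | exists s t, [/\ tends_to s a, tends_to t b &
    exists N, forall i j, (N <= i)%N -> (N <= j)%N ->
      r <= gromov_product o (s i) (t j)]].

Definition boundary_open (U : set boundary) :=
  forall o a, U a -> exists r, boundary_nbhd o a r `<=` U.

Lemma boundary_nbhd_mono o a r r' : r <= r' ->
  boundary_nbhd o a r' `<=` boundary_nbhd o a r.
Proof.
move=> rr' b [s [t [sa tb [N sN]]]]; exists s, t; split => //.
by exists N => i j Ni Nj; exact: le_trans rr' (sN i j Ni Nj).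
Qed.

Lemma boundary_openT : boundary_open setT.
Proof. by move=> o a _; exists 0. Qed.

Lemma boundary_openI : setI_closed boundary_open.
Proof.
move=> U V oU oV o a [/(oU o)[r rU] /(oV o)[r' rV]]; exists (Num.max r r').
move=> b ab; split; [apply: rU|apply: rV]; apply: boundary_nbhd_mono ab.
  by rewrite le_max lexx.
by rewrite le_max lexx orbT.
Qed.

Lemma boundary_open_bigU (I : Type) (f : I -> set boundary) :
  (forall i, boundary_open (f i)) -> boundary_open (\bigcup_i f i).
Proof.
move=> of_ o a [i _ /(of_ i o)[r rf]]; exists r.
by apply: subset_trans rf _; exact: bigcup_sup.
Qed.

HB.instance Definition _ := isOpenTopological.Build boundary
  boundary_openT boundary_openI boundary_open_bigU.

(* [fine] discards the infinite values, which do not occur for pairwise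
   distinct points of the boundary of a hyperbolic space. *)
Definition cross_ratio (a b c d : boundary) : R :=
  fine (expeR (2^-1%:E * ereal_sup
    [set l : \bar R | exists x y z t : nat -> X,
      [/\ tends_to x a, tends_to y b, tends_to z c & tends_to t d] /\
      l = limn_einf (fun i => (mdist (x i) (t i) - mdist (t i) (z i) +
                               mdist (z i) (y i) - mdist (y i) (x i))%:E)]))%E.

End Boundary.

Section BoundaryMaps.
Variables (R : realType) (X Y : metricType R).

Definition extends_to_boundary (f : X -> Y) (F : boundary X -> boundary Y) :=
  forall s a, tends_to s a -> tends_to (f \o s) (F a).

(* [I] is only considered on [0, +oo[. *)
Definition proper_increasing (I : R -> R) :=
  [/\ forall x, 0 <= x -> 0 <= I x,
      forall x y, 0 <= x -> x < y -> I x < I y &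
      I x @[x --> +oo] --> +oo].

Definition quasimobius (I : R -> R) (F : boundary X -> boundary Y) :=
  forall a b c d, uniq [:: a; b; c; d] ->
    cross_ratio a b c d <= I (cross_ratio (F a) (F b) (F c) (F d)) /\
    cross_ratio (F a) (F b) (F c) (F d) <= I (cross_ratio a b c d).

End BoundaryMaps.

Definition homeomorphism (A B : topologicalType) (f : A -> B) :=
  exists g : B -> A,
    [/\ cancel f g, cancel g f, continuous f & continuous g].

Definition action_by_homeomorphisms (G : groupType) (B : topologicalType)
    (A : G -> B -> B) :=
  [/\ forall b, A 1%g b = b,
      forall g h b, A (g * h)%g b = A g (A h b) &
      forall g, homeomorphism (A g)].

Section Quasiconformal.
Variables (R : realType) (X : metricType R) (G : groupType).
Variable A : G -> boundary X -> boundary X.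

Definition uniformly_quasiisometric :=
  exists K C : R, [/\ 1 <= K, 0 <= C &
    forall g, exists2 f : X -> X,
      quasi_isometry K C f & extends_to_boundary f (A g)].

Definition uniformly_quasimobius :=
  exists2 I : R -> R, proper_increasing I & forall g, quasimobius I (A g).

Definition compact_modulo_isometries :=
  exists K : set {compact-open, boundary X -> boundary X},
    [/\ compact K,
        forall F : boundary X -> boundary X, K F -> homeomorphism F &
        forall g (a : X -> X) (da : boundary X -> boundary X),
          isometry a -> extends_to_boundary a da ->
          exists (b : X -> X) (db : boundary X -> boundary X),
            [/\ isometry b, extends_to_boundary b db &
                K (db \o A g \o da)]].

Definition uniformly_quasiconformal :=
  [\/ uniformly_quasiisometric, uniformly_quasimobius |
      cobounded_isometries X /\ compact_modulo_isometries].

End Quasiconformal.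

Definition distinct_triples (B : Type) : set (B * B * B) :=
  [set t | [/\ t.1.1 <> t.1.2, t.1.2 <> t.2 & t.1.1 <> t.2]].

Definition distinct_pairs (B : Type) : set (B * B) :=
  [set p | p.1 <> p.2].

Section Actions.
Variables (G : groupType) (B : topologicalType) (A : G -> B -> B).

Definition cocompact_on_triples :=
  exists2 K : set (set_type (@distinct_triples B)), compact K &
    forall t : set_type (@distinct_triples B), exists g, exists2 k, K k &
      let: (a, b, c) := set_val k in set_val t = (A g a, A g b, A g c).

Definition pair_orbit (H : {pred G}) (p : set_type (@distinct_pairs B)) :
    set (set_type (@distinct_pairs B)) :=
  [set q | exists2 h, h \in H &
    set_val q = (A h (set_val p).1, A h (set_val p).2)].

Definition precompact_pair_orbits (H : {pred G}) :=
  forall p, precompact (pair_orbit H p).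

End Actions.

Section Presentation.
Variables (S : Type) (rel : seq (S * bool) -> seq (S * bool) -> Prop).

(* The letter [(s, false)] stands for the formal inverse of [s]. *)
Notation word := (seq (S * bool)).

Inductive word_eq : word -> word -> Prop :=
| word_eq_refl w : word_eq w w
| word_eq_sym u v : word_eq u v -> word_eq v u
| word_eq_trans u v w : word_eq u v -> word_eq v w -> word_eq u w
| word_eq_cat u u' v v' :
    word_eq u u' -> word_eq v v' -> word_eq (u ++ v) (u' ++ v')
| word_eq_cancel s b : word_eq [:: (s, b); (s, ~~ b)] [::]
| word_eq_rel u v : rel u v -> word_eq u v.

Record presented := Presented {
  word_class : set word;
  word_classP : exists w, word_class = word_eq w }.

HB.instance Definition _ := gen_eqMixin presented.
HB.instance Definition _ := gen_choiceMixin presented.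

Definition word_val (w : word) : presented :=
  Presented (ex_intro _ w erefl).

Definition word_repr (x : presented) : word := projT1 (cid (word_classP x)).

Definition word_inv (w : word) : word := rev [seq (l.1, ~~ l.2) | l <- w].

Lemma word_valP u v : word_val u = word_val v <-> word_eq u v.
Proof.
split=> [[e]|uv]; first by rewrite e; exact: word_eq_refl.
have e : word_eq u = word_eq v.
  apply/funext => w; apply/propext; split; apply: word_eq_trans => //.
  exact: word_eq_sym.
rewrite /word_val; case: _ / e (ex_intro _ v _) => E.
by congr Presented; exact: Prop_irrelevance.
Qed.

Lemma word_reprK x : word_val (word_repr x) = x.
Proof.
rewrite /word_repr; case: cid => w /= e; case: x e => c Pc /= e.
rewrite /word_val; case: _ / (esym e) Pc => Pc.
by congr Presented; exact: Prop_irrelevance.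
Qed.

Lemma word_valK w : word_eq (word_repr (word_val w)) w.
Proof. by apply/word_valP; rewrite word_reprK. Qed.

Lemma word_inv_cat u v : word_inv (u ++ v) = word_inv v ++ word_inv u.
Proof. by rewrite /word_inv map_cat rev_cat. Qed.

Lemma word_invK : involutive word_inv.
Proof.
move=> w; rewrite /word_inv map_rev revK -map_comp -[RHS]map_id.
by apply: eq_map => -[s b] /=; rewrite negbK.
Qed.

Lemma word_catV w : word_eq (w ++ word_inv w) [::].
Proof.
elim: w => [|[s b] w IH]; first exact: word_eq_refl.
rewrite -cat1s word_inv_cat -catA [w ++ _]catA.
apply: word_eq_trans (word_eq_cancel s b).
apply: (@word_eq_cat [:: (s, b)] [:: (s, b)] _ [:: (s, ~~ b)]).
  exact: word_eq_refl.
rewrite -[X in word_eq _ X]cat0s.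
by apply: word_eq_cat IH _; exact: word_eq_refl.
Qed.

Lemma word_Vcat w : word_eq (word_inv w ++ w) [::].
Proof. by rewrite -{2}[w]word_invK; exact: word_catV. Qed.

Definition presented_one := word_val [::].
Definition presented_mul x y := word_val (word_repr x ++ word_repr y).
Definition presented_inv x := word_val (word_inv (word_repr x)).

Lemma presented_mulE u v :
  presented_mul (word_val u) (word_val v) = word_val (u ++ v).
Proof. by apply/word_valP/word_eq_cat; exact: word_valK. Qed.

Lemma presented_mulA : associative presented_mul.
Proof.
move=> x y z; rewrite -[x]word_reprK -[y]word_reprK -[z]word_reprK.
by rewrite !presented_mulE catA.
Qed.

Lemma presented_mul1 : left_id presented_one presented_mul.
Proof. by move=> x; rewrite -[x]word_reprK presented_mulE. Qed.

Lemma presented_mulr1 : right_id presented_one presented_mul.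
Proof. by move=> x; rewrite -[x]word_reprK presented_mulE cats0. Qed.

Lemma presented_mulV : left_inverse presented_one presented_inv presented_mul.
Proof.
move=> x; rewrite -{2}[x]word_reprK presented_mulE.
by apply/word_valP; exact: word_Vcat.
Qed.

Lemma presented_mulrV : right_inverse presented_one presented_inv presented_mul.
Proof.
move=> x; rewrite -{1}[x]word_reprK presented_mulE.
by apply/word_valP; exact: word_catV.
Qed.

HB.instance Definition _ := isGroup.Build presented presented_mulA
  presented_mul1 presented_mulr1 presented_mulV presented_mulrV.

End Presentation.

Definition left_coset (G : groupType) (g : G) (K : set G) : set G :=
  [set (g * k)%g | k in K].

Definition left_cosets (G : groupType) (K : set G) : set (set G) :=
  [set left_coset g K | g in [set: G]].

Record graph_of_groups := GraphOfGroups {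
  base :> graph;
  vertex_group : vertex base -> groupType;
  edge_group : edge base -> groupType;
  at_source : forall e, {multiplicative edge_group e -> vertex_group (source e)};
  at_target : forall e, {multiplicative edge_group e -> vertex_group (target e)};
  at_source_inj : forall e, injective (at_source e);
  at_target_inj : forall e, injective (at_target e) }.

Definition finite_index_injections (Gam : graph_of_groups) :=
  forall e : edge Gam,
    finite_set (left_cosets (range (at_source e))) /\
    finite_set (left_cosets (range (at_target e))).

Section FundamentalGroup.
Variables (Gam : graph_of_groups) (F : set (edge Gam)).

Inductive pi1_generator :=
| vertex_elt (v : vertex Gam) (x : vertex_group v)
| stable_letter (e : edge Gam).

(* Serre's presentation relative to a maximal tree with edge set [F]. *)
Inductive pi1_rel : seq (pi1_generator * bool) ->
    seq (pi1_generator * bool) -> Prop :=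
| pi1_rel_vertex v (x y : vertex_group v) :
    pi1_rel [:: (vertex_elt x, true); (vertex_elt y, true)]
            [:: (vertex_elt (x * y)%g, true)]
| pi1_rel_edge e (a : edge_group e) :
    pi1_rel [:: (stable_letter e, true); (vertex_elt (at_target e a), true)]
            [:: (vertex_elt (at_source e a), true); (stable_letter e, true)]
| pi1_rel_tree e : F e -> pi1_rel [:: (stable_letter e, true)] [::].

Definition pi1 : groupType := presented pi1_rel.

Definition pi1_vertex v (x : vertex_group v) : pi1 :=
  word_val pi1_rel [:: (vertex_elt x, true)].

Definition pi1_stable e : pi1 := word_val pi1_rel [:: (stable_letter e, true)].

Definition pi1_vertex_group v : set pi1 := range (@pi1_vertex v).

Definition pi1_edge_group e : set pi1 :=
  [set pi1_vertex (at_source e a) | a in [set: edge_group e]].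

Definition coset_space (K : set pi1) := {C : set pi1 | left_cosets K C}.

Definition mk_coset (g : pi1) (K : set pi1) : coset_space K :=
  exist _ (left_coset g K) (ex_intro2 _ _ g I erefl).

Definition coset_repr (K : set pi1) (C : coset_space K) : pi1 :=
  projT1 (cid2 (svalP C)).

(* The end points of an edge do not depend on the coset representative, by
   the relations [pi1_rel_edge]. *)
Definition bass_serre_tree : graph :=
  @Graph {v : vertex Gam & coset_space (pi1_vertex_group v)}
    {e : edge Gam & coset_space (pi1_edge_group e)}
    (fun E => existT _ (source (projT1 E))
       (mk_coset (coset_repr (projT2 E)) _))
    (fun E => existT _ (target (projT1 E))
       (mk_coset (coset_repr (projT2 E) * pi1_stable (projT1 E))%g _)).

Definition bass_serre_act (g : pi1) (x : vertex bass_serre_tree) :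
    vertex bass_serre_tree :=
  existT _ (projT1 x) (mk_coset (g * coset_repr (projT2 x))%g _).

End FundamentalGroup.

(* Main.v *)
Require Import Defs.
From HB Require Import structures.
From mathcomp Require Import all_boot all_order all_algebra.
From mathcomp Require Import all_classical all_reals all_analysis.
From mathcomp Require Import zify lra.
From Stdlib Require Import Eqdep.

(* Read from a base vertex of [T], the logarithm of a cross ratio is a sum of
   branching heights up to a bounded error, and all three quasiconformality
   criteria yield the same coarse control of these heights. It follows that,
   for clopen sets [W], [A1] and [A2], only finitely many translates [V] of [W]
   are such that both [A1] and its complement meet [V] while both [A2] and its
   complement meet the complement of [V]. In particular, fixing finitely many
   boxes whose translates cover the triple space, every clopen set crosses only
   finitely many translates of the sides of these boxes. This number of
   crossings is an invariant cost which is submodular under intersection and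
   union. There are finitely many orbits of clopen sets of bounded cost, and
   every two points are separated by such a set; among the sets separating two
   points, those of least cost, ties being broken by the crossings with the
   other sets of bounded cost, are pairwise nested. They are dual to a locally
   finite tree on which [G] acts with finite quotient, and Bass-Serre theory
   gives the graph of groups. A subgroup fixes a vertex of this tree if and
   only if the sets separating the translates of any given pair of points can
   be chosen in a finite family, that is, if and only if its orbits of pairs
   are precompact. *)

Set Implicit Arguments.
Unset Strict Implicit.
Unset Printing Implicit Defensive.

Local Open Scope classical_set_scope.

(** [G] acts only on the boundary of [T], not on [T], and the geometry it preserves is preserved
    only coarsely. Counts of clopen sets are exactly invariant, which is why the argument is phrased
    with them. Submodularity alone does not uncross two sets of least cost, because equality may
    hold. The tie-break works since a cheap set [U] that crosses [V] is itself counted among the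
    sets crossing [V], but crosses no corner of [U] and [V]: the second inequality is strict. For
    the second count to be finite, the cheap sets must form finitely many orbits. Translate a cheap
    set so that a smallest box side around its complement is one of finitely many sets [W]. If
    infinitely many cheap sets had the same [W], they would accumulate at a point; box sides inside
    [W] nest around this point in arbitrarily long chains, and a cheap set splitting a small enough
    neighbourhood would cross the whole chain, so that its cost would be too large. The metric
    enters only through [ca_conv]. There, four points in bounded position both before and after
    applying [g] control every other point, because the distortion of cross ratios is bounded in
    both directions. *)

Section FiniteSets.
Variable T : choiceType.
Implicit Types A B : set T.

Definition ncard A : nat := size (finmap.enum_fset (fset_set A)).

Lemma ncardS A B : finite_set B -> A `<=` B -> (ncard A <= ncard B)%N.
Proof.
move=> fB AB; apply: finmap.fsubset_leq_card.
by rewrite -fset_set_sub//; exact: sub_finite_set fB.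
Qed.

Lemma ncard_proper A B : finite_set B -> A `<` B -> (ncard A < ncard B)%N.
Proof.
move=> fB [AB nBA]; have fA := sub_finite_set AB fB.
apply: finmap.fproper_ltn_card; rewrite finmap.fproperE; apply/andP; split.
  by rewrite -fset_set_sub.
by apply/negP; rewrite -fset_set_sub.
Qed.

Lemma ncardUI A B : finite_set A -> finite_set B ->
  (ncard (A `|` B) + ncard (A `&` B) = ncard A + ncard B)%N.
Proof. by move=> fA fB; rewrite /ncard fset_setU// fset_setI// finmap.cardfsUI. Qed.

Lemma finite_proper_ind (P : set T -> Prop) :
  (forall A, finite_set A -> (forall A', A' `<` A -> P A') -> P A) ->
  forall A, finite_set A -> P A.
Proof.
move=> IH A; move: {2}(ncard A) (leqnn (ncard A)) => n.
elim: n A => [|n IHn] A An fA; apply: IH => // A' A'A.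
  by have := ncard_proper fA A'A; lia.
apply: IHn; last by apply: sub_finite_set fA; case: A'A.
by have := ncard_proper fA A'A; lia.
Qed.

End FiniteSets.

(** * Minimal members of finite families and induction over compact sets *)

Lemma finite_minimal (T : Type) (F : set (set T)) (U : set T) :
  finite_set F -> F U ->
  exists2 V, F V /\ V `<=` U & forall W, F W -> W `<=` V -> W = V.
Proof.
move=> fF FU; have : finite_set [set V | F V /\ V `<=` U].
  by apply: sub_finite_set fF => V [].
set I := [set _ | _]; move E0: I => J fJ.
move: fJ U FU @I E0; elim/finite_proper_ind => {}J fJ IH U FU I IJ.
have [mU|nm] := pselect (forall W, F W -> W `<=` U -> W = U); first by exists U; [split|].
have [V [FV VU ne]] : exists V, [/\ F V, V `<=` U & V <> U].
  apply: contrapT => no; apply: nm => V FV VU; apply: contrapT => ne.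
  by apply: no; exists V.
have [|X [FX XV] mX] := IH [set X | F X /\ X `<=` V] _ V FV erefl.
  rewrite -IJ; split; first by move=> X [FX XV]; split=> // x /XV/VU.
  move=> h; have [_ UV] : F U /\ U `<=` V by apply: h; split.
  by apply: ne; apply/seteqP.
by exists X => //; split=> // x /XV/VU.
Qed.

(** Compactness as an induction principle. If [P] failed on [K], the sets [S] such that [P] holds on
    [K] minus [S] would form a proper filter containing [K], and a cluster point of it would
    contradict the local hypothesis. Most compactness arguments below take this form. *)
Lemma compact_ind (T : topologicalType) (P : set T -> Prop) (K : set T) :
  P set0 -> (forall U V, P U -> P V -> P (U `|` V)) ->
  (forall U V, U `<=` V -> P V -> P U) ->
  (forall x, K x -> exists2 U, open_nbhs x U & P U) -> compact K -> P K.
Proof.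
move=> P0 PU PS Ploc cK; apply: contrapT => nPK.
pose F : set_system T := [set S | P (K `&` ~` S)].
have FF : ProperFilter F.
  split; first by rewrite /F /= setC0 setIT.
  split; rewrite /F /=.
  - by rewrite setCT setI0.
  - move=> S S' h h'; apply: PS (PU _ _ h h').
    by rewrite setCI setIUr.
  - move=> S S' SS'; apply: PS; apply: setIS; exact: subsetC.
have [|x [Kx cx]] := cK F FF; first by rewrite /F /= setICr.
have [U [oU Ux] PU'] := Ploc x Kx.
have [|y [nUy Uy]] := cx (~` U) U _ (open_nbhs_nbhs (conj oU Ux)).
  by rewrite /F /= setCK; apply: PS PU'; exact: subIsetr.
exact: nUy.
Qed.

Lemma compact_subtype (T : topologicalType) (A C : set T) :
  C `<=` A -> compact C -> compact (set_val @^-1` C : set (set_type A)).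
Proof.
move=> CA cC F FF FC.
have [x [Cx cx]] := cC _ (fmap_proper_filter (set_val : set_type A -> T) FF) FC.
exists (exist _ x (mem_set (CA x Cx))); split=> //.
move=> P N FP [_ [[W oW <-] Wx WN]].
have h1 : (fmap (set_val : set_type A -> T) F) (set_val @` P).
  by apply: (@filterS _ F _ P) => // y Py; exists y.
have [_ [[y Py <-] Wy]] := cx _ W h1 (open_nbhs_nbhs (conj oW Wx)).
by exists y; split=> //; exact: WN.
Qed.

Lemma open_setX (T U : topologicalType) (P : set T) (Q : set U) :
  open P -> open Q -> open (P `*` Q).
Proof.
move=> oP oQ; rewrite openE => -[x y] /= [Px Qy].
by exists (P, Q) => //; split; exact: open_nbhs_nbhs.
Qed.

Lemma finite_bounded (T : choiceType) (s : set T) (f : T -> nat) : finite_set s ->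
  exists N, forall x, s x -> (f x <= N)%N.
Proof.
move=> /finite_seqP[l ->]; elim: l => [|x l [N hN]]; first by exists 0%N.
exists (maxn (f x) N) => y /=; rewrite inE leq_max => /orP[/eqP ->|/hN ->].
  by rewrite leqnn.
by rewrite orbT.
Qed.

Lemma finite_nbhd (T : topologicalType) (Y : set (set T)) (b : T) :
  finite_set Y -> (forall U, Y U -> clopen U) ->
  exists D, [/\ clopen D, D b & forall U, Y U -> D `<=` U \/ D `<=` ~` U].
Proof.
move=> /finite_seqP[l ->]; elim: l => [|V l IH] hY.
  by exists setT; split=> //; exact: clopenT.
have [|D [cD Db hD]] := IH; first by move=> U Ul; apply: hY; rewrite /= inE Ul orbT.
have cV : clopen V by apply: hY; rewrite /= inE eqxx.
have [Vb|nVb] := pselect (V b).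
  exists (D `&` V); split=> //; first exact: clopenI.
  move=> U; rewrite /= inE => /orP[/eqP ->|/hD[h|h]]; first by left; exact: subIsetr.
    by left=> x [/h].
  by right=> x [/h].
exists (D `&` ~` V); split=> //; first by apply: clopenI => //; exact: clopenC.
move=> U; rewrite /= inE => /orP[/eqP ->|/hD[h|h]]; first by right; exact: subIsetr.
  by left=> x [/h].
by right=> x [/h].
Qed.

(** * Walks and geodesics in trees *)

Section GraphWalks.
Variable G : graph.
Implicit Types (u v w : vertex G) (d e : dart G) (p q : seq (dart G)).

Lemma reverseK : involutive (@reverse G).
Proof. by case=> e b; rewrite /reverse /= negbK. Qed.

Lemma origin_reverse d : origin (reverse d) = terminus d.
Proof. by case: d => e []. Qed.

Lemma terminus_reverse d : terminus (reverse d) = origin d.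
Proof. by case: d => e []. Qed.

Definition walk_rev p := rev [seq reverse d | d <- p].

Lemma walk_cat u p q w :
  walk u (p ++ q) w <-> exists2 v, walk u p v & walk v q w.
Proof.
elim: p u => [|d p IH] u /=.
  by split=> [h|[v ->]]; first exists u.
split=> [[<- /IH[v h h']]|[v [<- h] h']]; first by exists v.
by split=> //; apply/IH; exists v.
Qed.

Lemma walk_catI u p v q w : walk u p v -> walk v q w -> walk u (p ++ q) w.
Proof. by move=> h h'; apply/walk_cat; exists v. Qed.

Lemma walk_rcons u p d w :
  walk u (rcons p d) w <-> walk u p (origin d) /\ terminus d = w.
Proof.
rewrite -cats1; split=> [/walk_cat[v h /= [-> ->]]//|[h <-]].
exact: (walk_catI h).
Qed.

Lemma walk_revP u p v : walk u p v -> walk v (walk_rev p) u.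
Proof.
elim: p u => [|d p IH] u /=; first by [].
move=> [<- /IH h]; rewrite /walk_rev /= rev_cons; apply/walk_rcons.
by rewrite origin_reverse terminus_reverse.
Qed.

Lemma walk_end u p v w : walk u p v -> walk u p w -> v = w.
Proof.
elim: p u => [|d p IH] u /=; first by move=> <-.
by move=> [_ h] [_]; exact: IH h.
Qed.

Lemma walk_last u p v : walk u p v -> last u [seq terminus d | d <- p] = v.
Proof. by elim: p u => [//|d p IH] u /= [_ /IH]. Qed.

Lemma reduced_cat2 p d d' q : reduced (p ++ d :: d' :: q) <->
  [/\ reduced (rcons p d), d' <> reverse d & reduced (d' :: q)].
Proof.
elim: p => [|c [|c' p] IH].
- by rewrite [_ ++ _]/= [rcons _ _]/=; split=> [[]|[]].
- rewrite [_ ++ _]/= [rcons _ _]/=.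
  split=> [[h1 [h2 h3]]|[[h1 _] h2 h3]]; first by split.
  by split.
- have -> : (c :: c' :: p) ++ d :: d' :: q = c :: c' :: (p ++ d :: d' :: q) by [].
  have -> : rcons (c :: c' :: p) d = c :: c' :: rcons p d by [].
  split=> [[h] /IH[h1 h2 h3]|[[h h1] h2 h3]]; first by split.
  by split=> //; apply/IH; split.
Qed.

Lemma reduced_tl d p : reduced (d :: p) -> reduced p.
Proof. by case: p => [//|d' p] []. Qed.

Lemma reduced_catl p q : reduced (p ++ q) -> reduced p.
Proof.
elim: p => [//|d [//|d' p] IH].
by rewrite !cat_cons => -[h /IH h']; split.
Qed.

Lemma reduced_catr p q : reduced (p ++ q) -> reduced q.
Proof. by elim: p => [//|d p IH] /= /reduced_tl. Qed.

Lemma reduced_rev p : reduced p -> reduced (walk_rev p).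
Proof.
elim: p => [//|d [//|d' p] IH] [h /IH].
rewrite /walk_rev /= !rev_cons => h'.
rewrite -cats1 cat_rcons; apply/reduced_cat2; split=> //.
by rewrite reverseK => /esym.
Qed.

Lemma walk_reduce u p v : walk u p v -> exists2 q, walk u q v & reduced q.
Proof.
elim: p u => [|d p IH] u /=; first by move=> <-; exists [::].
move=> [<- /IH[[|d' q] wq rq]].
  by exists [:: d] => //=; split.
have [e|ne] := pselect (d' = reverse d); last by exists [:: d, d' & q].
exists q; last exact: reduced_tl rq.
by move: wq => /= [_]; rewrite e terminus_reverse.
Qed.

Lemma walk_rev_cons d p : walk_rev (d :: p) = rcons (walk_rev p) (reverse d).
Proof. by rewrite /walk_rev /= rev_cons. Qed.

Lemma size_walk_rev p : size (walk_rev p) = size p.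
Proof. by rewrite /walk_rev size_rev size_map. Qed.

Lemma reduced_diverge p q : reduced p -> reduced q ->
  (forall d p' e q', p = d :: p' -> q = e :: q' -> d <> e) ->
  reduced (walk_rev p ++ q).
Proof.
case: p q => [//|d p] [|e q] rp rq h; first by rewrite cats0; exact: reduced_rev.
have rdp := reduced_rev rp.
rewrite walk_rev_cons cat_rcons; apply/reduced_cat2; split=> //.
  by move: rdp; rewrite walk_rev_cons.
by rewrite reverseK => ed; exact: (h _ _ _ _ erefl erefl).
Qed.

Hypothesis no_loop : forall u p, walk u p u -> reduced p -> p = [::].

(** Once the common initial darts are removed, the reverse of one walk followed by the other is a
    reduced closed walk. *)
Lemma walk_unique u v p q : walk u p v -> reduced p ->
  walk u q v -> reduced q -> p = q.
Proof.
elim: p u q => [|d p IH] u q.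
  by move=> /= -> _ /no_loop h /h.
case: q => [|e q] wp rp wq rq.
  by move: wq wp => /= -> wp; exact: (@no_loop v (d :: p)).
have [de|de] := pselect (d = e).
  move: wp wq; rewrite -{}de in rq * => -[_ wp] [_ wq]; congr cons.
  exact: (IH _ _ wp (reduced_tl rp) wq (reduced_tl rq)).
have r : reduced (walk_rev (d :: p) ++ e :: q).
  by apply: reduced_diverge => // ? ? ? ? [<- _] [<- _].
have := no_loop (walk_catI (walk_revP wp) wq) r.
by move=> /(congr1 size); rewrite size_cat /= addnS.
Qed.

Lemma is_treeI : inhabited (vertex G) -> (forall u v, exists p, walk u p v) ->
  is_tree G.
Proof.
move=> i c; split=> // u v.
have [p /walk_reduce[q wq rq]] := c u v; exists q; split=> // r [wr rr].
exact: (walk_unique wq).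
Qed.

End GraphWalks.

Lemma tree_no_loop (G : graph) : is_tree G ->
  forall (u : vertex G) p, walk u p u -> reduced p -> p = [::].
Proof.
move=> [_ t] u p wp rp; have [q [_ uq]] := t u u.
by rewrite -(uq p (conj wp rp)); apply: uq; split.
Qed.

Section CommonPrefix.
Variable A : Type.
Implicit Types s t : seq A.

Fixpoint lcp s t : nat :=
  match s, t with
  | x :: s', y :: t' => if pselect (x = y) then (lcp s' t').+1 else 0
  | _, _ => 0
  end.

Lemma lcp_leq k s t : (k <= lcp s t)%N <-> (k <= size s)%N /\ take k s = take k t.
Proof.
elim: k s t => [|k IH] s t; first by rewrite !take0; split.
case: s t => [|x s] [|y t] //=; try by split=> // -[].
case: pselect => /= [xy|ne]; last by split=> // -[_ [/ne]].
by rewrite !ltnS; split=> [/IH[h ->]|[h [_ e]]]; [rewrite xy|apply/IH].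
Qed.

Lemma lcpC s t : lcp s t = lcp t s.
Proof.
elim: s t => [|x s IH] [|y t] //=.
case: pselect => /= xy; case: pselect => //= yx; rewrite ?IH//.
- by case: yx.
- by case: xy.
Qed.

Lemma lcp_ultra s t u : (minn (lcp s t) (lcp t u) <= lcp s u)%N.
Proof.
apply/lcp_leq; have [st tu] : (minn (lcp s t) (lcp t u) <= lcp s t)%N /\
  (minn (lcp s t) (lcp t u) <= lcp t u)%N by lia.
move: st tu; set k := minn _ _ => /lcp_leq[ks ->] /lcp_leq[_ ->].
by split.
Qed.

Lemma lcp_size s t : (lcp s t <= size s)%N.
Proof. by have /lcp_leq[] := leqnn (lcp s t). Qed.

Lemma lcp_sizer s t : (lcp s t <= size t)%N.
Proof. by rewrite lcpC lcp_size. Qed.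

Lemma lcp_take s t : take (lcp s t) s = take (lcp s t) t.
Proof. by have /lcp_leq[] := leqnn (lcp s t). Qed.

Lemma lcp_drop s t d s' e t' :
  drop (lcp s t) s = d :: s' -> drop (lcp s t) t = e :: t' -> d <> e.
Proof.
elim: s t => [|x s IH] [|y t] //=; case: pselect => [_|ne] /=; first exact: IH.
by move=> [<- _] [<- _].
Qed.

End CommonPrefix.

Section TreeDistance.
Variables (T : graph) (hT : is_tree T).
Implicit Types (u v w o m x y z t : vertex T) (p q : seq (dart T)).

Definition geod u v : seq (dart T) :=
  projT1 (cid (hT.2 u v)).

Lemma geod_walk u v : walk u (geod u v) v.
Proof. by rewrite /geod; case: cid => p [[]]. Qed.

Lemma geod_reduced u v : reduced (geod u v).
Proof. by rewrite /geod; case: cid => p [[]]. Qed.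

Lemma geodP u p v : walk u p v -> reduced p -> geod u v = p.
Proof.
move=> wp rp; apply: (walk_unique (tree_no_loop hT) (geod_walk u v)) => //.
exact: geod_reduced.
Qed.

Lemma geod_eq u v : geod u v = [::] -> u = v.
Proof. by move=> e; have := geod_walk u v; rewrite e. Qed.

Lemma geodxx u : geod u u = [::].
Proof. exact: geodP. Qed.

Definition tdist u v := size (geod u v).

(** In a tree the Gromov product based at [o] is the length of the common initial part of two
    geodesics from [o]; [tdist_gp] justifies the name. The ultrametric inequality then becomes a
    property of common prefixes. *)
Definition tgp o u v := lcp (geod o u) (geod o v).

Lemma geod_rev u v : geod v u = walk_rev (geod u v).
Proof.
by apply: geodP; [apply/walk_revP/geod_walk|apply/reduced_rev/geod_reduced].
Qed.

Lemma tdistC u v : tdist u v = tdist v u.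
Proof. by rewrite /tdist geod_rev size_walk_rev. Qed.

Lemma tdistxx u : tdist u u = 0%N.
Proof. by rewrite /tdist geodxx. Qed.

Definition geod_vertex o u k : vertex T :=
  last o [seq terminus d | d <- take k (geod o u)].

Lemma geod_vertex_walk o u k :
  walk o (take k (geod o u)) (geod_vertex o u k).
Proof.
have := geod_walk o u; rewrite -{1}(cat_take_drop k (geod o u)).
by move=> /walk_cat[v h _]; rewrite /geod_vertex (walk_last h).
Qed.

Lemma geod_vertex_walk' o u k :
  walk (geod_vertex o u k) (drop k (geod o u)) u.
Proof.
have := geod_walk o u; rewrite -{1}(cat_take_drop k (geod o u)).
by move=> /walk_cat[v /(walk_end (geod_vertex_walk o u k)) <-].
Qed.

Lemma geod_geod_vertex o u k : geod o (geod_vertex o u k) = take k (geod o u).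
Proof.
apply: geodP; first exact: geod_vertex_walk.
by have := geod_reduced o u; rewrite -{1}(cat_take_drop k (geod o u)) => /reduced_catl.
Qed.

Lemma geod_geod_vertex' o u k : geod (geod_vertex o u k) u = drop k (geod o u).
Proof.
apply: geodP; first exact: geod_vertex_walk'.
by have := geod_reduced o u; rewrite -{1}(cat_take_drop k (geod o u)) => /reduced_catr.
Qed.

Lemma geod_inj o u v : geod o u = geod o v -> u = v.
Proof.
by move=> e; have := geod_walk o u; rewrite e => /walk_end; apply; exact: geod_walk.
Qed.

(** Beyond their common part the two geodesics start with different darts, so the reverse of one
    tail followed by the other tail is the geodesic from [u] to [v]. *)
Lemma tdist_gp o u v : (tdist u v + 2 * tgp o u v = tdist o u + tdist o v)%N.
Proof.
have e : geod_vertex o u (tgp o u v) = geod_vertex o v (tgp o u v).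
  by apply: (@geod_inj o); rewrite !geod_geod_vertex /tgp lcp_take.
have wu := geod_vertex_walk' o u (tgp o u v).
have wv := geod_vertex_walk' o v (tgp o u v); rewrite -e in wv.
have r : reduced (walk_rev (drop (tgp o u v) (geod o u)) ++
                  drop (tgp o u v) (geod o v)).
  apply: reduced_diverge.
  - by rewrite -geod_geod_vertex'; exact: geod_reduced.
  - by rewrite -geod_geod_vertex'; exact: geod_reduced.
  - by move=> d p' e' q'; exact: lcp_drop.
rewrite /tdist (geodP (walk_catI (walk_revP wu) wv) r).
rewrite size_cat size_walk_rev !size_drop /tgp.
have := lcp_size (geod o u) (geod o v); have := lcp_sizer (geod o u) (geod o v).
lia.
Qed.

Lemma tdist_triangle v u w : (tdist u w <= tdist u v + tdist v w)%N.
Proof. by have := tdist_gp v u w; rewrite (tdistC u v); lia. Qed.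

Lemma tgp_ultra o x y z : (minn (tgp o x y) (tgp o y z) <= tgp o x z)%N.
Proof. exact: lcp_ultra. Qed.

Lemma tgpC o x y : tgp o x y = tgp o y x.
Proof. exact: lcpC. Qed.

(* In the base [m] the hypothesis says that the Gromov product of the end
   points vanishes, while consecutive points far from [m] have a positive one. *)
Lemma coarse_path_near (S : nat) m y0 (ys : seq (vertex T)) :
  (forall i, (i < size ys)%N ->
     (tdist (nth y0 (y0 :: ys) i) (nth y0 (y0 :: ys) i.+1) <= S)%N) ->
  (tdist y0 m + tdist m (last y0 ys) = tdist y0 (last y0 ys))%N ->
  exists2 i, (i <= size ys)%N & (tdist (nth y0 (y0 :: ys) i) m <= S)%N.
Proof.
move=> hS hm; apply: contrapT => no.
have far i : (i <= size ys)%N -> (S < tdist m (nth y0 (y0 :: ys) i))%N.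
  move=> i_ys; rewrite ltnNge; apply/negP => h; apply: no; exists i => //.
  by rewrite tdistC.
have pos i : (i <= size ys)%N -> (0 < tgp m y0 (nth y0 (y0 :: ys) i))%N.
  elim: i => [_|i IH i_ys].
    by have := tdist_gp m y0 y0; rewrite tdistxx; have := far 0%N isT; rewrite /=; lia.
  have := IH (ltnW i_ys); have := hS i i_ys.
  have := far i (ltnW i_ys); have := far i.+1 i_ys.
  have := tdist_gp m (nth y0 (y0 :: ys) i) (nth y0 (y0 :: ys) i.+1).
  by have := tgp_ultra m y0 (nth y0 (y0 :: ys) i) (nth y0 (y0 :: ys) i.+1); lia.
have := pos (size ys) (leqnn _); rewrite nth_last /=.
by have := tdist_gp m y0 (last y0 ys); rewrite (tdistC m y0); lia.
Qed.

Lemma tdist_geod_vertex o u k : (k <= tdist o u)%N ->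
  tdist o (geod_vertex o u k) = k /\ tdist (geod_vertex o u k) u = (tdist o u - k)%N.
Proof.
move=> ku; rewrite {1 2}/tdist geod_geod_vertex geod_geod_vertex' size_drop.
by rewrite size_takel.
Qed.

Lemma geod_vertex_lcp o u v k : (k <= tgp o u v)%N ->
  geod_vertex o u k = geod_vertex o v k.
Proof.
by move=> /lcp_leq[_ e]; apply: (@geod_inj o); rewrite !geod_geod_vertex.
Qed.

Lemma tgp_geod_vertex o u k : (k <= tdist o u)%N ->
  tgp o (geod_vertex o u k) u = k.
Proof.
move=> ku; have := tdist_gp o (geod_vertex o u k) u.
by have [-> ->] := tdist_geod_vertex ku; lia.
Qed.

(* With base point [x], the geodesics from [x] to [y] and from [z] to [t] are
   joined by a segment of the geodesic from [x] to [z]. *)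
Lemma geodesics_bridge x y z t : exists m n,
  [/\ (tdist x m + tdist m y = tdist x y)%N,
      (tdist z n + tdist n t = tdist z t)%N &
      (2 * tdist m n <= (tdist x t + tdist y z) - (tdist x y + tdist z t))%N].
Proof.
have ayz := tgp_ultra x y z t; have bzt := tgp_ultra x z t y.
have czy := tgp_ultra x t y z.
have e1 := tdist_gp x y z; have e2 := tdist_gp x z t; have e3 := tdist_gp x y t.
have ly : (tgp x z y <= tdist x y)%N by exact: lcp_sizer.
have lz : (tgp x z y <= tdist x z)%N by exact: lcp_size.
have lz' : (tgp x z t <= tdist x z)%N by exact: lcp_size.
have mE := geod_vertex_lcp (leqnn (tgp x z y)).
(* [m] is where the geodesic from [x] to [z] leaves the one to [y]. A point of it lies on the
   geodesic from [z] to [t] as soon as its height is at least [tgp x z t]; [n] is the first such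
   point not before [m], whence the maximum. *)
pose m := geod_vertex x z (tgp x z y); pose k := maxn (tgp x z y) (tgp x z t).
have kz : (k <= tdist x z)%N by rewrite /k; lia.
pose n := geod_vertex x z k.
have [m1 m2] := tdist_geod_vertex ly; rewrite -mE -/m in m1 m2.
have [n1 n2] := tdist_geod_vertex kz; rewrite -/n in n1 n2.
exists m, n; split; first by rewrite m1 m2; lia.
- have gnt : (tgp x n t = tgp x z t)%N.
    have := tgp_ultra x n z t; have := tgp_ultra x z n t.
    have : tgp x n z = k by exact: tgp_geod_vertex.
    rewrite (tgpC x z n) /k => gnz.
    have : (tgp x n t <= tdist x n)%N by exact: lcp_size.
    have : (tgp x n t <= tdist x t)%N by exact: lcp_sizer.
    have [|] := leqP (tgp x z y) (tgp x z t); last by lia.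
    move=> h; rewrite /k in n1 gnz *; lia.
  have := tdist_gp x n t; rewrite (tdistC z n) n2 gnt n1 /k; lia.
- have gmn : (tgp x m n = tgp x z y)%N.
    have := tgp_ultra x m z n; have -> : tgp x m z = tgp x z y by exact: tgp_geod_vertex.
    have : tgp x n z = k by exact: tgp_geod_vertex.
    rewrite (tgpC x z n) /k => ->.
    have : (tgp x m n <= tdist x m)%N by exact: lcp_size.
    by rewrite m1; lia.
  have := tdist_gp x m n; rewrite m1 n1 gmn /k.
  rewrite (tgpC x y z) (tgpC x t y) (tgpC x t z) in e1 ayz bzt czy *; lia.
Qed.

End TreeDistance.

(** * From actions on trees to graphs of groups *)

Lemma In_walk_rev (G : graph) (p : seq (dart G)) c :
  List.In c (walk_rev p) -> exists2 d, List.In d p & c = reverse d.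
Proof.
elim: p => [//|d p IH]; rewrite walk_rev_cons -cats1 => /List.in_app_iff[|].
  by move/IH=> [e pe ->]; exists e => //; right.
by move=> [<-|//]; exists d => //; left.
Qed.

Record subgroup (G : groupType) := Subgroup {
  carrier : set G;
  subgroup1 : carrier 1%g;
  subgroupM : forall x y, carrier x -> carrier y -> carrier (x * y)%g;
  subgroupV : forall x, carrier x -> carrier (x^-1)%g }.

Section SubgroupType.
Variables (G : groupType) (K : subgroup G).

Record subgroup_type := SubgroupElt {
  subgroup_val : G;
  subgroup_valP : carrier K subgroup_val }.

HB.instance Definition _ := gen_eqMixin subgroup_type.
HB.instance Definition _ := gen_choiceMixin subgroup_type.

Lemma subgroup_val_inj : injective subgroup_val.
Proof.
case=> x Kx [y Ky] /= e; case: _ / e Ky => Ky.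
by congr SubgroupElt; exact: Prop_irrelevance.
Qed.

Let one := SubgroupElt (subgroup1 K).
Let mul x y := SubgroupElt (subgroupM (subgroup_valP x) (subgroup_valP y)).
Let inv x := SubgroupElt (subgroupV (subgroup_valP x)).

Let mulA : associative mul.
Proof. by move=> x y z; apply: subgroup_val_inj; exact: mulgA. Qed.
Let mul1 : left_id one mul.
Proof. by move=> x; apply: subgroup_val_inj; exact: mul1g. Qed.
Let mulr1 : right_id one mul.
Proof. by move=> x; apply: subgroup_val_inj; exact: mulg1. Qed.
Let mulV : left_inverse one inv mul.
Proof. by move=> x; apply: subgroup_val_inj; exact: mulVg. Qed.
Let mulrV : right_inverse one inv mul.
Proof. by move=> x; apply: subgroup_val_inj; exact: mulgV. Qed.

HB.instance Definition _ := isGroup.Build subgroup_type mulA mul1 mulr1 mulV mulrV.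

End SubgroupType.

Definition multiplicative_of (G H : groupType) (f : G -> H)
    (fM : {morph f : x y / (x * y)%g}) : {multiplicative G -> H} :=
  HB.pack f (isMultiplicative.Build G H f fM).

Lemma morph1 (G H : groupType) (f : G -> H) :
  {morph f : x y / (x * y)%g} -> f 1%g = 1%g.
Proof. by move=> fM; apply: (@mulIg _ (f 1%g)); rewrite -fM !mul1g. Qed.

Lemma morphV (G H : groupType) (f : G -> H) :
  {morph f : x y / (x * y)%g} -> {morph f : x / x^-1%g}.
Proof.
move=> fM x; apply/esym/mulg1_eq; rewrite -fM mulgV; exact: morph1.
Qed.

(** * Labelled walks and maps out of presented groups *)

Section Potential.
Variables (X : graph) (hX : is_tree X) (P : groupType) (lam : edge X -> P).

Definition dart_label (d : dart X) := if d.2 then lam d.1 else (lam d.1)^-1%g.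

Definition word_label (p : seq (dart X)) : P :=
  foldr (fun d x => (dart_label d * x)%g) 1%g p.

Lemma word_label_rcons p d :
  word_label (rcons p d) = (word_label p * dart_label d)%g.
Proof. by elim: p => [|c p IH] /=; rewrite ?mul1g ?mulg1// IH mulgA. Qed.

(* Trees are simply connected. *)
Lemma potential (o : vertex X) : exists D : vertex X -> P, D o = 1%g /\
  forall e, D (target e) = (D (source e) * lam e)%g.
Proof.
exists (fun v => word_label (geod hX o v)); split; first by rewrite geodxx.
move=> e; case/lastP E: (geod hX o (source e)) => [|p d].
  have -> : geod hX o (target e) = [:: (e, true)].
    by apply: geodP => //=; rewrite (geod_eq E).
  by rewrite /= mulg1 mul1g.
(* Either the geodesic to the source ends by crossing [e] backwards, and the one to the target is
   shorter by that dart, or appending [e] to it gives a reduced walk. *)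
have [de|ne] := pselect (d = (e, false)).
  have [wp _] : walk o p (target e) /\ True.
    by have := geod_walk hX o (source e); rewrite E de => /walk_rcons[].
  rewrite (_ : geod hX o (target e) = p); first last.
    apply: geodP => //; have := geod_reduced hX o (source e).
    by rewrite E -cats1 => /reduced_catl.
  by rewrite word_label_rcons de /dart_label /= mulgVK.
rewrite (_ : geod hX o (target e) = rcons (rcons p d) (e, true)).
  by rewrite word_label_rcons.
apply: geodP.
  by apply/walk_rcons; split=> //; rewrite -E; exact: geod_walk.
rewrite -cats1 cat_rcons; apply/reduced_cat2; split=> //.
  by rewrite -E; exact: geod_reduced.
by case: (d) ne => a [] // ne [] // ?; subst.
Qed.

End Potential.

Section Evaluation.
Variables (S : Type) (rel : seq (S * bool) -> seq (S * bool) -> Prop).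
Variables (G : groupType) (f : S -> G).

Definition letter_eval (l : S * bool) : G := if l.2 then f l.1 else (f l.1)^-1%g.

Definition word_eval (w : seq (S * bool)) : G :=
  foldr (fun l x => (letter_eval l * x)%g) 1%g w.

Lemma word_eval_cat u v : word_eval (u ++ v) = (word_eval u * word_eval v)%g.
Proof. by elim: u => [|l u IH] /=; rewrite ?mul1g// IH mulgA. Qed.

Hypothesis f_rel : forall u v, rel u v -> word_eval u = word_eval v.

Lemma word_eval_eq u v : word_eq rel u v -> word_eval u = word_eval v.
Proof.
elim=> {u v} [//|u v _ ->//|u v w _ -> _ ->//|u u' v v' _ e _ e'|s b|u v /f_rel//].
  by rewrite !word_eval_cat e e'.
by case: b; rewrite /word_eval /letter_eval /= mulg1 ?mulgV ?mulVg.
Qed.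

Definition presented_eval (x : presented rel) : G := word_eval (word_repr x).

Lemma presented_evalE w : presented_eval (word_val rel w) = word_eval w.
Proof. exact/word_eval_eq/word_valK. Qed.

Lemma presented_evalM : {morph presented_eval : x y / (x * y)%g}.
Proof.
move=> x y; rewrite -[x]word_reprK -[y]word_reprK.
by rewrite [(_ * _)%g]presented_mulE !presented_evalE word_eval_cat.
Qed.

Lemma presented_ind (Q : presented rel -> Prop) : Q 1%g ->
  (forall x y, Q x -> Q y -> Q (x * y)%g) -> (forall x, Q x -> Q x^-1%g) ->
  (forall s, Q (word_val rel [:: (s, true)])) -> forall x, Q x.
Proof.
move=> Q1 QM QV Qs x; rewrite -[x]word_reprK; elim: (word_repr x) => [//|[s b] w IH].
have -> : word_val rel ((s, b) :: w) =
    (word_val rel [:: (s, b)] * word_val rel w)%g by rewrite [RHS]presented_mulE.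
apply: QM IH; case: b => //.
have -> : word_val rel [:: (s, false)] = (word_val rel [:: (s, true)])^-1%g.
  apply/esym/mulg1_eq; rewrite [LHS]presented_mulE; apply/word_valP.
  exact: word_eq_cancel.
exact: QV.
Qed.

End Evaluation.

(** * Orbit representatives and the quotient graph of groups *)

Section Action.
Variables (X : graph) (G : groupType).
Variables (actV : G -> vertex X -> vertex X) (actE : G -> edge X -> edge X).

Record graph_action : Prop := GraphAction {
  actV1 : forall v, actV 1%g v = v;
  actVM : forall g h v, actV (g * h)%g v = actV g (actV h v);
  actE1 : forall e, actE 1%g e = e;
  actEM : forall g h e, actE (g * h)%g e = actE g (actE h e);
  act_source : forall g e, source (actE g e) = actV g (source e);
  act_target : forall g e, target (actE g e) = actV g (target e) }.

Hypothesis hA : graph_action.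

Lemma actVK g v : actV g^-1%g (actV g v) = v.
Proof. by rewrite -actVM// mulVg actV1. Qed.
Lemma actEK g v : actE g^-1%g (actE g v) = v.
Proof. by rewrite -actEM// mulVg actE1. Qed.

Definition act_dart g (d : dart X) : dart X := (actE g d.1, d.2).

Lemma act_origin g d : origin (act_dart g d) = actV g (origin d).
Proof. by case: d => e []; rewrite /origin /= ?act_source ?act_target. Qed.
Lemma act_terminus g d : terminus (act_dart g d) = actV g (terminus d).
Proof. by case: d => e []; rewrite /terminus /= ?act_source ?act_target. Qed.

(** The lift of a finite subtree of the quotient graph: at most one vertex in each orbit, and any
    two of its vertices are joined by a walk inside it. *)
Definition partial_transversal (S : set (vertex X)) :=
  [/\ finite_set S, (forall v g, S v -> S (actV g v) -> actV g v = v) &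
   forall u v, S u -> S v -> exists2 p, walk u p v &
     forall d, List.In d p -> S (source d.1) /\ S (target d.1)].

Definition meets_orbit (S : set (vertex X)) v := exists g, S (actV g v).

(** If the orbit of the terminus is missed, translate the dart until its origin lies in [S] and
    adjoin the new terminus. *)
Lemma partial_transversal_step (S : set (vertex X)) d : partial_transversal S ->
  meets_orbit S (origin d) ->
  exists S', [/\ partial_transversal S', S `<=` S' & meets_orbit S' (terminus d)].
Proof.
move=> [fS tS cS] [g Sg].
have [m|nm] := pselect (meets_orbit S (terminus d)); first by exists S; split.
pose d' := act_dart g d; pose w := terminus d'.
exists (w |` S); split; last by exists g; left; rewrite /w act_terminus.
  split; first by rewrite finite_setU; split=> //; exact: finite_set1.
    have nw h : ~ S (actV h w).
      by move=> h1; apply: nm; exists (h * g)%g; rewrite actVM// -act_terminus.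
    move=> v h [->|Sv]; first by move=> [//|/nw].
    move=> [e|]; last exact: tS.
    by case: (nw h^-1%g); rewrite -e actVK.
  have So : S (origin d') by rewrite act_origin.
  have Sd : (w |` S) (source d'.1) /\ (w |` S) (target d'.1).
    move: So; rewrite /w /origin /terminus; case: (d'.2) => So; split; by [left|right].
  have cw v : S v -> exists2 p, walk v p w &
      forall d, List.In d p -> (w |` S) (source d.1) /\ (w |` S) (target d.1).
    move=> Sv; have [p wp hp] := cS _ _ Sv So.
    exists (rcons p d'); first by apply/walk_rcons.
    move=> c; rewrite -cats1 => /List.in_app_iff[/hp[? ?]|[<-//|//]].
    by split; right.
  move=> u v [->|Su] [->|Sv]; [by exists [::]| | exact: cw |].
    have [p wp hp] := cw _ Sv; exists (walk_rev p); first exact: walk_revP.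
    by move=> c /In_walk_rev[c' /hp h ->].
  have [p wp hp] := cS _ _ Su Sv; exists p => // c /hp[? ?]; split; by right.
by move=> v Sv; right.
Qed.

Lemma partial_transversal_walk (S : set (vertex X)) u p v :
  partial_transversal S -> meets_orbit S u -> walk u p v ->
  exists S', [/\ partial_transversal S', S `<=` S' & meets_orbit S' v].
Proof.
elim: p S u => [|d p IH] S u tS mu /=; first by move=> <-; exists S; split.
move=> [du wp]; rewrite -du in mu.
have [S1 [tS1 SS1 m1]] := partial_transversal_step tS mu.
have [S2 [tS2 S12 m2]] := IH _ _ tS1 m1 wp.
by exists S2; split=> // x /SS1/S12.
Qed.

Lemma transversal_exists (hX : is_tree X) (s : set (vertex X)) :
  finite_set s -> (forall v, exists g u, s u /\ v = actV g u) ->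
  exists2 S, partial_transversal S & (forall v, meets_orbit S v) /\ S !=set0.
Proof.
move=> fs hs; have [[v0] _] := hX.
suff [S [tS So mS]] : exists S, [/\ partial_transversal S, S v0 &
    forall v, s v -> meets_orbit S v].
  exists S => //; split; last by exists v0.
  move=> v; have [g [u [/mS[h Sh] ->]]] := hs v.
  by exists (h * g^-1)%g; rewrite -actVM// mulgVK.
have /(@finite_seqP {classic vertex X})[l ->] := fs.
elim: l => [|x l [S [tS So mS]]].
  exists [set v0]; split=> //; split; first exact: finite_set1.
    by move=> v g -> .
  by move=> u v -> ->; exists [::].
have mo : meets_orbit S v0 by exists 1%g; rewrite actV1.
have [S' [tS' SS' mx]] := partial_transversal_walk tS mo (geod_walk hX v0 x).
exists S'; split=> //; first exact: SS'.
move=> v /=; rewrite inE => /orP[/eqP ->//|/mS[g /SS' h]].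
by exists g.
Qed.

Section BassSerre.
Hypothesis hX : is_tree X.
Variable S : set (vertex X).
Hypotheses (S_transv : partial_transversal S) (S_all : forall v, meets_orbit S v).
Hypothesis S_neq0 : S !=set0.

Definition edge_orbit e : set (edge X) := [set e' | exists g, e' = actE g e].

Lemma edge_orbit_act g e : edge_orbit (actE g e) = edge_orbit e.
Proof.
apply/seteqP; split=> _ [h ->]; first by exists (h * g)%g; rewrite actEM.
by exists (h * g^-1)%g; rewrite -actEM// mulgVK.
Qed.

Lemma edge_orbitP e e' : edge_orbit e = edge_orbit e' -> exists g, e = actE g e'.
Proof.
move=> ee'; have : edge_orbit e e by exists 1%g; rewrite actE1.
by rewrite ee'.
Qed.

Let fundamental e := S (source e) /\ S (target e).

Definition orbit_vertex := {v : vertex X | S v}.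
Definition orbit_edge := {C : set (edge X) | exists e, C = edge_orbit e}.

(** A representative with both ends in [S] is preferred, and is then unique: two of them in one
    orbit would have the same ends, because [S] meets each orbit at most once, and would form a
    closed walk of length two. *)
Lemma edge_repr_exists (j : orbit_edge) : exists e,
  [/\ sval j = edge_orbit e, S (source e) &
      forall e', edge_orbit e = edge_orbit e' -> fundamental e' -> e = e'].
Proof.
case: j => C /= [e ->].
have [[e' [ee' fe']]|no] := pselect (exists e', edge_orbit e = edge_orbit e' /\ fundamental e').
  exists e'; split=> //; first by case: fe'.
  move=> e2 /edge_orbitP[g e'E] f2; have [_ tS _] := S_transv.
  have [s2 t2] := f2; have [s1 t1] := fe'.
  move: s1 t1; rewrite e'E act_source// act_target// => s1 t1.
  have es := tS _ _ s2 s1; have et := tS _ _ t2 t1.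
  apply: contrapT => ne.
  have w : walk (source e2) [:: (e2, true); (actE g e2, false)] (source e2).
    by rewrite /= /origin /terminus /= act_source// act_target// et es.
  have r : reduced [:: (e2, true); (actE g e2, false)].
    by split=> // -[] /ne.
  by have := tree_no_loop hX w r.
have [g Sg] := S_all (source e); exists (actE g e).
rewrite edge_orbit_act act_source//; split=> // e' ee' fe'.
by case: no; exists e'.
Qed.

Definition edge_repr j := projT1 (cid (edge_repr_exists j)).

Lemma edge_reprP j : [/\ sval j = edge_orbit (edge_repr j), S (source (edge_repr j)) &
   forall e', edge_orbit (edge_repr j) = edge_orbit e' -> fundamental e' ->
   edge_repr j = e'].
Proof. by rewrite /edge_repr; case: cid. Qed.

Definition edge_class e : orbit_edge := exist _ (edge_orbit e) (ex_intro _ e erefl).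

Lemma edge_class_act g e : edge_class (actE g e) = edge_class e.
Proof. exact/eq_exist/edge_orbit_act. Qed.

Lemma edge_repr_class e : exists g, actE g (edge_repr (edge_class e)) = e.
Proof.
have [/= /edge_orbitP[g eE] _ _] := edge_reprP (edge_class e).
by exists g.
Qed.

Lemma edge_reprK j : edge_class (edge_repr j) = j.
Proof.
have [h _ _] := edge_reprP j; case: j h => C PC h.
exact/eq_exist/esym.
Qed.

(** The normalization on [S] makes the labels of the edges of the maximal tree trivial later on. *)
Lemma vertex_class_exists v :
  exists i : orbit_vertex, exists g, actV g (sval i) = v /\ (S v -> g = 1%g).
Proof.
have [Sv|nSv] := pselect (S v).
  by exists (exist _ v Sv), 1%g; rewrite actV1.
have [g Sg] := S_all v; exists (exist _ _ Sg), g^-1%g.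
by rewrite /= actVK.
Qed.

Definition vertex_class v : orbit_vertex := projT1 (cid (vertex_class_exists v)).

Definition mover v : G :=
  projT1 (cid (projT2 (cid (vertex_class_exists v)))).

Lemma moverP v : actV (mover v) (sval (vertex_class v)) = v.
Proof. exact: (projT2 (cid (projT2 (cid (vertex_class_exists v))))).1. Qed.

Lemma mover1 v : S v -> mover v = 1%g.
Proof. exact: (projT2 (cid (projT2 (cid (vertex_class_exists v))))).2. Qed.

Lemma orbit_vertex_inj (i j : orbit_vertex) g : actV g (sval i) = sval j -> i = j.
Proof.
case: i j => [u Su] [v Sv] /= e; apply: eq_exist.
have [_ tS _] := S_transv; rewrite -e; apply/esym/tS => //.
by rewrite e.
Qed.

Lemma vertex_class_act g v : vertex_class (actV g v) = vertex_class v.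
Proof.
apply: (@orbit_vertex_inj _ _ ((mover v)^-1 * g^-1 * mover (actV g v))%g).
by rewrite !actVM// moverP actVK -[RHS](actVK (mover v)) moverP.
Qed.

Lemma vertex_classE v (Sv : S v) : vertex_class v = exist _ v Sv.
Proof.
by apply: (@orbit_vertex_inj _ _ 1%g); rewrite /= -[RHS]moverP mover1.
Qed.

Lemma vertex_class_sval (i : orbit_vertex) : vertex_class (sval i) = i.
Proof. by case: i => v Sv; exact: vertex_classE. Qed.

Definition vertex_stab (v : vertex X) : subgroup G.
Proof.
refine (@Subgroup G [set g | actV g v = v] _ _ _) => /=; first exact: actV1.
  by move=> x y xv yv; rewrite actVM// yv.
by move=> x {1}<-; rewrite actVK.
Defined.

Definition edge_stab (e : edge X) : subgroup G.
Proof.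
refine (@Subgroup G [set g | actE g e = e] _ _ _) => /=; first exact: actE1.
  by move=> x y xv yv; rewrite actEM// yv.
by move=> x {1}<-; rewrite actEK.
Defined.

Definition edge_origin (j : orbit_edge) : orbit_vertex :=
  let: And3 _ h _ := edge_reprP j in exist _ _ h.

Lemma edge_originE j : sval (edge_origin j) = source (edge_repr j).
Proof. by rewrite /edge_origin; case: edge_reprP. Qed.

Definition edge_end (j : orbit_edge) : orbit_vertex :=
  vertex_class (target (edge_repr j)).

(** The image in [G] of the stable letter of the edge [j]. It carries the chosen representative of
    the target orbit to the actual target, and conjugation by it embeds the edge group into the
    target group. *)
Definition edge_elt (j : orbit_edge) : G := mover (target (edge_repr j)).

Lemma edge_eltP j : actV (edge_elt j) (sval (edge_end j)) = target (edge_repr j).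
Proof. exact: moverP. Qed.

Lemma source_stab j (a : subgroup_type (edge_stab (edge_repr j))) :
  carrier (vertex_stab (sval (edge_origin j))) (subgroup_val a).
Proof.
by case: a => a /= ha; rewrite edge_originE -act_source// ha.
Qed.

Lemma target_stab j (a : subgroup_type (edge_stab (edge_repr j))) :
  carrier (vertex_stab (sval (edge_end j)))
    ((edge_elt j)^-1 * subgroup_val a * edge_elt j)%g.
Proof.
case: a => a /= ha; rewrite !actVM// edge_eltP -act_target// ha.
by rewrite -edge_eltP actVK.
Qed.

Definition to_source j (a : subgroup_type (edge_stab (edge_repr j))) :=
  SubgroupElt (source_stab a).
Definition to_target j (a : subgroup_type (edge_stab (edge_repr j))) :=
  SubgroupElt (target_stab a).

Lemma to_sourceM j : {morph @to_source j : x y / (x * y)%g}.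
Proof. by move=> x y; apply: subgroup_val_inj. Qed.
Lemma to_targetM j : {morph @to_target j : x y / (x * y)%g}.
Proof.
move=> x y; apply: subgroup_val_inj => /=.
by rewrite !mulgA mulgK.
Qed.
Lemma to_source_inj j : injective (@to_source j).
Proof. by move=> x y /(congr1 (@subgroup_val _ _)) /= /subgroup_val_inj. Qed.
Lemma to_target_inj j : injective (@to_target j).
Proof.
move=> x y /(congr1 (@subgroup_val _ _)) /= /mulIg /mulgI.
exact: subgroup_val_inj.
Qed.

Definition quotient_gog : graph_of_groups :=
  @GraphOfGroups (@Graph orbit_vertex orbit_edge edge_origin edge_end)
    (fun i => subgroup_type (vertex_stab (sval i)))
    (fun j => subgroup_type (edge_stab (edge_repr j)))
    (fun j => multiplicative_of (@to_sourceM j))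
    (fun j => multiplicative_of (@to_targetM j))
    to_source_inj to_target_inj.

(** The source of a representative always lies in [S], so these are the orbits that contain an edge
    with both ends in [S]. *)
Definition tree_edges : set (edge quotient_gog) :=
  [set j | S (target (edge_repr j))].

Notation PI := (pi1 tree_edges).

Definition gen_eval (s : pi1_generator quotient_gog) : G :=
  match s with
  | vertex_elt v x => subgroup_val x
  | stable_letter j => edge_elt j
  end.

Lemma gen_eval_rel u v : pi1_rel tree_edges u v ->
  word_eval gen_eval u = word_eval gen_eval v.
Proof.
case=> [i x y|j a|j tj]; rewrite /word_eval /letter_eval /= ?mulg1//.
- by rewrite !mulgA mulgV mul1g.
- exact: mover1.
Qed.

Definition pi1_eval : PI -> G := presented_eval gen_eval.

Lemma pi1_evalM : {morph pi1_eval : x y / (x * y)%g}.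
Proof. exact: (presented_evalM gen_eval_rel). Qed.

(* Junk value [1] unless [g] stabilizes the vertex [i]. *)
Definition stab_elt (i : orbit_vertex) (g : G) : PI :=
  if pselect (carrier (vertex_stab (sval i)) g) is left h
  then pi1_vertex (Gam := quotient_gog) tree_edges (v := i) (SubgroupElt h) else 1%g.

Lemma stab_eltE i (x : subgroup_type (vertex_stab (sval i))) :
  stab_elt i (subgroup_val x) =
  pi1_vertex (Gam := quotient_gog) tree_edges (v := i) x.
Proof.
rewrite /stab_elt; case: pselect => [h|]; last by case: x.
by congr pi1_vertex; exact: subgroup_val_inj.
Qed.

Lemma pi1_vertexM i : {morph pi1_vertex (Gam := quotient_gog) tree_edges (v := i) : x y / (x * y)%g}.
Proof.
move=> x y; rewrite [RHS]presented_mulE; apply/word_valP/word_eq_sym/word_eq_rel.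
exact: pi1_rel_vertex.
Qed.

Lemma stab_eltM i g h : actV g (sval i) = sval i -> actV h (sval i) = sval i ->
  stab_elt i (g * h)%g = (stab_elt i g * stab_elt i h)%g.
Proof.
move=> hg hh; rewrite -[g]/(subgroup_val (SubgroupElt (K := vertex_stab (sval i)) hg)).
rewrite -[h]/(subgroup_val (SubgroupElt (K := vertex_stab (sval i)) hh)).
rewrite -[(_ * _)%g]/(subgroup_val (SubgroupElt (K := vertex_stab (sval i)) hg *
  SubgroupElt (K := vertex_stab (sval i)) hh)%g).
by rewrite !stab_eltE pi1_vertexM.
Qed.

Lemma stab_elt1 i : stab_elt i 1%g = 1%g.
Proof.
by apply: (mulgI (stab_elt i 1%g)); rewrite -stab_eltM ?actV1// !mulg1.
Qed.

Notation stable j := (pi1_stable tree_edges (j : edge quotient_gog)).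

Lemma stable_stab j a : actE a (edge_repr j) = edge_repr j ->
  (stable j * stab_elt (edge_end j) ((edge_elt j)^-1 * a * edge_elt j) =
   stab_elt (edge_origin j) a * stable j)%g.
Proof.
move=> ha; pose A := SubgroupElt (K := edge_stab (edge_repr j)) ha.
rewrite -[a]/(subgroup_val (to_source A)) stab_eltE.
rewrite -[(_ * subgroup_val _ * _)%g]/(subgroup_val (to_target A)) stab_eltE.
rewrite [LHS]presented_mulE [RHS]presented_mulE; apply/word_valP/word_eq_rel.
exact: (@pi1_rel_edge quotient_gog tree_edges j A).
Qed.

Lemma pi1_eval_stab_elt i g : actV g (sval i) = sval i -> pi1_eval (stab_elt i g) = g.
Proof.
move=> hg; rewrite /stab_elt; case: pselect => // h.
rewrite /pi1_eval presented_evalE ?/word_eval /letter_eval /= ?mulg1//.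
exact: gen_eval_rel.
Qed.

Lemma pi1_eval_stable j : pi1_eval (stable j) = edge_elt j.
Proof.
rewrite /pi1_eval presented_evalE ?/word_eval /letter_eval /= ?mulg1//.
exact: gen_eval_rel.
Qed.

(** A lift of [(mover (source e))^-1 * mover (target e)] to the fundamental group. If [rho] carries
    the representative to [e], that element is the product of a source stabilizer element,
    [edge_elt], and the inverse of a target stabilizer element; each factor has an obvious lift. *)
Definition edge_label_of e rho : PI :=
  let j := edge_class e in
  (stab_elt (edge_origin j) ((mover (source e))^-1 * rho) * stable j *
   (stab_elt (edge_end j) ((mover (target e))^-1 * rho * edge_elt j))^-1)%g.

Definition edge_label e : PI := edge_label_of e (projT1 (cid (edge_repr_class e))).

Lemma mover_inv v : actV (mover v)^-1%g v = sval (vertex_class v).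
Proof. by rewrite -[RHS](actVK (mover v)) moverP. Qed.

Lemma vertex_class_source e : vertex_class (source e) = edge_origin (edge_class e).
Proof.
have [g <-] := edge_repr_class e; rewrite edge_class_act act_source//.
by rewrite vertex_class_act edge_reprK -edge_originE vertex_class_sval.
Qed.

Lemma vertex_class_target e : vertex_class (target e) = edge_end (edge_class e).
Proof.
have [g <-] := edge_repr_class e; rewrite edge_class_act act_target//.
by rewrite vertex_class_act edge_reprK.
Qed.

Lemma edge_source_stab e rho : actE rho (edge_repr (edge_class e)) = e ->
  actV ((mover (source e))^-1 * rho)%g (sval (edge_origin (edge_class e))) =
  sval (edge_origin (edge_class e)).
Proof.
move=> re; rewrite actVM// edge_originE -act_source// re mover_inv.
by rewrite vertex_class_source edge_originE.
Qed.

Lemma edge_target_stab e rho : actE rho (edge_repr (edge_class e)) = e ->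
  actV ((mover (target e))^-1 * rho * edge_elt (edge_class e))%g
    (sval (edge_end (edge_class e))) = sval (edge_end (edge_class e)).
Proof.
move=> re; rewrite !actVM// edge_eltP -act_target// re mover_inv.
by rewrite vertex_class_target.
Qed.

(** Two choices of [rho] differ by an element of the edge stabilizer, which [stable_stab] moves
    across the stable letter until it cancels. *)
Lemma edge_labelE e rho : actE rho (edge_repr (edge_class e)) = e ->
  edge_label e = edge_label_of e rho.
Proof.
rewrite /edge_label; case: cid => r /= hr hrho.
set j := edge_class e in hr hrho *.
have [a ha ->] : exists2 a, actE a (edge_repr j) = edge_repr j & rho = (r * a)%g.
  by exists (r^-1 * rho)%g; rewrite ?mulVKg// actEM// hrho -[in LHS]hr actEK.
have as_ : actV a (sval (edge_origin j)) = sval (edge_origin j).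
  by rewrite edge_originE -act_source// ha.
have at_ : actV ((edge_elt j)^-1 * a * edge_elt j)%g (sval (edge_end j)) =
    sval (edge_end j).
  by rewrite !actVM// edge_eltP -act_target// ha -edge_eltP actVK.
have E1 : (stab_elt (edge_origin j) ((mover (source e))^-1 * (r * a)) =
    stab_elt (edge_origin j) ((mover (source e))^-1 * r) * stab_elt (edge_origin j) a)%g.
  by rewrite mulgA; apply: stab_eltM => //; exact: edge_source_stab.
have E2 : (stab_elt (edge_end j) ((mover (target e))^-1 * (r * a) * edge_elt j) =
    stab_elt (edge_end j) ((mover (target e))^-1 * r * edge_elt j) *
    stab_elt (edge_end j) ((edge_elt j)^-1 * a * edge_elt j))%g.
  rewrite -stab_eltM//; last exact: edge_target_stab.
  by rewrite !mulgA mulgK.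
rewrite /edge_label_of -/j E1 E2 invgM -(mulgA _ _ (stable j)) -(stable_stab ha).
by rewrite !mulgA mulgK.
Qed.

Lemma edge_label_act g e : edge_label (actE g e) =
  (stab_elt (vertex_class (source e)) ((mover (actV g (source e)))^-1 * g * mover (source e)) *
   edge_label e *
   (stab_elt (vertex_class (target e)) ((mover (actV g (target e)))^-1 * g * mover (target e)))^-1)%g.
Proof.
have [r hr] := edge_repr_class e.
have hgr : actE (g * r)%g (edge_repr (edge_class (actE g e))) = actE g e.
  by rewrite edge_class_act actEM// hr.
rewrite (edge_labelE hgr) (edge_labelE hr) /edge_label_of !edge_class_act.
set j := edge_class e in hr *.
have ms v : actV ((mover (actV g v))^-1 * g * mover v)%g (sval (vertex_class v)) =
   sval (vertex_class v).
  by rewrite !actVM// moverP mover_inv vertex_class_act.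
have es := edge_source_stab hr; have et := edge_target_stab hr.
have mss := ms (source e); have mst := ms (target e).
rewrite act_source// act_target// vertex_class_source vertex_class_target -/j in mss mst *.
have -> : ((mover (actV g (source e)))^-1 * (g * r) =
  ((mover (actV g (source e)))^-1 * g * mover (source e)) * ((mover (source e))^-1 * r))%g.
  by rewrite !mulgA mulgK.
rewrite stab_eltM//.
have -> : ((mover (actV g (target e)))^-1 * (g * r) * edge_elt j =
  ((mover (actV g (target e)))^-1 * g * mover (target e)) *
  ((mover (target e))^-1 * r * edge_elt j))%g.
  by rewrite !mulgA mulgK.
by rewrite [X in (_ / X)%g = _]stab_eltM// invgM !mulgA.
Qed.

Lemma pi1_eval_edge_label e : pi1_eval (edge_label e) = ((mover (source e))^-1 * mover (target e))%g.
Proof.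
have [r hr] := edge_repr_class e; rewrite (edge_labelE hr) /edge_label_of.
rewrite !pi1_evalM (morphV pi1_evalM) pi1_eval_stable !pi1_eval_stab_elt; [|exact: edge_target_stab|exact: edge_source_stab].
by rewrite !invgM !invgK !mulgA mulgK mulgK.
Qed.

(** This is where simple connectedness of [X] is used: the edge labels integrate to a potential [D],
    whose variation under [g] yields the element of the fundamental group above [g]. *)
Lemma pi1_eval_inverse : exists Phi : G -> PI,
  [/\ {morph Phi : x y / (x * y)%g}, cancel Phi pi1_eval & cancel pi1_eval Phi].
Proof.
have [v0 Sv0] := S_neq0.
have [D [D0 Dt]] := potential hX edge_label v0.
(* By [PsiD] below, [D] evaluates to [mover], so [c g x] evaluates to [g]. By [edge_label_act] it
   takes the same value at both ends of an edge, hence everywhere; this makes [Phi]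
   multiplicative. *)
pose c g x := (D (actV g x) * stab_elt (vertex_class x)
   ((mover (actV g x))^-1 * g * mover x) * (D x)^-1)%g.
have cst g x y : c g x = c g y.
  move: (geod hX x y) (geod_walk hX x y) => p.
  elim: p x => [|d p IH] x /=; first by move=> ->.
  move=> [<- /IH <-]; case: d => e b.
  have ce : c g (source e) = c g (target e).
    rewrite /c -act_source// -act_target// !Dt edge_label_act act_source// act_target//.
    move: (edge_label e) (stab_elt _ _) (stab_elt _ _) => l x1 x2.
    by rewrite !invgM !mulgA !mulgVK mulgK.
  by case: b.
have ms g v : actV ((mover (actV g v))^-1 * g * mover v)%g (sval (vertex_class v)) =
   sval (vertex_class v).
  by rewrite !actVM// moverP mover_inv vertex_class_act.
have PsiD v : pi1_eval (D v) = mover v.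
  move: (geod hX v0 v) (geod_walk hX v0 v) => p.
  elim/last_ind: p v => [|p d IH] v.
    by move=> /= <-; rewrite D0 (morph1 pi1_evalM) mover1.
  move=> /walk_rcons[/IH h <-]; case: d h => e [] /=; rewrite /origin /terminus /=.
    by rewrite Dt pi1_evalM pi1_eval_edge_label => ->; rewrite mulVKg.
  by rewrite Dt pi1_evalM pi1_eval_edge_label => /(canRL (mulgK _)) ->; rewrite invgM invgK mulVKg.
pose Phi g := c g v0.
have PhiM : {morph Phi : x y / (x * y)%g}.
  move=> g h; rewrite /Phi (cst g v0 (actV h v0)) /c.
  have -> : stab_elt (vertex_class v0) ((mover (actV (g * h) v0))^-1 * (g * h) * mover v0)%g =
    (stab_elt (vertex_class (actV h v0))
       ((mover (actV g (actV h v0)))^-1 * g * mover (actV h v0)) *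
     stab_elt (vertex_class v0) ((mover (actV h v0))^-1 * h * mover v0))%g.
    have hg := ms g (actV h v0); rewrite vertex_class_act in hg *.
    by rewrite -stab_eltM// actVM// !mulgA mulgK.
  rewrite actVM//; move: (stab_elt _ _) (stab_elt _ _) => x1 x2.
  by rewrite !mulgA mulgVK.
have PhiK : cancel Phi pi1_eval.
  move=> g; rewrite /Phi /c !pi1_evalM (morphV pi1_evalM) !PsiD pi1_eval_stab_elt//.
  by rewrite !mulgA mulgV mul1g mulgK.
exists Phi; split=> //.
(* Inside [S] the walk crosses only edges of the maximal tree, where movers and stable letters are
   trivial. *)
have D1 v : S v -> D v = 1%g.
  move=> Sv; have [_ _ cS] := S_transv; have [p] := cS _ _ Sv0 Sv.
  elim/last_ind: p v Sv => [|p d IH] v Sv /=; first by move=> <-.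
  move=> /walk_rcons[wp dv] hp.
  have [Ss St] : S (source d.1) /\ S (target d.1).
    by apply: hp; rewrite -cats1; apply/List.in_app_iff; right; left.
  have Do : D (origin d) = 1%g.
    apply: IH => //; first by rewrite /origin; case: ifP.
    by move=> e pe; apply: hp; rewrite -cats1; apply/List.in_app_iff; left.
  have lab : edge_label d.1 = 1%g.
    have er : edge_repr (edge_class d.1) = d.1.
      have [/= h _ hu] := edge_reprP (edge_class d.1).
      by apply: hu => //; rewrite -h.
    have hr : actE 1%g (edge_repr (edge_class d.1)) = d.1 by rewrite actE1.
    rewrite (edge_labelE hr) /edge_label_of /edge_elt er !mover1// invg1 !mulg1 !stab_elt1.
    rewrite invg1 mulg1 mul1g; apply/word_valP/word_eq_rel/pi1_rel_tree.
    by rewrite /tree_edges /= er.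
  move: Do dv; rewrite /origin /terminus; case: (d.2) => h <-.
    by rewrite Dt h lab mulg1.
  by move: h; rewrite Dt lab mulg1.
(* With base vertex in [S], all factors of [c] other than the stabilizer element are trivial; this
   settles the vertex generators. *)
have PsiK1 i h : actV h (sval i) = sval i -> Phi h = stab_elt i h.
  move=> hi; rewrite /Phi (cst _ _ (sval i)) /c hi mover1; last exact: (svalP i).
  rewrite D1; last exact: (svalP i).
  by rewrite !invg1 !(mul1g, mulg1) vertex_class_sval.
move=> x; elim/presented_ind: x => [|x y hx hy|x hx|s].
- by rewrite (morph1 pi1_evalM) (morph1 PhiM).
- by rewrite pi1_evalM PhiM hx hy.
- by rewrite (morphV pi1_evalM) (morphV PhiM) hx.
case: s => [i x|j].
  rewrite -[word_val _ _]/(pi1_vertex (Gam := quotient_gog) tree_edges (v := i) x).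
  rewrite -stab_eltE; case: x => x /= hx.
  by rewrite pi1_eval_stab_elt// (PsiK1 i x hx).
rewrite -[word_val _ _]/(stable j) pi1_eval_stable.
have hr : actE 1%g (edge_repr (edge_class (edge_repr j))) = edge_repr j.
  by rewrite actE1// edge_reprK.
rewrite /Phi (cst _ _ (sval (edge_end j))) /c edge_eltP.
have Se : S (sval (edge_end j)) := svalP (edge_end j).
have So : S (source (edge_repr j)) by case: (edge_reprP j).
rewrite (D1 _ Se) (mover1 Se) Dt (D1 _ So) vertex_class_sval invg1 !mulg1 mul1g.
rewrite (edge_labelE hr) /edge_label_of edge_reprK (mover1 So) invg1 mulg1 stab_elt1 mul1g mulg1.
by rewrite mulgVK.
Qed.

Lemma finite_factor (A B C : Type) (f : A -> C) (h : A -> B) :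
  finite_set (range h) -> (forall a a', h a = h a' -> f a = f a') ->
  finite_set (range f).
Proof.
move=> fh hf.
have [[a0]|nA] := pselect (inhabited A); last first.
  rewrite (_ : range f = set0) ?finite_set0//.
  by apply/seteqP; split=> // c [a _ _]; case: nA; exists.
pose F b := if pselect (exists a, h a = b) is left e then f (projT1 (cid e)) else f a0.
apply: (sub_finite_set _ (finite_image F fh)) => _ [a _ <-].
exists (h a); first by exists a.
rewrite /F; case: pselect => [e|[]]; last by exists a.
by apply: hf; case: cid.
Qed.

Lemma left_coset_range (E V : groupType) (f : {multiplicative E -> V}) x a :
  left_coset (x * f a)%g (range f) = left_coset x (range f).
Proof.
apply/seteqP; split=> _ [_ [b _ <-] <-].
  by exists (f (a * b)%g); [exists (a * b)%g|rewrite gmulfM mulgA].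
exists (f (a^-1 * b)%g); first by exists (a^-1 * b)%g.
by rewrite -mulgA -gmulfM mulVKg.
Qed.

Lemma sval_inj T (P : T -> Prop) : injective (@sval T P).
Proof. by case=> x Px [y Py] /= e; exact: eq_exist. Qed.

Lemma finite_sig T (P : set T) (F : set T) :
  finite_set F -> (forall x, P x -> F x) -> finite_set [set: {x | P x}].
Proof.
move=> fF PF; have fP : finite_set P by exact: sub_finite_set fF.
have -> : [set: {x | P x}] = @sval T P @^-1` P.
  by apply/seteqP; split=> // -[x Px].
by apply: finite_preimage fP => x y _ _; exact: sval_inj.
Qed.

Lemma quotient_finite (s : set (edge X)) : finite_set s ->
  (forall e, exists g u, s u /\ e = actE g u) -> finite_graph quotient_gog.
Proof.
move=> fs hs; have [fS _ _] := S_transv; split; first exact: finite_sig fS _.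
apply: (finite_sig (finite_image edge_orbit fs)) => _ [e ->].
have [g [u [su ->]]] := hs e; exists u => //.
by rewrite edge_orbit_act.
Qed.

(** The cosets of an edge group in a vertex group embed into the set of edges of [X] at that vertex:
    a coset is determined by where it sends the representative edge. *)
Lemma quotient_finite_index :
  (forall v : vertex X, finite_set [set e : edge X | source e = v]) ->
  (forall v : vertex X, finite_set [set e : edge X | target e = v]) ->
  finite_index_injections quotient_gog.
Proof.
move=> lfs lft j; split.
- apply: (@finite_factor _ _ _ _ (fun x => actE (subgroup_val x) (edge_repr j))).
    apply: sub_finite_set (lfs (source (edge_repr j))) => _ [[x /= hx] _ <-] /=.
    by rewrite act_source// -edge_originE.
  move=> x y xy.
  have st : carrier (edge_stab (edge_repr j)) ((subgroup_val x)^-1 * subgroup_val y)%g.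
    by rewrite /= actEM// -xy actEK.
  rewrite -(left_coset_range _ x (SubgroupElt st)); congr left_coset.
  by apply: subgroup_val_inj => /=; rewrite mulVKg.
- apply: (@finite_factor _ _ _ _
    (fun x => actE (subgroup_val x * (edge_elt j)^-1)%g (edge_repr j))).
    apply: sub_finite_set (lft (sval (edge_end j))) => _ [[x /= hx] _ <-] /=.
    by rewrite act_target// actVM// -edge_eltP actVK.
  move=> x y xy.
  have st : carrier (edge_stab (edge_repr j))
     (edge_elt j * ((subgroup_val x)^-1 * subgroup_val y) * (edge_elt j)^-1)%g.
    have -> : (edge_elt j * ((subgroup_val x)^-1 * subgroup_val y) * (edge_elt j)^-1 =
      (subgroup_val x * (edge_elt j)^-1)^-1 * (subgroup_val y * (edge_elt j)^-1))%g.
      by rewrite invgM invgK !mulgA.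
    by rewrite /= actEM// -xy actEK.
  rewrite -(left_coset_range _ x (SubgroupElt st)); congr left_coset.
  by apply: subgroup_val_inj => /=; rewrite !mulgA !mulgVK mulgV mul1g.
Qed.

(** Sending an edge to its representative embeds this graph into [X] as the subgraph spanned by
    [S]. *)
Lemma quotient_tree : is_tree (spanning_subgraph tree_edges).
Proof.
have [_ _ cS] := S_transv.
pose sd (d : dart (spanning_subgraph tree_edges)) : dart X :=
  (edge_repr (sval d.1), d.2).
have sd_inj : injective sd.
  move=> [[e Fe] b] [[e' Fe'] b'] [/= ee' ->]; congr pair; apply: eq_exist.
  by rewrite -(edge_reprK e) ee' edge_reprK.
have sd_o (d : dart (spanning_subgraph tree_edges)) :
    sval (origin d : orbit_vertex) = origin (sd d).
  case: d => [[e Fe] []]; rewrite /origin /= ?edge_originE// /edge_end.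
  by rewrite (vertex_classE Fe).
have sd_t (d : dart (spanning_subgraph tree_edges)) :
    sval (terminus d : orbit_vertex) = terminus (sd d).
  case: d => [[e Fe] []]; rewrite /terminus /= ?edge_originE// /edge_end.
  by rewrite (vertex_classE Fe).
have sd_r (d : dart (spanning_subgraph tree_edges)) : sd (reverse d) = reverse (sd d) by [].
apply: is_treeI.
- move=> u p wp rp.
  have wX (v w : orbit_vertex) (q : seq (dart (spanning_subgraph tree_edges))) :
      walk (G := spanning_subgraph tree_edges) v q w ->
      walk (sval v) (map sd q) (sval w).
    by elim: q v => [|d q IH] v /=; [move=> ->|move=> [<- /IH]; rewrite -sd_o -sd_t].
  have rX q : reduced q -> reduced (map sd q).
    elim: q => [//|d [//|d' q] IH] [h /IH]; split=> //.
    by rewrite -sd_r => /sd_inj.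
  by have := tree_no_loop hX (wX _ _ _ wp) (rX _ rp); case: (p).
- have [v Sv] := S_neq0; by exists; exists v.
- move=> [u Su] [v Sv]; have [p] := cS _ _ Su Sv.
  elim: p u Su => [|d p IH] u Su /=.
    by move=> uv _; exists [::] => /=; exact: eq_exist.
  move=> [du wp] hp; have [Ss St] := hp d (or_introl erefl).
  have Sd : S (terminus d) by rewrite /terminus; case: ifP.
  have [q wq] := IH _ Sd wp (fun c h => hp c (or_intror h)).
  have er : edge_repr (edge_class d.1) = d.1.
    have [/= h _ hu] := edge_reprP (edge_class d.1).
    by apply: hu => //; rewrite -h.
  have Fd : tree_edges (edge_class d.1) by rewrite /tree_edges /= er.
  pose c : dart (spanning_subgraph tree_edges) := (exist _ (edge_class d.1) Fd, d.2).
  have sc : sd c = d by rewrite /sd /= er; case: (d).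
  exists (c :: q) => /=; split; first by apply: sval_inj; rewrite sd_o sc.
  by rewrite (_ : terminus c = exist _ _ Sd)//; apply: sval_inj; rewrite sd_t sc.
Qed.

Lemma left_coset_eqP (K : set PI) (g h : PI) :
  left_coset g K = left_coset h K -> K 1%g -> exists2 k, K k & g = (h * k)%g.
Proof.
move=> gh K1; have : left_coset g K g by exists 1%g; rewrite ?mulg1.
by rewrite gh => -[k Kk <-]; exists k.
Qed.

Lemma coset_reprK (K : set PI) (C : coset_space K) :
  left_coset (coset_repr C) K = sval C.
Proof. by rewrite /coset_repr; case: cid2. Qed.

Lemma coset_repr_mk (K : set PI) g : left_coset (coset_repr (mk_coset g K)) K = left_coset g K.
Proof. by rewrite coset_reprK. Qed.

Lemma vertex_group1 (i : orbit_vertex) :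
  @pi1_vertex_group quotient_gog tree_edges i 1%g.
Proof. by exists 1%g => //; apply: (morph1 (@pi1_vertexM i)). Qed.

Lemma vertex_group_coset (i : orbit_vertex) g k :
  @pi1_vertex_group quotient_gog tree_edges i k ->
  left_coset (g * k)%g (@pi1_vertex_group quotient_gog tree_edges i) =
  left_coset g (@pi1_vertex_group quotient_gog tree_edges i).
Proof.
move=> [a _ <-]; exact: (left_coset_range (multiplicative_of (@pi1_vertexM i))).
Qed.

(** The coset of [g] in the vertex group of [i] is matched with the vertex
    [actV (pi1_eval g) (sval i)]. Both stabilizers are the conjugate by [g] of that vertex group. *)
Lemma bass_serre_fixed (Phi : G -> PI) :
  {morph Phi : x y / (x * y)%g} -> cancel Phi pi1_eval -> cancel pi1_eval Phi ->
  forall H : {pred G},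
    (exists x : vertex (bass_serre_tree tree_edges),
       forall h, h \in H -> bass_serre_act (Phi h) x = x) <->
    (exists v, forall h, h \in H -> actV h v = v).
Proof.
move=> PhiM PhiK PsiK H; split=> [[[i C] hx]|[v hv]].
  exists (actV (pi1_eval (coset_repr C)) (sval (i : orbit_vertex))) => h Hh.
  have e := inj_pairT2 _ _ _ _ _ (hx h Hh).
  have := congr1 (fun D : coset_space _ => sval D) e.
  rewrite [LHS]/= -coset_reprK => /left_coset_eqP /(_ (vertex_group1 i))[k [a _ <-]].
  move=> /(congr1 pi1_eval); rewrite !pi1_evalM PhiK -actVM// => ->.
  rewrite -stab_eltE; case: a => a /= ha.
  by rewrite pi1_eval_stab_elt// actVM// ha.
exists (existT _ (vertex_class v) (mk_coset (Phi (mover v)) _)) => h /hv hh.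
rewrite /bass_serre_act; congr existT; apply: sval_inj => /=.
have [k Kk ->] := left_coset_eqP (coset_repr_mk
  (@pi1_vertex_group quotient_gog tree_edges (vertex_class v)) (Phi (mover v)))
  (vertex_group1 _).
rewrite mulgA vertex_group_coset//.
have st : carrier (vertex_stab (sval (vertex_class v))) ((mover v)^-1 * h * mover v)%g.
  by rewrite /= !actVM// moverP hh mover_inv.
have e : h = (mover v * ((mover v)^-1 * h * mover v) * (mover v)^-1)%g.
  by rewrite !mulgA mulgV mul1g mulgK.
rewrite [X in Phi X]e -PhiM mulgVK PhiM; apply: vertex_group_coset.
exists (SubgroupElt st) => //.
by rewrite -[LHS]PsiK -stab_eltE pi1_eval_stab_elt.
Qed.

End BassSerre.
End Action.

Lemma bass_serre (X : graph) (G : groupType)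
    (actV : G -> vertex X -> vertex X) (actE : G -> edge X -> edge X)
    (sV : set (vertex X)) (sE : set (edge X)) :
  is_tree X -> graph_action actV actE ->
  finite_set sV -> (forall v, exists g u, sV u /\ v = actV g u) ->
  finite_set sE -> (forall e, exists g u, sE u /\ e = actE g u) ->
  (forall v : vertex X, finite_set [set e : edge X | source e = v]) ->
  (forall v : vertex X, finite_set [set e : edge X | target e = v]) ->
  exists (Gam : graph_of_groups) (F : set (edge Gam)),
    [/\ finite_graph Gam, is_tree (spanning_subgraph F),
        finite_index_injections Gam &
        exists2 phi : {multiplicative G -> pi1 F}, bijective phi &
          forall H : {pred G},
            (exists x : vertex (bass_serre_tree F),
               forall h, h \in H -> bass_serre_act (phi h) x = x) <->
            (exists v, forall h, h \in H -> actV h v = v)].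
Proof.
move=> hX hA fV hV fE hE ls lt.
have [S tS [aS S0]] := transversal_exists hA hX fV hV.
have [Phi [PhiM PhiK PsiK]] := pi1_eval_inverse hA hX tS aS S0.
exists (quotient_gog hA hX tS aS), (@tree_edges _ _ _ _ hA hX S tS aS); split.
- exact: quotient_finite fE hE.
- exact: quotient_tree.
- exact: quotient_finite_index.
- exists (multiplicative_of PhiM); first by exists (@pi1_eval _ _ _ _ hA hX S tS aS).
  exact: bass_serre_fixed.
Qed.

(** * The dual tree of a nested family *)

Section Translates.
Variables (B : Type) (G : groupType) (A : G -> B -> B).
Hypothesis A1 : forall b, A 1%g b = b.
Hypothesis AM : forall g h b, A (g * h)%g b = A g (A h b).
Implicit Types U V W : set B.

(** A preimage under the inverse rather than an image, so that translation commutes with complements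
    definitionally. *)
Definition translate g U : set B := A g^-1%g @^-1` U.

Lemma translateP g U b : translate g U (A g b) <-> U b.
Proof. by rewrite /translate /= -AM mulVg A1. Qed.

Lemma translate1 U : translate 1%g U = U.
Proof. by apply/seteqP; split=> b; rewrite /translate /= invg1 A1. Qed.

Lemma translateM g h U : translate (g * h)%g U = translate g (translate h U).
Proof. by apply/seteqP; split=> b; rewrite /translate /= invgM AM. Qed.

Lemma translateK g U : translate g^-1%g (translate g U) = U.
Proof. by rewrite -translateM mulVg translate1. Qed.

Lemma translateKV g U : translate g (translate g^-1%g U) = U.
Proof. by rewrite -translateM mulgV translate1. Qed.

Lemma translateS g U V : translate g U `<=` translate g V <-> U `<=` V.
Proof.
split=> [h b|h b]; last exact: h.
  by move=> Ub; apply/(translateP g); apply: h; apply/translateP.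
Qed.

Lemma translateC g U : translate g (~` U) = ~` translate g U.
Proof. by []. Qed.

Lemma translate_inj g : injective (translate g).
Proof. by move=> U V /(congr1 (translate g^-1%g)); rewrite !translateK. Qed.

Definition orbit_of (H : {pred G}) U : set (set B) := [set translate h U | h in [set` H]].

End Translates.

(* The dual tree of a nested family, subdivided so that the action has no
   inversions: the edge [U] joins the midpoint [{U, ~` U}] to the vertex towards
   which [U] points. *)
Section NestedTree.
Variables (B : Type) (E : set (set B)).
Implicit Types U V W : set B.

(** The conditions under which, as Dunwoody showed, a family of sets is the set of oriented edges of
    a tree, complementation being the reversal of edges. *)
Record nested_family : Prop := NestedFamily {
  nest_neq0 : forall U, E U -> U !=set0;
  nestC : forall U, E U -> E (~` U);
  nested : forall U V, E U -> E V ->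
    [\/ U `<=` V, U `<=` ~` V, ~` U `<=` V | V `<=` U];
  nest_interval : forall U V, E U -> E V ->
    finite_set [set W | [/\ E W, U `<=` W & W `<=` V]] }.

Hypothesis hE : nested_family.

(** The oriented edges [U] and [V] point to the same vertex: no member of the family lies strictly
    between the reverse of [U] and [V]. *)
Definition same_end U V := U = V \/
  ~` U `<` V /\ forall W, E W -> ~` U `<=` W -> W `<=` V -> W = ~` U \/ W = V.

Definition block U : set (set B) := [set V | E V /\ same_end U V].
Definition midpoint U : set (set B) := [set U; ~` U].

Lemma nest_false U : E U -> ~ U `<=` ~` U.
Proof. by move=> /(nest_neq0 hE)[x Ux] h; exact: (h x). Qed.

Lemma nest_falseC U : E U -> ~ ~` U `<=` U.
Proof. by move=> /(nestC hE)/nest_false; rewrite setCK. Qed.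

Lemma same_end_sym U V : same_end U V -> same_end V U.
Proof.
move=> [->|[UV h]]; [by left|right; split].
  case: UV => UV VU; split; first by apply: subsetCl.
  by move=> VU'; apply: VU; apply: subsetCr.
move=> W EW VW WU.
have [e|<-] := h _ (nestC hE EW) (subsetC WU) (subsetCl VW).
  by right; apply: setC_inj.
by left; rewrite setCK.
Qed.

Lemma same_end_trans U V W : E U -> E V -> E W ->
  same_end U V -> same_end V W -> same_end U W.
Proof.
move=> EU EV EW [->//|[UV hUV]] [<-|[VW hVW]]; first by right.
have [->|UW] := pselect (U = W); first by left.
have UV1 := proj1 UV; have VW1 := proj1 VW.
have [v nv] := nest_neq0 hE (nestC hE EV).
have [u nu] := nest_neq0 hE (nestC hE EU).
(* Otherwise [W], which also contains the complement of [V], would be everything. *)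
have nVW : ~ V `<=` W.
  move=> VW2; have [w nw] := nest_neq0 hE (nestC hE EW).
  by apply: nw; have [/VW2|/VW1] := pselect (V w).
right; split.
  split; last by move=> /(_ _ (VW1 v nv)) /UV1.
  have [h|h|//|h] := nested hE EU EW.
  - have [e|//] := hVW _ EU (subsetCl UV1) h.
    by case: (proj2 UV); rewrite e setCK.
  - have Uv : U v by apply: contrapT => /UV1.
    by case: (h v Uv (VW1 v nv)).
  - have [e|e] := hUV _ (nestC hE EW) (subsetC h) (subsetCl VW1).
      by case: UW; apply: setC_inj.
    by case: (proj2 VW); rewrite -e setCK.
move=> X EX UX XW; have [h|h|h|h] := nested hE EX EV.
- have [->|e] := hUV _ EX UX h; first by left.
  by case: nVW; rewrite -e.
- by case: (h u (UX u nu) (UV1 u nu)).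
- have [e|->] := hVW _ EX (subsetCl h) XW; last by right.
  by have := UX u nu; rewrite e => /(_ (UV1 u nu)).
- by case: nVW => x /h/XW.
Qed.

Lemma block_eqP U V : E U -> E V -> block U = block V <-> same_end U V.
Proof.
move=> EU EV; split=> [e|UV].
  have : block V V by split=> //; left.
  by rewrite -e => -[].
apply/seteqP; split=> W [EW h]; split=> //; last exact: same_end_trans UV h.
by apply: same_end_trans h; rewrite ?nestC//; exact: same_end_sym.
Qed.

Lemma midpointC U : midpoint (~` U) = midpoint U.
Proof. by rewrite /midpoint setCK setUC. Qed.

Lemma midpoint_eqP U V : midpoint U = midpoint V -> U = V \/ U = ~` V.
Proof. by move=> e; suff : midpoint V U by []; rewrite -e; left. Qed.

Record nest_vertex := NestVertex {
  nest_class : bool * set (set B);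
  nest_classP : exists2 U, E U &
    nest_class = (true, midpoint U) \/ nest_class = (false, block U) }.

Lemma nest_class_inj : injective nest_class.
Proof.
case=> c Pc [d Pd] /= e; case: _ / e Pd => Pd.
by congr NestVertex; exact: Prop_irrelevance.
Qed.

Definition nest_edge := {U | E U}.

Definition mid_vertex (U : nest_edge) : nest_vertex :=
  @NestVertex (true, midpoint (sval U)) (ex_intro2 _ _ (sval U) (svalP U) (or_introl erefl)).
Definition block_vertex (U : nest_edge) : nest_vertex :=
  @NestVertex (false, block (sval U)) (ex_intro2 _ _ (sval U) (svalP U) (or_intror erefl)).

Definition nest_graph := @Graph nest_vertex nest_edge mid_vertex block_vertex.

(** The half of [B] on the origin side of the dart. Along a reduced walk it never shrinks, and it
    grows strictly at each block, which excludes loops. *)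
Definition behind (d : dart nest_graph) : set B :=
  if d.2 then ~` (sval d.1) else sval d.1.

Lemma origin_kind (d : dart nest_graph) : (nest_class (origin d)).1 = d.2.
Proof. by case: d => U []. Qed.

Lemma terminus_kind (d : dart nest_graph) : (nest_class (terminus d)).1 = ~~ d.2.
Proof. by case: d => U []. Qed.

Lemma behind_step (d d' : dart nest_graph) : terminus d = origin d' ->
  d' <> reverse d ->
  d'.2 = ~~ d.2 /\ if d.2 then behind d `<` behind d' else behind d = behind d'.
Proof.
move=> tor ne; have k : d'.2 = ~~ d.2 by rewrite -origin_kind -tor terminus_kind.
split=> //; move: tor ne k.
case: d d' => [[U EU] b] [[V EV] b'] /= tor ne k; subst b'; case: b tor ne => /= tor ne.
  have : block U = block V := congr1 (fun x => (nest_class x).2) tor.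
  move/(block_eqP EU EV) => [UV|[]//].
  by case: ne; congr pair; exact: eq_exist.
have : midpoint U = midpoint V := congr1 (fun x => (nest_class x).2) tor.
rewrite /behind /= => /midpoint_eqP[UV|->]; last by [].
by case: ne; congr pair; exact: eq_exist.
Qed.

Lemma behind_mono u (d : dart nest_graph) p v : walk u (d :: p) v -> reduced (d :: p) ->
  behind d `<=` behind (last d p) /\
  (d.2 -> ~~ (last d p).2 -> behind d `<` behind (last d p)).
Proof.
elim: p u d => [|d' p IH] u d; first by move=> _ _; split=> //= ->.
move=> [_ w] [ne r]; have [wo _] := w.
have [sub str] := IH _ _ w r.
have [k] := behind_step (esym wo) ne; rewrite [last _ _]/=; case: ifP => dd h; last by rewrite h.
split; first by apply: subset_trans sub; exact: (proj1 h).
move=> _ _; split; first by apply: subset_trans sub; exact: (proj1 h).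
by move=> h'; apply: (proj2 h); apply: subset_trans h'.
Qed.

Lemma walk_last_terminus (X : graph) (u : vertex X) d p v :
  walk u (d :: p) v -> terminus (last d p) = v.
Proof. by elim: p u d => [|d' p IH] u d /= [_]; [|move/IH]. Qed.

Lemma nest_no_loop (u : vertex nest_graph) p : walk u p u -> reduced p -> p = [::].
Proof.
case: p => [//|d p] w r; have [sub str] := behind_mono w r.
have te := walk_last_terminus w; have [oe _] := w.
have k : (last d p).2 = ~~ d.2.
  by rewrite -origin_kind -[d.2]origin_kind oe -te terminus_kind origin_kind negbK.
move: sub str oe te k; case: d {w r} => [[U EU] b]; case: (last _ _) => [[V EV] b'].
rewrite /behind /= => sub str oe te k; subst b'; case: b sub str oe te => /= sub str oe te.
  have : midpoint U = midpoint V :=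
    congr1 (fun x : nest_vertex => (nest_class x).2) (etrans oe (esym te)).
  have [_ ns] := str isT isT.
  move=> /midpoint_eqP[e|e]; last by case: ns; rewrite e setCK.
  by rewrite -e in sub; case: (nest_falseC EU).
have : block U = block V :=
  congr1 (fun x : nest_vertex => (nest_class x).2) (etrans oe (esym te)).
move/(block_eqP EU EV) => [e|[[h n] _]]; first by rewrite -e in sub; case: (nest_false EU).
by case: n; apply: subsetCr.
Qed.

Section Connected.
Variable (T : set B -> set B -> Prop).
Hypotheses (T_refl : forall U, E U -> T U U)
  (T_trans : forall U V W, E U -> E V -> E W -> T U V -> T V W -> T U W)
  (T_C : forall U V, E U -> E V -> T U V -> T (~` U) V)
  (T_sym : forall U V, E U -> E V -> T U V -> T V U)
  (T_next : forall U V, E U -> E V -> same_end (~` U) V -> T U V).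

(** Induction on the finite interval between [U] and [V]. If nothing lies strictly inside, then
    either the two sets are equal or the complement of [U] and [V] end at the same block. *)
Lemma nest_connect_sub U V : E U -> E V -> U `<=` V -> T U V.
Proof.
move=> EU EV; move: (nest_interval hE EU EV).
set I := [set _ | _]; move E0: I => J fJ.
move: fJ U V EU EV @I E0; elim/finite_proper_ind => {}J fJ IH U V EU EV I IJ UV.
have [->|nUV] := pselect (U = V); first exact: T_refl.
have [[W [EW UW WV [WU WV']]]|no] := pselect (exists W, [/\ E W, U `<=` W, W `<=` V &
    W <> U /\ W <> V]).
  apply: (T_trans EU EW EV).
    apply: (IH [set X | [/\ E X, U `<=` X & X `<=` W]]) => //; rewrite -IJ; split.
      by move=> X [EX UX XW]; split=> // x /XW/WV.
    move=> h; have [_ _ VW] : [/\ E V, U `<=` V & V `<=` W] by apply: h; split.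
    by apply: WV'; apply/seteqP.
  apply: (IH [set X | [/\ E X, W `<=` X & X `<=` V]]) => //; rewrite -IJ; split.
    by move=> X [EX UX XW]; split=> // x /UW/UX.
  move=> h; have [_ WU' _] : [/\ E U, W `<=` U & U `<=` V] by apply: h; split.
  by apply: WU; apply/seteqP.
apply: T_next => //; right; rewrite setCK; split.
  by split=> // VU; apply: nUV; apply/seteqP.
move=> W EW UW WV; apply: contrapT => /not_orP[WU WV']; apply: no.
by exists W; split.
Qed.

Lemma nest_connect U V : E U -> E V -> T U V.
Proof.
move=> EU EV; have [EU' EV'] := (nestC hE EU, nestC hE EV).
have [h|h|h|h] := nested hE EU EV.
- exact: nest_connect_sub.
- apply: T_sym => //; rewrite -(setCK V); apply: T_C => //; apply: T_sym => //.
  exact: nest_connect_sub.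
- rewrite -(setCK U); apply: T_C => //; exact: nest_connect_sub.
- by apply: T_sym => //; exact: nest_connect_sub.
Qed.
End Connected.

Lemma nest_tree : E !=set0 -> is_tree nest_graph.
Proof.
move=> [U0 EU0]; apply: (is_treeI nest_no_loop).
  by exists; exact: (mid_vertex (exist _ U0 EU0)).
pose conn (u v : vertex nest_graph) := exists p, walk u p v.
have conn_trans u v w : conn u v -> conn v w -> conn u w.
  by move=> [p wp] [q wq]; exists (p ++ q); exact: (walk_catI wp).
have conn_sym u v : conn u v -> conn v u.
  by move=> [p wp]; exists (walk_rev p); exact: walk_revP.
have conn_block (U : nest_edge) : conn (mid_vertex U) (block_vertex U).
  by exists [:: (U, true) : dart nest_graph].
pose T U V := forall (EU : E U) (EV : E V),
  conn (mid_vertex (exist _ U EU)) (mid_vertex (exist _ V EV)).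
have midC U (EU : E U) (EU' : E (~` U)) :
    mid_vertex (exist _ _ EU') = mid_vertex (exist _ _ EU).
  by apply: nest_class_inj => /=; rewrite midpointC.
have TT U V : E U -> E V -> T U V.
  apply: nest_connect => {U V}.
  - move=> U _ EU EV; rewrite (Prop_irrelevance EU EV); by exists [::].
  - by move=> U V W _ EV _ UV VW EU EW; exact: (conn_trans _ _ _ (UV EU EV) (VW EV EW)).
  - by move=> U V EU _ UV EU' EV; rewrite (midC _ EU); exact: UV.
  - by move=> U V _ _ UV EU EV; apply: conn_sym; exact: UV.
  - move=> U V _ _ UV EU EV; have EU' := nestC hE EU.
    rewrite -(midC _ EU EU'); apply: (conn_trans _ _ _ (conn_block _)).
    rewrite (_ : block_vertex _ = block_vertex (exist _ V EV)).
      exact/conn_sym/conn_block.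
    by apply: nest_class_inj => /=; congr pair; apply/(block_eqP EU' EV).
have to_mid (v : vertex nest_graph) : exists U : nest_edge, conn v (mid_vertex U).
  case: v => c [U EU [] e].
    exists (exist _ U EU); exists [::]; exact: nest_class_inj.
  exists (exist _ U EU); rewrite (_ : NestVertex _ = block_vertex (exist _ U EU)).
    exact/conn_sym/conn_block.
  exact: nest_class_inj.
move=> u v; have [[U EU] uU] := to_mid u; have [[V EV] vV] := to_mid v.
apply: (conn_trans _ _ _ uU); apply: (conn_trans _ _ _ _ (conn_sym _ _ vV)).
exact: TT.
Qed.

End NestedTree.

(** * The action on the dual tree and its fixed vertices *)

Section NestedAction.
Variables (B : Type) (G : groupType) (A : G -> B -> B) (E : set (set B)).
Hypotheses (A1 : forall b, A 1%g b = b)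
  (AM : forall g h b, A (g * h)%g b = A g (A h b))
  (hE : nested_family E) (E_act : forall g U, E U -> E (translate A g U))
  (block_finite : forall U, E U -> finite_set (block E U)).
Local Notation tr := (translate A).
Implicit Types U V W : set B.

Lemma same_end_translate g U V : same_end E U V -> same_end E (tr g U) (tr g V).
Proof.
move=> [->|[[UV VU] h]]; [by left|right; split].
  by rewrite -translateC; split; [move=> b; exact: UV|move/(translateS A1 AM)].
move=> W EW; rewrite -(translateKV A1 AM g W) -translateC.
move=> /(translateS A1 AM) UW /(translateS A1 AM) WV.
by have [->|->] := h _ (E_act g^-1%g EW) UW WV; [left|right].
Qed.

Lemma block_translate g U : block E (tr g U) = [set tr g V | V in block E U].
Proof.
apply/seteqP; split=> [W [EW UW]|_ [V [EV UV] <-]]; last first.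
  by split; [exact: E_act|exact: same_end_translate].
exists (tr g^-1%g W); last by rewrite translateKV.
split; first exact: E_act.
by rewrite -(translateK A1 AM g U); exact: same_end_translate.
Qed.

Lemma midpoint_translate g U : midpoint (tr g U) = [set tr g V | V in midpoint U].
Proof.
apply/seteqP; split=> [W [->|->]|_ [V [->|->] <-]].
- by exists U => //; left.
- by exists (~` U) => //; right.
- by left.
- by right.
Qed.

Lemma nest_actV_subproof g (v : nest_vertex E) : exists2 U, E U &
  ((nest_class v).1, [set tr g V | V in (nest_class v).2]) = (true, midpoint U) \/
  ((nest_class v).1, [set tr g V | V in (nest_class v).2]) = (false, block E U).
Proof.
case: v => c [U EU h]; exists (tr g U); first exact: E_act.
by rewrite midpoint_translate block_translate /=; case: h => ->; [left|right].
Qed.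

Definition nest_actV g v := NestVertex (nest_actV_subproof g v).
Definition nest_actE g (U : nest_edge E) : nest_edge E :=
  exist _ (tr g (sval U)) (E_act g (svalP U)).

Lemma nest_action : graph_action (X := nest_graph E) nest_actV nest_actE.
Proof.
split.
- move=> v; apply: nest_class_inj; case: v => -[k C] h /=; congr pair.
  by apply/seteqP; split=> [_ [V CV <-]|V CV];
    [rewrite translate1|exists V => //; rewrite translate1].
- move=> g h v; apply: nest_class_inj; case: v => -[k C] p /=; congr pair.
  apply/seteqP; split=> [_ [V CV <-]|_ [_ [V CV <-] <-]].
    by exists (tr h V); [exists V|rewrite translateM].
  by exists V => //; rewrite translateM.
- by move=> [U EU]; apply: eq_exist => /=; exact: translate1.
- by move=> g h [U EU]; apply: eq_exist => /=; exact: translateM.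
- by move=> g [U EU]; apply: nest_class_inj => /=; rewrite midpoint_translate.
- by move=> g [U EU]; apply: nest_class_inj => /=; rewrite block_translate.
Qed.

Section Fixed.
Variable H : {pred G}.
Hypothesis hH : group_closed H.

Let H1 : 1%g \in H. Proof. by case: hH. Qed.
Let HM : forall g h, g \in H -> h \in H -> (g * h)%g \in H.
Proof. exact: (group_closedM hH). Qed.
Let HV : forall g, g \in H -> g^-1%g \in H.
Proof. exact: (group_closedV hH). Qed.

(** If [W] is in the block of [U], each translate of [W] is in the block of the corresponding
    translate of [U]. Blocks being finite, finiteness of the orbit spreads from edge to edge. *)
Lemma orbit_finite_all U W : E U -> E W ->
  finite_set (orbit_of A H U) -> finite_set (orbit_of A H W).
Proof.
pose fo V := finite_set (orbit_of A H V).
have foC V : fo (~` V) <-> fo V.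
  suff h X : fo X -> fo (~` X) by split; [move/h; rewrite setCK|exact: h].
  move=> fX; apply: sub_finite_set (finite_image (@setC B) fX) => _ [g gH <-].
  by exists (tr g X); [exists g|].
have step V X : E V -> E X -> same_end E V X -> fo V -> fo X.
  move=> EV EX VX fV.
  apply: (@sub_finite_set _ _ (\bigcup_(Y in orbit_of A H V) block E Y)).
    move=> _ [g gH <-]; exists (tr g V); first by exists g.
    by split; [exact: E_act|exact: same_end_translate].
  by apply: bigcup_finite => // _ [g gH <-]; apply: block_finite; exact: E_act.
move=> EU EW; suff [h _] : (fo U -> fo W) /\ (fo W -> fo U) by [].
apply: (nest_connect hE (T := fun U W => (fo U -> fo W) /\ (fo W -> fo U))) => //.
- by move=> X Y Z _ _ _ [h1 h2] [h3 h4]; split; [move/h1/h3|move/h4/h2].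
- by move=> X Y _ _ [h1 h2]; split; [move/foC/h1|move/h2/foC].
- by move=> X Y _ _ [].
- move=> X Y EX EY XY; have EX' := nestC hE EX.
  split; first by move/foC; exact: step XY.
  by move=> fY; apply/foC; apply: step fY => //; exact: same_end_sym.
Qed.

(** [D] is the edge set of a finite invariant subtree and its minimal members are the edges pointing
    to leaves. Pruning all leaves preserves the hypotheses and is repeated until only one edge or a
    star remains; the midpoint or the centre is then fixed. *)
Lemma convex_fixed (D : set (set B)) : finite_set D -> D !=set0 ->
  D `<=` E -> (forall U, D U -> D (~` U)) ->
  (forall h U, h \in H -> D U -> D (tr h U)) ->
  (forall U V W, D U -> D W -> E V -> U `<=` V -> V `<=` W -> D V) ->
  exists v : nest_vertex E, forall h, h \in H -> nest_actV h v = v.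
Proof.
elim/finite_proper_ind => {}D fD IH [U0 DU0] DE DC DH DX.
pose minimal U := D U /\ forall V, D V -> V `<=` U -> V = U.
have minH h U : h \in H -> minimal U -> minimal (tr h U).
  move=> hh [DU mU]; split; first exact: DH.
  move=> V DV; rewrite -(translateKV A1 AM h V) => /(translateS A1 AM) VU.
  by rewrite (mU _ (DH _ _ (HV hh) DV) VU).
pose D' := [set U | [/\ D U, ~ minimal U & ~ minimal (~` U)]].
have exmin U : D U -> exists2 V, minimal V & V `<=` U.
  by move=> DU; have [V [DV VU] mV] := finite_minimal fD DU; exists V.
have [[U D'U]|no] := pselect (D' !=set0).
  apply: (IH D'); [|by exists U|by move=> V [/DE]| | |].
  - split; first by move=> V [].
    move=> h; have [V mV _] := exmin U0 DU0.
    by have [_ /(_ mV)] := h V (proj1 mV).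
  - by move=> V [DV m m']; split; [exact: DC|by []|rewrite setCK].
  - move=> h V hh [DV m m']; split; first exact: DH.
      by move/(minH _ _ (HV hh)); rewrite (translateK A1 AM).
    by rewrite -translateC; move/(minH _ _ (HV hh)); rewrite (translateK A1 AM).
  - move=> V X W [DV mV _] [DW _ mW] EX VX XW; have DX' := DX _ _ _ DV DW EX VX XW.
    split=> //; first by move=> mX; apply: mV; rewrite (proj2 mX _ DV VX).
    move=> mX; apply: mW; rewrite (proj2 mX (~` W))//; first exact: DC.
    exact: subsetC.
have all U : D U -> minimal U \/ minimal (~` U).
  by move=> DU; apply: contrapT => /not_orP[? ?]; apply: no; exists U.
have [U mU _] := exmin U0 DU0; have DU := proj1 mU; have EU := DE _ DU.
(* If both orientations of [U] point to leaves, the subtree is a single edge. Otherwise all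
   complements of minimal sets point to one block, the centre of the star. *)
have [mU'|nmU'] := pselect (minimal (~` U)).
  have only V : minimal V -> V = U \/ V = ~` U.
    move=> mV; have DV := proj1 mV.
    have [h|h|h|h] := nested hE EU (DE _ DV).
    - by left; rewrite (proj2 mV _ DU h).
    - by right; apply: (proj2 mU' _ DV); exact: subsetCr.
    - by right; rewrite (proj2 mV _ (DC _ DU) h).
    - by left; exact: (proj2 mU _ DV h).
  exists (mid_vertex (exist _ U EU)) => h hh; apply: nest_class_inj => /=.
  rewrite -midpoint_translate; congr pair.
  by have [->//|->] := only _ (minH _ _ hh mU); rewrite midpointC.
have EU' := nestC hE EU.
exists (block_vertex (exist _ (~` U) EU')) => h hh; apply: nest_class_inj => /=.
rewrite -block_translate; congr pair; apply/(block_eqP hE) => //.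
  exact: E_act.
have mh := minH _ _ hh mU; rewrite translateC; set V := tr h U in mh *.
have EV := DE _ (proj1 mh).
have [VU|VU] := pselect (V = U); first by left; rewrite VU.
right; rewrite setCK.
have VU' : V `<=` ~` U.
  have [k|k|k|k] := nested hE EU EV.
  - by case: VU; rewrite (proj2 mh _ DU k).
  - exact: subsetCr.
  - by case: nmU'; rewrite (proj2 mh _ (DC _ DU) k).
  - by case: VU; rewrite (proj2 mU _ (proj1 mh) k).
split.
  split=> // k; apply: nmU'; have <- : V = ~` U by apply/seteqP.
  exact: mh.
move=> W EW VW WU; have DW := DX _ _ _ (proj1 mh) (DC _ DU) EW VW WU.
have [mW|mW] := all _ DW; first by left; rewrite (proj2 mW _ (proj1 mh) VW).
by right; rewrite (proj2 mW U)// ?setCK//; exact: subsetCr.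
Qed.

Lemma nest_fixed : E !=set0 ->
  (exists v : nest_vertex E, forall h, h \in H -> nest_actV h v = v) <->
  (forall U, E U -> finite_set (orbit_of A H U)).
Proof.
move=> [U0 EU0]; split=> [[v hv]|fin].
  have hv2 h : h \in H -> [set tr h V | V in (nest_class v).2] = (nest_class v).2.
    by move=> /hv /(congr1 (fun x => (nest_class x).2)).
  case: v hv hv2 => c [U EU h] _ /= hv2.
  suff fU : finite_set (orbit_of A H U) by move=> W EW; exact: orbit_finite_all fU.
  have [cU fc] : c.2 U /\ finite_set c.2.
    case: h => ->; split=> /=; first by left.
    - exact: finite_set2.
    - by split=> //; left.
    - exact: block_finite.
  by apply: sub_finite_set fc => _ [g gH <-]; rewrite -(hv2 g gH); exists U.
pose D0 := orbit_of A H U0 `|` [set ~` U | U in orbit_of A H U0].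
have fD0 : finite_set D0.
  by rewrite finite_setU; split; [exact: fin|apply/finite_image/fin].
have D0E : D0 `<=` E.
  by move=> _ [[g _ <-]|[_ [g _ <-] <-]]; [|apply: (nestC hE)]; exact: E_act.
have D0C U : D0 U -> D0 (~` U).
  by move=> [UO|[V VO <-]]; [right; exists U|left; rewrite setCK].
have D0H h U : h \in H -> D0 U -> D0 (tr h U).
  move=> hh [[g gH <-]|[_ [g gH <-] <-]]; [left|right].
    by exists (h * g)%g; rewrite ?translateM//; exact: HM.
  exists (tr (h * g)%g U0); first by exists (h * g)%g => //; exact: HM.
  by rewrite translateM.
(* The convex hull of the orbit of one edge, in both orientations; it is finite because intervals
   are. *)
pose D := \bigcup_(P in D0 `*` D0) [set W | [/\ E W, P.1 `<=` W & W `<=` P.2]].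
apply: (@convex_fixed D).
- apply: bigcup_finite; first exact: finite_setX.
  by move=> [U V] [/D0E EU /D0E EV]; exact: nest_interval.
- have D0U : D0 U0 by left; exists 1%g; rewrite ?translate1.
  by exists U0; exists (U0, U0); split.
- by move=> W [P _ []].
- move=> W [[U V] /= [DU DV] [EW UW WV]]; exists (~` V, ~` U).
    by split=> /=; exact: D0C.
  by split=> /=; [exact: nestC|exact: subsetC|exact: subsetC].
- move=> h W hh [[U V] /= [DU DV] [EW UW WV]]; exists (tr h U, tr h V).
    by split=> /=; exact: D0H.
  by split=> /=; [exact: E_act|apply/(translateS A1 AM)|apply/(translateS A1 AM)].
- move=> X Y Z [[U V] /= [DU DV] [EX UX XV]] [[U' V'] /= [DU' DV'] [EZ UZ ZV]] EY XY YZ.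
  exists (U, V') => //; split=> //=; first by move=> x /UX/XY.
  by move=> x /YZ/ZV.
Qed.

End Fixed.

Lemma nested_bass_serre (s : set (set B)) : E !=set0 -> finite_set s ->
  (forall U, E U -> exists g V, [/\ s V, E V & U = tr g V]) ->
  exists (Gam : graph_of_groups) (F : set (edge Gam)),
    [/\ finite_graph Gam, is_tree (spanning_subgraph F),
        finite_index_injections Gam &
        exists2 phi : {multiplicative G -> pi1 F}, bijective phi &
          forall H : {pred G}, group_closed H ->
            (exists x : vertex (bass_serre_tree F),
               forall h, h \in H -> bass_serre_act (phi h) x = x) <->
            (forall U, E U -> finite_set (orbit_of A H U))].
Proof.
move=> E0 fs hs.
pose sE := [set e : nest_edge E | s (sval e)].
have fE : finite_set sE by apply: finite_preimage fs => x y _ _; exact: sval_inj.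
pose sV := [set mid_vertex e | e in sE] `|` [set block_vertex e | e in sE].
have hsE (e : edge (nest_graph E)) : exists g u, sE u /\ e = nest_actE g u.
  case: e => U EU; have [g [V [sV' EV e]]] := hs U EU.
  by exists g, (exist _ V EV); split=> //; exact: eq_exist.
have [|v|||v|v|] := @bass_serre (nest_graph E) G nest_actV nest_actE sV sE (nest_tree hE E0) nest_action.
- by rewrite finite_setU; split; exact: finite_image.
- case: v => c [U EU h].
  have [g [u [su e]]] := hsE (exist _ U EU).
  have ea := congr1 (@source (nest_graph E)) e; have eb := congr1 (@target (nest_graph E)) e.
  rewrite (act_source nest_action) in ea; rewrite (act_target nest_action) in eb.
  have [hc|hc] := h.
    exists g, (mid_vertex u); split; first by left; exists u.
    by rewrite -[RHS]ea; exact: nest_class_inj.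
  exists g, (block_vertex u); split; first by right; exists u.
  by rewrite -[RHS]eb; exact: nest_class_inj.
- exact: fE.
- exact: hsE.
- have [[U hU]|no] := pselect (exists U : nest_edge E, mid_vertex U = v); last first.
    apply: (@sub_finite_set _ _ set0); last exact: finite_set0.
    by move=> e he; case: no; exists e.
  have f2 : finite_set (@sval _ E @^-1` (midpoint (sval U))).
    by apply: finite_preimage; [move=> x y _ _; exact: sval_inj|exact: finite_set2].
  apply: sub_finite_set f2 => e /= he.
  have := congr1 (fun x : nest_vertex E => (nest_class x).2) (etrans he (esym hU)).
  by move=> /= <-; left.
- have [[U hU]|no] := pselect (exists U : nest_edge E, block_vertex U = v); last first.
    apply: (@sub_finite_set _ _ set0); last exact: finite_set0.
    by move=> e he; case: no; exists e.
  have f2 : finite_set (@sval _ E @^-1` (block E (sval U))).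
    apply: finite_preimage; first by move=> x y _ _; exact: sval_inj.
    by apply: block_finite; exact: svalP.
  apply: sub_finite_set f2 => e /= he.
  have := congr1 (fun x : nest_vertex E => (nest_class x).2) (etrans he (esym hU)).
  by move=> /= <-; split; [exact: svalP|left].
- move=> Gam [F [h1 h2 h3 [phi bphi hphi]]]; exists Gam, F; split=> //.
  exists phi => // H hH; rewrite hphi; exact: nest_fixed.
Qed.

End NestedAction.

(** * Convergence actions on compact spaces *)

Lemma ncard_image_le (T U : choiceType) (f : T -> U) (A : set T) :
  finite_set A -> (ncard (f @` A) <= ncard A)%N.
Proof.
by move=> fA; rewrite /ncard fset_set_image//; exact: finmap.leq_imfset_card.
Qed.

Section Crossing.
Variable B : Type.
Implicit Types U V W : set B.

Definition crosses U V := [/\ U `&` V !=set0, U `&` ~` V !=set0,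
  ~` U `&` V !=set0 & ~` U `&` ~` V !=set0].

Lemma crossesC U V : crosses U (~` V) <-> crosses U V.
Proof.
suff h W : crosses U W -> crosses U (~` W) by split=> [/h|/h//]; rewrite setCK.
by move=> [h1 h2 h3 h4]; split; rewrite ?setCK.
Qed.

Lemma crossesP U V : [\/ U `<=` V, U `<=` ~` V, ~` U `<=` V | V `<=` U] \/ crosses U V.
Proof.
have sub (X Y : set B) : X `&` ~` Y !=set0 \/ X `<=` Y.
  have [h|h] := pselect (X `&` ~` Y !=set0); [by left|right=> x Xx].
  by apply: contrapT => nY; apply: h; exists x.
have [h1|h1] := sub U V; last by left; apply: Or41.
have [h2|h2] := sub U (~` V); last by left; apply: Or42.
have [h3|h3] := sub (~` U) V; last by left; apply: Or43.
have [h4|h4] := sub V U; last by left; apply: Or44.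
by right; split=> //; [rewrite -(setCK V)|rewrite setIC].
Qed.

Definition crossing (F : set (set B)) U := [set W | F W /\ crosses W U].

Lemma crossingC F U : crossing F (~` U) = crossing F U.
Proof. by apply/seteqP; split=> W [FW /crossesC h]. Qed.

(** If both [W] and its complement leave [U], then [W] crosses [U]. Otherwise one of the two stays
    in [U], hence leaves [V], while the other contains the common outside point [z0]; so [W] crosses
    [V]. *)
Lemma crosses_meet U V W : ~` U `&` ~` V !=set0 -> crosses W (U `&` V) ->
  crosses W U \/ crosses W V.
Proof.
move=> [z0 [nUo nVo]] [[x [Wx [Ux Vx]]] [y [Wy nUVy]] [x' [Wx' [Ux' Vx']]] [y' [Wy' nUVy']]].
have [[z [Wz nUz]]|noU] := pselect (exists z, W z /\ ~ U z).
  have [[z' [Wz' nUz']]|noU'] := pselect (exists z, ~ W z /\ ~ U z).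
    by left; split; [exists x|exists z|exists x'|exists z'].
  have subU' t : ~ W t -> U t by move=> nWt; apply: contrapT => nUt; apply: noU'; exists t.
  right; split; [by exists x| |by exists x'|].
    by exists z0; split=> //; apply: contrapT => /subU'.
  by exists y'; split=> // Vy'; apply: nUVy'; split=> //; exact: subU'.
have subU t : W t -> U t by move=> nWt; apply: contrapT => nUt; apply: noU; exists t.
right; split; [by exists x| |by exists x'|].
  by exists y; split=> // Vy; apply: nUVy; split=> //; exact: subU.
by exists z0; split=> // /subU.
Qed.

(** A set crossing a corner crosses [U] or [V], and one crossing two opposite corners crosses both.
    Strictness comes from [U] itself: when it belongs to [F] it is counted for [V], but for neither
    corner. *)
Lemma crossing_submodular F U V : crosses U V ->
  finite_set (crossing F U) -> finite_set (crossing F V) ->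
  (ncard (crossing F (U `&` V)) + ncard (crossing F (~` U `&` ~` V)) <=
   ncard (crossing F U) + ncard (crossing F V))%N /\
  (F U -> (ncard (crossing F (U `&` V)) + ncard (crossing F (~` U `&` ~` V)) <
   ncard (crossing F U) + ncard (crossing F V))%N).
Proof.
move=> [UV UV' U'V U'V'] fU fV.
have fUV : finite_set (crossing F U `|` crossing F V) by rewrite finite_setU.
have su : crossing F (U `&` V) `|` crossing F (~` U `&` ~` V) `<=`
    crossing F U `|` crossing F V.
  move=> W [[FW]|[FW]].
    by move/(crosses_meet U'V')=> [h|h]; [left|right].
  move/(@crosses_meet (~` U) (~` V)); rewrite !setCK => /(_ UV).
  by move=> [/crossesC h|/crossesC h]; [left|right].
have si : crossing F (U `&` V) `&` crossing F (~` U `&` ~` V) `<=`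
    crossing F U `&` crossing F V.
  move=> W [[FW [[x [Wx [Ux Vx]]] _ [y [Wy [Uy Vy]]] _]]].
  move=> [_ [[x' [Wx' [Ux' Vx']]] _ [y' [Wy' [Uy' Vy']]] _]].
  by split; split=> //; split; [exists x|exists x'|exists y|exists y'|exists x|exists x'|exists y|exists y'].
have fI : finite_set (crossing F (U `&` V)).
  by apply: sub_finite_set fUV => W h; apply: su; left.
have fO : finite_set (crossing F (~` U `&` ~` V)).
  by apply: sub_finite_set fUV => W h; apply: su; right.
have := ncardUI fI fO; have := ncardUI fU fV.
have := ncardS fUV su; have := ncardS (sub_finite_set (@subIsetl _ _ _) fU) si.
move=> e1 e2 e3 e4. split; first by rewrite -e3 -e4 leq_add.
move=> FU; suff : (ncard (crossing F (U `&` V) `|` crossing F (~` U `&` ~` V)) <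
   ncard (crossing F U `|` crossing F V))%N.
  by move=> e5; rewrite -e3 -e4 -addSn leq_add.
apply: ncard_proper => //; split=> // h.
have [] : (crossing F (U `&` V) `|` crossing F (~` U `&` ~` V)) U.
- by apply: h; right; split=> //; split.
- by move=> [_ [_ _ [x [nUx [Ux _]]] _]].
- by move=> [_ [[x [Ux [nUx _]]] _ _ _]].
Qed.

Lemma crossing_submodular' F U V : crosses U V ->
  finite_set (crossing F U) -> finite_set (crossing F V) ->
  (ncard (crossing F (U `&` ~` V)) + ncard (crossing F (~` U `&` V)) <=
   ncard (crossing F U) + ncard (crossing F V))%N /\
  (F U -> (ncard (crossing F (U `&` ~` V)) + ncard (crossing F (~` U `&` V)) <
   ncard (crossing F U) + ncard (crossing F V))%N).
Proof.
move=> /crossesC UV fU fV.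
have := crossing_submodular (F := F) UV fU.
by rewrite crossingC setCK; apply.
Qed.

End Crossing.

(* A uniform convergence action in combinatorial form: [bx] consists of finitely
   many triples of disjoint clopen sets whose translates cover the triple space,
   and [ca_conv] says that all but finitely many translates of a clopen set are small,
   or have small complement. *)
Section Dynamics.
Variables (B : topologicalType) (G : groupType) (A : G -> B -> B).
Local Notation tr := (translate A).

Record convergence_action (bx : set (set B * set B * set B)) : Prop := {
  ca_act1 : forall b, A 1%g b = b;
  ca_actM : forall g h b, A (g * h)%g b = A g (A h b);
  ca_clopen : forall g U, clopen U -> clopen (tr g U);
  ca_compact : compact [set: B];
  ca_sep : forall a b : B, a <> b -> exists U, [/\ clopen U, U a & ~ U b];
  ca_perfect : forall (U : set B) a, clopen U -> U a -> exists2 b, U b & b <> a;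
  ca_ne : exists b : B, True;
  ca_finite : finite_set bx;
  ca_box : forall P Q R, bx (P, Q, R) -> [/\ clopen P, clopen Q & clopen R] /\
    [/\ P `<=` ~` Q, P `<=` ~` R & Q `<=` ~` R];
  ca_cover : forall a b c : B, a <> b -> b <> c -> a <> c ->
    exists P Q R g, [/\ bx (P, Q, R), tr g P a, tr g Q b & tr g R c];
  ca_conv : forall W A1 A2, clopen W -> clopen A1 -> clopen A2 ->
    finite_set [set V | exists g, [/\ V = tr g W,
      (exists x y, [/\ V x, V y, A1 x & ~ A1 y]) &
      (exists x y, [/\ ~ V x, ~ V y, A2 x & ~ A2 y])]] }.

Variable bx : set (set B * set B * set B).
Hypothesis ca : convergence_action bx.

Let A1 := ca_act1 ca.
Let AM := ca_actM ca.
Implicit Types U V W D : set B.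

Definition translates (s : set (set B)) := [set V | exists g W, s W /\ V = tr g W].

Lemma translates_tr s g V : translates s V -> translates s (tr g V).
Proof. by move=> [h [W [sW ->]]]; exists (g * h)%g, W; rewrite translateM. Qed.

Lemma crosses_tr g U V : crosses (tr g U) (tr g V) <-> crosses U V.
Proof.
suff h k X Y : crosses X Y -> crosses (tr k X) (tr k Y).
  by split=> [/(h g^-1%g)|/h]//; rewrite !translateK.
move=> [[x1 [? ?]] [x2 [? ?]] [x3 [? ?]] [x4 [? ?]]].
split; [exists (A k x1)|exists (A k x2)|exists (A k x3)|exists (A k x4)];
  by split; rewrite ?translateP// /setC /= translateP.
Qed.

Lemma conv_crosses s U : finite_set s -> (forall W, s W -> clopen W) -> clopen U ->
  finite_set (crossing (translates s) U).
Proof.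
move=> fs cs cU.
apply: (@sub_finite_set _ _ (\bigcup_(W in s) [set V | exists g, [/\ V = tr g W,
      (exists x y, [/\ V x, V y, U x & ~ U y]) &
      (exists x y, [/\ ~ V x, ~ V y, U x & ~ U y])]])).
  move=> V [[g [W [sW e]]] [[x1 [? ?]] [x2 [? ?]] [x3 [? ?]] [x4 [? ?]]]].
  by exists W => //; exists g; split=> //; [exists x1, x2|exists x3, x4].
by apply: bigcup_finite => // W sW; apply: (ca_conv ca) => //; exact: cs.
Qed.

(** As there are no isolated points, [U] and the complement of [V] each contain two points. Clopen
    sets splitting these two pairs are the test sets given to [ca_conv]. *)
Lemma conv_between s U V : finite_set s -> (forall W, s W -> clopen W) ->
  clopen U -> clopen V -> U !=set0 -> ~` V !=set0 ->
  finite_set [set W | [/\ translates s W, U `<=` W & W `<=` V]].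
Proof.
move=> fs cs cU cV [x Ux] [z nVz].
have [y Uy xy] := ca_perfect ca cU Ux.
have [w nVw zw] := ca_perfect ca (clopenC setT cV) nVz.
have [D1 [cD1 D1y D1x]] := ca_sep ca xy.
have [D2 [cD2 D2w D2z]] := ca_sep ca zw.
apply: (@sub_finite_set _ _ (\bigcup_(W in s) [set V | exists g, [/\ V = tr g W,
      (exists x y, [/\ V x, V y, D1 x & ~ D1 y]) &
      (exists x y, [/\ ~ V x, ~ V y, D2 x & ~ D2 y])]])).
  move=> _ [[g [X [sX ->]]] UX XV]; exists X => //; exists g; split=> //.
    by exists y, x; split=> //; exact: UX.
  by exists w, z; split=> // /XV.
by apply: bigcup_finite => // W sW; apply: (ca_conv ca) => //; exact: cs.
Qed.

(* Points are conical: as [z] tends to [b], the translates of the boxes that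
   separate [b], [z] and a fixed [x] contract everything but a neighbourhood of
   one point to [b]. *)
Lemma conical D b x (S : set (set B)) : clopen D -> D b -> ~ D x ->
  finite_set S -> (forall U, S U -> clopen U) ->
  exists P Q R g, [/\ bx (P, Q, R), tr g P b, tr g P `<=` D, tr g R x &
    forall U, S U -> ~` D `<=` tr g U \/ ~` D `<=` ~` tr g U].
Proof.
move=> cD Db nDx fS cS.
(* Adding [P] to a set [U] of [S] and removing [Q] makes its translate separate [b] from [z]; off
   [D] this changes nothing, once the translates of [P] and [Q] are known to lie in [D]. *)
pose s := [set t.1.1 | t in bx] `|` [set t.1.2 | t in bx] `|`
   [set (U `|` t.1.1) `\` t.1.2 | U in S & t in bx].
have fs : finite_set s.
  rewrite !finite_setU; split; last exact: (finite_image2 _ fS (ca_finite ca)).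
  by split; apply: finite_image; exact: (ca_finite ca).
have cs U : s U -> clopen U.
  move=> [[[[[P Q] R] h <-]|[[[P Q] R] h <-]]|[V SV [[[P Q] R] h <-]]] /=;
    have [[cP cQ cR] _] := ca_box ca h => //.
  apply: clopenI; last exact: clopenC.
  by apply: clopenU => //; exact: cS.
have fY := conv_crosses fs cs cD.
have cY U : crossing (translates s) D U -> clopen U.
  by move=> [[g [W [/cs cW ->]]] _]; exact: (ca_clopen ca).
(* No translate crossing [D] splits [N]. As [b] and [z] both lie in [N], a translate of a member of
   [s] that separates them cannot cross [D]; this excludes every bad position below. *)
have [N [cN Nb hN]] := finite_nbhd b fY cY.
have [z [Dz Nz] zb] := ca_perfect ca (clopenI cD cN) (conj Db Nb).
have zx : z <> x by move=> e; apply: nDx; rewrite -e.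
have bx' : b <> x by move=> e; apply: nDx; rewrite -e.
have [P [Q [R [g [bPQR Pb Qz Rx]]]]] := ca_cover ca (nesym zb) zx bx'.
exists P, Q, R, g.
have [_ [PQ PR QR]] := ca_box ca bPQR.
have ncross U : s U -> tr g U b -> ~ tr g U z -> ~ crosses (tr g U) D.
  move=> sU Ub nUz cr; have [//|h|h] := hN (tr g U).
  - by split=> //; exists g, U.
  - by apply: nUz; exact: h.
  - by case: (h b Nb).
have ncross' U : s U -> ~ tr g U b -> tr g U z -> ~ crosses (tr g U) D.
  move=> sU Ub nUz cr; have [//|h|h] := hN (tr g U).
  - by split=> //; exists g, U.
  - by apply: Ub; exact: h.
  - by case: (h z Nz).
have PD : tr g P `<=` D.
  have nPz : ~ tr g P z by move/PQ.
  have sP : s P by left; left; exists (P, Q, R).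
  move=> y Py; apply: contrapT => nDy; apply: (ncross _ sP Pb nPz); split.
  - by exists b.
  - by exists y.
  - by exists z.
  - by exists x; split=> // /PR.
have QD : tr g Q `<=` D.
  have nQb : ~ tr g Q b by move/PQ: Pb.
  have sQ : s Q by left; right; exists (P, Q, R).
  move=> y Py; apply: contrapT => nDy; apply: (ncross' _ sQ nQb Qz); split.
  - by exists z.
  - by exists y.
  - by exists b.
  - by exists x; split=> // /QR.
split=> // U SU.
have sU : s ((U `|` P) `\` Q) by right; exists U => //; exists (P, Q, R).
have Ub : tr g ((U `|` P) `\` Q) b by split; [right|move/PQ: Pb].
have nUz : ~ tr g ((U `|` P) `\` Q) z by case.
have key y : ~ D y -> (tr g ((U `|` P) `\` Q) y <-> tr g U y).
  move=> nDy; split=> [[[//|/PD]]|Uy]//.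
  by split; [left|move/QD].
have nc := ncross _ sU Ub nUz.
have [h|h] := pselect (exists y, ~ D y /\ ~ tr g U y); last first.
  by left=> y nDy; apply: contrapT => nUy; apply: h; exists y.
right=> y nDy Uy; apply: nc; have [w [nDw nUw]] := h; split.
- by exists b.
- by exists y; split=> //; apply/key.
- by exists z.
- by exists w; split=> // /(key w nDw).
Qed.

(** * Box sides and cheap clopen sets *)

Definition parts : set (set B) :=
  [set t.1.1 | t in bx] `|` [set ~` t.1.1 | t in bx].

Lemma parts_finite : finite_set parts.
Proof. by rewrite finite_setU; split; apply: finite_image; exact: (ca_finite ca). Qed.

Lemma parts_clopen U : parts U -> clopen U.
Proof.
move=> [[[[P Q] R] h <-]|[[[P Q] R] h <-]] /=;
  have [[cP _ _] _] := ca_box ca h => //; exact: clopenC.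
Qed.

Lemma partsC U : parts U -> parts (~` U).
Proof. by move=> [[t h <-]|[t h <-]]; [right|left]; exists t; rewrite ?setCK. Qed.

Local Notation box_sides := (translates parts).

Lemma box_sides_clopen U : box_sides U -> clopen U.
Proof. by move=> [g [W [/parts_clopen cW ->]]]; exact: (ca_clopen ca). Qed.

Lemma box_sidesC U : box_sides U -> box_sides (~` U).
Proof. by move=> [g [W [/partsC sW ->]]]; exists g, (~` W). Qed.

Lemma box_sides_basis D b x : clopen D -> D b -> ~ D x ->
  exists W, [/\ box_sides W, W b & W `<=` D].
Proof.
move=> cD Db nDx.
have [||P [Q [R [g [bPQR Pb PD _ _]]]]] := @conical D b x set0 cD Db nDx.
- exact: finite_set0.
- by [].
- by exists (tr g P); split=> //; exists g, P; split=> //; left; exists (P, Q, R).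
Qed.

Lemma crossing_finite U : clopen U -> finite_set (crossing box_sides U).
Proof. by move=> cU; apply: conv_crosses => //; [exact: parts_finite|exact: parts_clopen]. Qed.

Definition cost (F : set (set B)) U := ncard (crossing F U).

Lemma cost_tr F g U : (forall g V, F V -> F (tr g V)) ->
  finite_set (crossing F U) -> finite_set (crossing F (tr g U)) ->
  cost F (tr g U) = cost F U.
Proof.
move=> FG.
suff h k V : finite_set (crossing F V) -> (cost F (tr k V) <= cost F V)%N.
  move=> fU fgU; apply/eqP; rewrite eqn_leq h//=.
  by have := h g^-1%g _ fgU; rewrite translateK.
move=> fV; apply: leq_trans (ncard_image_le (tr k) fV).
apply: ncardS; first exact: finite_image.
move=> W [FW cr]; exists (tr k^-1%g W); last by rewrite translateKV.
split; first exact: FG.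
by rewrite -(crosses_tr k) translateKV.
Qed.

Lemma costC F U : cost F (~` U) = cost F U.
Proof. by rewrite /cost crossingC. Qed.

Definition proper_clopen U := [/\ clopen U, U !=set0 & ~` U !=set0].

Definition cheap N U := proper_clopen U /\ (cost box_sides U <= N)%N.

Lemma cost_box_sides_tr g U : clopen U -> cost box_sides (tr g U) = cost box_sides U.
Proof.
move=> cU; apply: cost_tr; [exact: translates_tr|exact: crossing_finite|].
by apply: crossing_finite; exact: (ca_clopen ca).
Qed.

Lemma proper_clopen_tr g U : proper_clopen U -> proper_clopen (tr g U).
Proof.
move=> [cU [x Ux] [y nUy]]; split; first exact: (ca_clopen ca).
  by exists (A g x); apply/translateP.
by exists (A g y) => /(translateP A1 AM).
Qed.

Lemma cheap_tr N g U : cheap N U -> cheap N (tr g U).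
Proof.
move=> [pU kU]; split; first exact: proper_clopen_tr.
by rewrite cost_box_sides_tr//; case: pU.
Qed.

(** Up to translation there are finitely many [W]. Fixing [W] as a minimal box side around the
    complement of [U] removes the freedom of translating [U]. *)
Let fitted N W := [set U | [/\ cheap N U, ~` U `<=` W &
  forall V, box_sides V -> ~` U `<=` V -> V `<=` W -> V = W]].

(** If each point had a clopen neighbourhood that no fitted set splits, the fitted sets would have
    finitely many traces on each piece of a finite cover, and there would be finitely many of
    them. *)
Lemma fitted_limit_point N W : infinite_set (fitted N W) ->
  exists b, forall D, clopen D -> D b ->
    exists U, [/\ fitted N W U, D `&` U !=set0 & D `&` ~` U !=set0].
Proof.
move=> inf; apply: contrapT => no; apply: inf.
suff h : finite_set [set U `&` [set: B] | U in fitted N W].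
  by apply: sub_finite_set h => U hU; exists U; rewrite ?setIT.
apply: (@compact_ind B (fun S => finite_set [set U `&` S | U in fitted N W]));
  last exact: (ca_compact ca).
- apply: (@sub_finite_set _ _ [set set0]); last exact: finite_set1.
  by move=> _ [U _ <-]; rewrite setI0.
- move=> S1 S2 f1 f2; apply: sub_finite_set (finite_image2 (fun X Y => X `|` Y) f1 f2).
  move=> _ [U hU <-]; exists (U `&` S1); first by exists U.
  by exists (U `&` S2); [exists U|rewrite setIUr].
- move=> S1 S2 S12 f; apply: sub_finite_set (finite_image (fun X => X `&` S1) f).
  move=> _ [U hU <-]; exists (U `&` S2); first by exists U.
  by rewrite -setIA (setIidr S12).
- move=> b _.
  have [D [cD Db hD]] : exists D, [/\ clopen D, D b & forall U, fitted N W U ->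
      D `<=` U \/ D `<=` ~` U].
    apply: contrapT => nD; apply: no; exists b => D cD Db.
    apply: contrapT => nU; apply: nD; exists D; split=> // U hU.
    have [[y [Dy nUy]]|h] := pselect (exists y, D y /\ ~ U y); last first.
      by left=> y Dy; apply: contrapT => nUy; apply: h; exists y.
    right=> x Dx Ux; apply: nU; exists U; split=> //; [by exists x|by exists y].
  exists D; first by split=> //; case: cD.
  apply: (@sub_finite_set _ _ [set D; set0]); last exact: finite_set2.
  move=> _ [U /hD[h|h] <-]; [left|right]; first exact: setIidr.
  by apply/seteqP; split=> // x [Ux /h].
Qed.

(** A long chain of box sides shrinking to [b]. All of them contain [D], so a set splitting [D]
    splits each of them. *)
Lemma fitted_chain W b x : W b -> ~ W x -> clopen W -> forall n, exists C D,
  [/\ finite_set C /\ C `<=` box_sides, clopen D /\ D b, D `<` W,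
    (n <= ncard C)%N & forall V, C V -> D `<=` V /\ V `<` W].
Proof.
move=> Wb nWx cW; elim=> [|n [C [D [[fC CF] [cD Db] [DW WD] nC hC]]]].
  have [a Wa ab] := ca_perfect ca cW Wb.
  have [D [cD Db Da]] := ca_sep ca (nesym ab).
  exists set0, (W `&` D); split=> //.
  - by split=> //; exact: finite_set0.
  - by split=> //; exact: clopenI.
  - by split; [exact: subIsetl|move/(_ a Wa) => [_ /Da]].
have [a Da ab] := ca_perfect ca cD Db.
have [D' [cD' Db' Da']] := ca_sep ca (nesym ab).
have [|V [FV Vb VD]] := @box_sides_basis (D `&` D') b a (clopenI cD cD') (conj Db Db').
  by move=> [].
exists (V |` C), V; have cV := box_sides_clopen FV; split.
- by rewrite finite_setU; split; [split=> //; exact: finite_set1|move=> X [->|/CF]].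
- by [].
- split; first by move=> y /VD[/DW].
  by move=> WV; apply: WD => y /WV/VD[].
- apply: leq_ltn_trans nC _; apply: ncard_proper.
    by rewrite finite_setU; split=> //; exact: finite_set1.
  split; first by move=> X CX; right.
  move=> h; have CV : C V by apply: h; left.
  by have [/(_ a Da) /VD[_]] := hC V CV.
- move=> X [->|CX]; last first.
    by have [DX XW] := hC X CX; split=> // y /VD[/DX].
  split=> //; split; first by move=> y /VD[/DW].
  by move=> WV; apply: WD => y /WV/VD[].
Qed.

Lemma fitted_finite N W x : box_sides W -> ~ W x -> finite_set (fitted N W).
Proof.
move=> FW nWx; apply: contrapT => /fitted_limit_point[b hb].
have cW := box_sides_clopen FW.
have Wb : W b.
  apply: contrapT => nWb; have [U [[_ UW _] _ [y [nWy nUy]]]] := hb _ (clopenC setT cW) nWb.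
  by apply: nWy; exact: UW.
(* A member of this chain that contained the complement of [U] would contradict the minimality of
   [W]. So [U], which splits [D], crosses all of them, and they are more than its cost allows. *)
have [C [D [[fC CF] [cD Db] [DW WD] nC hC]]] := fitted_chain Wb nWx cW N.+1.
have [U [[[[cU _ _] kU] UW mU] [u [Du Uu]] [v [Dv nUv]]]] := hb D cD Db.
suff : C `<=` crossing box_sides U.
  by move=> /(ncardS (crossing_finite cU)) h; have := leq_trans nC (leq_trans h kU); rewrite ltnn.
move=> V CV; split; first exact: CF.
have [DV [VW nWV]] := hC V CV; split.
- by exists u; split=> //; exact: DV.
- by exists v; split=> //; exact: DV.
- by exists x; split=> [/VW//|]; apply: contrapT => /UW.
- apply: contrapT => no; apply: nWV; rewrite (mU V)//; first exact: CF.
  by move=> y nUy; apply: contrapT => nVy; apply: no; exists y.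
Qed.

(** The complement of a box side inside [U] is a box side around the complement of [U]; only
    finitely many others lie in between, so there is a minimal one. *)
Lemma cheap_fitted N U : cheap N U ->
  exists2 W, box_sides W /\ ~` W !=set0 & fitted N W U.
Proof.
move=> cpU; have [[cU [a Ua] nU] kU] := cpU; have [x nUx] := nU.
have [W0 [FW0 W0a W0U]] := box_sides_basis cU Ua (nUx : ~ U x).
have nW0 : ~` ~` W0 !=set0 by rewrite setCK; exists a.
have cW0 : clopen (~` W0) by apply: clopenC => //; exact: box_sides_clopen.
have fI := conv_between parts_finite parts_clopen (clopenC setT cU) cW0 nU nW0.
have [|W [[FW UW WW0] _] mW] := finite_minimal fI (U := ~` W0).
  by split=> //; [exact: box_sidesC|exact: subsetC].
exists W; first by split=> //; exists a => Wa; exact: (WW0 a Wa).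
split=> // V FV UV VW; apply: mW => //; split=> //.
by move=> y /VW/WW0.
Qed.

Lemma cheap_cofinite N : exists s, [/\ finite_set s, s `<=` cheap N &
  forall U, cheap N U -> translates s U].
Proof.
exists (\bigcup_(W in [set W | parts W /\ ~` W !=set0]) fitted N W); split.
- apply: bigcup_finite; first by apply: sub_finite_set parts_finite => W [].
  move=> W [pW [x nWx]]; apply: (@fitted_finite N W x) => //.
  by exists 1%g, W; rewrite translate1.
- by move=> U [W _ []].
move=> U cpU; have [_ [[g [W [pW ->]]] [x nWx]] [_ UW mU]] := cheap_fitted cpU.
exists g, (tr g^-1%g U); split; last by rewrite translateKV.
exists W; first by split=> //; exists (A g^-1%g x).
split; first exact: cheap_tr.
  by rewrite -translateC -(translateS A1 AM g) translateKV.
move=> V FV; rewrite -translateC -(translateS A1 AM g) translateKV// => UV VW.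
apply: (@translate_inj _ _ _ A1 AM g); apply: mU => //; first exact: translates_tr.
exact/(translateS A1 AM).
Qed.

Definition separates U (a b : B) := [/\ clopen U, U a & ~ U b].

(** Complete [a] and [b] to a triple. The first side of a translated box around it separates them,
    and its cost is that of one of finitely many boxes. *)
Lemma cheap_separates : exists N, forall a b, a <> b ->
  exists U, separates U a b /\ (cost box_sides U <= N)%N.
Proof.
have [N hN] := finite_bounded (fun t => cost box_sides t.1.1) (ca_finite ca).
exists N => a b ab; have [D [cD Da Db]] := ca_sep ca ab.
have [c Dc ca'] := ca_perfect ca cD Da.
have bc : b <> c by move=> e; apply: Db; rewrite e.
have [P [Q [R [g [h Pa Qb _]]]]] := ca_cover ca ab bc (nesym ca').
have [[cP _ _] [PQ _ _]] := ca_box ca h.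
exists (tr g P); split; last by rewrite cost_box_sides_tr//; exact: (hN _ h).
by split=> //; [exact: (ca_clopen ca)|move/PQ].
Qed.

(** * Separating sets of least cost *)

Section Optimal.
Variable N : nat.
Hypothesis hN : forall a b, a <> b ->
  exists U, separates U a b /\ (cost box_sides U <= N)%N.

Lemma cheap_crossing_finite U : clopen U -> finite_set (crossing (cheap N) U).
Proof.
move=> cU; have [s [fs sc hs]] := cheap_cofinite N.
apply: sub_finite_set (conv_crosses fs _ cU) => [W [/hs cW cr]|W /sc[[]]//].
by split.
Qed.

(* Ties are broken by counting the crossings with the cheap sets, which is
   strictly submodular on pairs of crossing cheap sets. *)
Definition cost_le U V := (cost box_sides U < cost box_sides V)%N \/
  cost box_sides U = cost box_sides V /\ (cost (cheap N) U <= cost (cheap N) V)%N.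

Definition optimal U a b := separates U a b /\
  forall V, separates V a b -> cost_le U V.

Definition optimal_family := [set U | exists a b, optimal U a b].

Lemma separates_neq U a b : separates U a b -> a <> b.
Proof. by move=> [_ Ua nUb] e; apply: nUb; rewrite -e. Qed.

Lemma separatesC U a b : separates U a b -> separates (~` U) b a.
Proof. by move=> [cU Ua nUb]; split=> //; exact: clopenC. Qed.

Lemma optimalC U a b : optimal U a b -> optimal (~` U) b a.
Proof.
move=> [sU oU]; split; first exact: separatesC.
move=> V /separatesC /oU; rewrite /cost_le !costC; case=> [h|[h1 h2]]; [by left|by right].
Qed.

Lemma optimal_exists a b : a <> b -> exists U, optimal U a b.
Proof.
move=> ab; pose p1 n := `[< exists U, separates U a b /\ cost box_sides U = n >].
have e1 : exists n, p1 n.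
  by have [U [sU _]] := hN ab; exists (cost box_sides U); apply/asboolP; exists U.
have [n1 /asboolP[U1 [sU1 c1]] m1] := ex_minnP e1.
pose p2 n := `[< exists U,
  [/\ separates U a b, cost box_sides U = n1 & cost (cheap N) U = n] >].
have e2 : exists n, p2 n by exists (cost (cheap N) U1); apply/asboolP; exists U1.
have [n2 /asboolP[U [sU cU c2]] m2] := ex_minnP e2.
exists U; split=> // V sV; rewrite /cost_le cU c2.
have : (n1 <= cost box_sides V)%N by apply: m1; apply/asboolP; exists V.
rewrite leq_eqVlt => /orP[/eqP e|]; last by left.
by right; split=> //; apply: m2; apply/asboolP; exists V.
Qed.

Lemma optimal_cheap U a b : optimal U a b -> cheap N U.
Proof.
move=> [sU oU]; have [V [sV cV]] := hN (separates_neq sU).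
have [cU Ua nUb] := sU; split; first by split=> //; [exists a|exists b].
by case: (oU V sV) => [/ltnW h|[-> _]] //; exact: leq_trans h cV.
Qed.

Lemma optimal_half U a b W : optimal U a b -> clopen W ->
  W a /\ ~ W b \/ W b /\ ~ W a -> cost_le U W.
Proof.
move=> [sU oU] cW [[Wa nWb]|[Wb nWa]]; first by apply: oU.
have := oU (~` W); rewrite /cost_le costC costC; apply.
by split=> //; exact: clopenC.
Qed.

(** A corner containing exactly one of [a] and [b] competes with [U], one containing exactly one of
    [c] and [d] with [V]. Usually two opposite corners compete with [U] and [V] respectively, which
    contradicts strict submodularity. The exception is when the four points lie in four different
    corners: then both corners of one pair may compete with [U] and both of the other with [V], and
    the two inequalities contradict each other when combined. *)
Lemma optimal_nested U a b V c d : optimal U a b -> optimal V c d -> ~ crosses U V.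
Proof.
move=> oU oV cr.
have [[cU _ _] kU] := optimal_cheap oU; have [[cV _ _] kV] := optimal_cheap oV.
have chU := optimal_cheap oU.
have [h1 _] := crossing_submodular (F := box_sides) cr (crossing_finite cU) (crossing_finite cV).
have [h2 _] := crossing_submodular' (F := box_sides) cr (crossing_finite cU) (crossing_finite cV).
have [_ /(_ chU) h3] := crossing_submodular (F := cheap N) cr
  (cheap_crossing_finite cU) (cheap_crossing_finite cV).
have [_ /(_ chU) h4] := crossing_submodular' (F := cheap N) cr
  (cheap_crossing_finite cU) (cheap_crossing_finite cV).
have nU : clopen (~` U) by exact: clopenC.
have nV : clopen (~` V) by exact: clopenC.
have [[_ Ua nUb] _] := oU; have [[_ Vc nVd] _] := oV.
have UI : V a -> cost_le U (U `&` V).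
  by move=> Va; apply: (optimal_half oU); [exact: clopenI|left; split=> // -[]].
have UO : ~ V b -> cost_le U (~` U `&` ~` V).
  by move=> Va; apply: (optimal_half oU); [exact: clopenI|right; split=> // -[]].
have UJ : ~ V a -> cost_le U (U `&` ~` V).
  by move=> Va; apply: (optimal_half oU); [exact: clopenI|left; split=> // -[]].
have UK : V b -> cost_le U (~` U `&` V).
  by move=> Va; apply: (optimal_half oU); [exact: clopenI|right; split=> // -[]].
have VI : U c -> cost_le V (U `&` V).
  by move=> Va; apply: (optimal_half oV); [exact: clopenI|left; split=> // -[]].
have VK : ~ U c -> cost_le V (~` U `&` V).
  by move=> Va; apply: (optimal_half oV); [exact: clopenI|left; split=> // -[]].
have VJ : U d -> cost_le V (U `&` ~` V).
  by move=> Va; apply: (optimal_half oV); [exact: clopenI|right; split=> // -[]].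
have VO : ~ U d -> cost_le V (~` U `&` ~` V).
  by move=> Va; apply: (optimal_half oV); [exact: clopenI|right; split=> // -[]].
move: h1 h2 h3 h4 UI UO UJ UK VI VK VJ VO.
rewrite /cost_le -!/(cost _ _).
move: (cost box_sides (U `&` V)) (cost (cheap N) (U `&` V)) => i1 i2.
move: (cost box_sides (~` U `&` ~` V)) (cost (cheap N) (~` U `&` ~` V)) => o1 o2.
move: (cost box_sides (U `&` ~` V)) (cost (cheap N) (U `&` ~` V)) => j1 j2.
move: (cost box_sides (~` U `&` V)) (cost (cheap N) (~` U `&` V)) => k1 k2.
move: (cost box_sides U) (cost (cheap N) U) (cost box_sides V) (cost (cheap N) V) => u1 u2 v1 v2.
move=> h1 h2 h3 h4 UI UO UJ UK VI VK VJ VO.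
have [Va|Va] := pselect (V a); have [Vb|Vb] := pselect (V b);
  have [Uc|Uc] := pselect (U c); have [Ud|Ud] := pselect (U d);
  repeat match goal with
  | H : ?P -> _, H' : ?P |- _ => specialize (H H')
  | H : ?P -> _, H' : ~ ?P |- _ => clear H
  | H : (~ ?P) -> _, H' : ?P |- _ => clear H
  end; lia.
Qed.

Lemma optimal_act g U : optimal_family U -> optimal_family (tr g U).
Proof.
move=> [a [b [sU oU]]]; exists (A g a), (A g b).
have str k W x y : separates W x y -> separates (tr k W) (A k x) (A k y).
  by move=> [cW Wx nWy]; split; [exact: (ca_clopen ca)|exact/translateP|by move=> /(translateP A1 AM)].
split; first exact: str.
move=> V sV; have cV : clopen V by case: sV.
have /oU : separates (tr g^-1%g V) a b.
  have := str g^-1%g _ _ _ sV; by rewrite -!AM !mulVg !A1.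
have cU : clopen U by case: sU.
have c2 k W : clopen W -> cost (cheap N) (tr k W) = cost (cheap N) W.
  move=> cW; apply: cost_tr; first by move=> h X; exact: cheap_tr.
    exact: cheap_crossing_finite.
  by apply: cheap_crossing_finite; exact: (ca_clopen ca).
by rewrite /cost_le !cost_box_sides_tr// !c2.
Qed.

Local Notation EE := optimal_family.

Lemma optimal_clopen U : EE U -> clopen U.
Proof. by move=> [a [b [[]]]]. Qed.

Lemma optimal_translates : exists s, [/\ finite_set s, (forall U, s U -> clopen U),
  EE `<=` translates s & forall U, EE U -> exists g V, [/\ s V, EE V & U = tr g V]].
Proof.
have [s [fs sc hs]] := cheap_cofinite N; exists s; split=> //.
- by move=> U /sc[[]].
- by move=> U [a [b /optimal_cheap/hs]].
- move=> U EU; have [a [b /optimal_cheap/hs[g [V [sV e]]]]] := EU.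
  exists g, V; split=> //; rewrite (_ : V = tr g^-1%g U); first exact: optimal_act.
  by rewrite e translateK.
Qed.

Lemma optimal_nested_family : nested_family EE.
Proof.
split.
- by move=> U [a [b [[_ Ua _] _]]]; exists a.
- by move=> U [a [b /optimalC oU]]; exists b, a.
- move=> U V [a [b oU]] [c [d oV]].
  by have [//|/(optimal_nested oU oV)] := crossesP U V.
- move=> U V EU EV; have [s [fs cs Es _]] := optimal_translates.
  have [a [b [[cU Ua _] _]]] := EU; have [c [d [[cV _ nVd] _]]] := EV.
  have := conv_between fs cs cU cV; move=> /(_ (ex_intro _ a Ua) (ex_intro _ d nVd)).
  by apply: sub_finite_set => W [/Es].
Qed.

Lemma optimal_finite_separation P R : clopen P -> clopen R -> P `<=` ~` R ->
  exists S, [/\ finite_set S, S `<=` EE &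
    forall p r, P p -> R r -> exists2 U, S U & U p /\ ~ U r].
Proof.
move=> cP cR PR.
have cPR : compact (P `*` R).
  by apply: compact_setX; apply: subclosed_compact (ca_compact ca) _ => //;
    [case: cP|case: cR].
suff [S [fS SE hS]] : exists S, [/\ finite_set S, S `<=` EE &
    forall t, (P `*` R) t -> exists2 U, S U & U t.1 /\ ~ U t.2].
  by exists S; split=> // p r Pp Rr; exact: (hS (p, r)).
apply: (@compact_ind _ (fun K => exists S, [/\ finite_set S, S `<=` EE &
    forall t, K t -> exists2 U, S U & U t.1 /\ ~ U t.2]) (P `*` R)) => //.
- by exists set0; split=> //; exact: finite_set0.
- move=> K K' [S [fS SE hS]] [S' [fS' SE' hS']]; exists (S `|` S'); split.
  + by rewrite finite_setU.
  + by move=> U [/SE|/SE'].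
  + move=> t [/hS[U SU h]|/hS'[U SU h]]; exists U => //; [by left|by right].
- by move=> K K' KK' [S [fS SE hS]]; exists S; split=> // t /KK'/hS.
- move=> [p r] [/= Pp Rr].
  have pr : p <> r by move=> e; apply: (PR p Pp); rewrite e.
  have [U oU] := optimal_exists pr; have [[cU Up nUr] _] := oU.
  exists (U `*` ~` U); last first.
    exists [set U]; split; [exact: finite_set1|by move=> _ ->; exists p, r|].
    by move=> t [Ut nUt]; exists U.
  split; last by split.
  by apply: open_setX; [case: cU|case: (clopenC setT cU)].
Qed.

(** By compactness finitely many optimal sets separate the first from the third side of every box.
    The translate given by [conical] contains [b], misses [x] and is constant off [D], so it lies in
    [D]. *)
Lemma optimal_basis D b x : clopen D -> D b -> ~ D x ->
  exists W, [/\ EE W, W b & W `<=` D].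
Proof.
move=> cD Db nDx.
have [S [fS SE hS]] : exists S, [/\ finite_set S, S `<=` EE &
    forall P Q R, bx (P, Q, R) -> forall p r, P p -> R r -> exists2 U, S U & U p /\ ~ U r].
  have /finite_seqP[l bl] := ca_finite ca.
  have : [set` l] `<=` bx by rewrite bl.
  suff : [set` l] `<=` bx -> exists S, [/\ finite_set S, S `<=` EE &
    forall P Q R, (P, Q, R) \in l -> forall p r, P p -> R r -> exists2 U, S U & U p /\ ~ U r].
    by move=> h /h[S [fS SE hS]]; exists S; split=> // P Q R; rewrite bl; exact: hS.
  elim: (l) => [|[[P Q] R] l' IH] lb; first by exists set0; split=> //; exact: finite_set0.
  have [|S [fS SE hS]] := IH; first by move=> t tl; apply: lb; rewrite /= inE tl orbT.
  have [|[cP cQ cR] [_ PR _]] := @ca_box _ ca P Q R; first by apply: lb; rewrite /= inE eqxx.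
  have [S' [fS' SE' hS']] := optimal_finite_separation cP cR PR.
  exists (S `|` S'); split.
  + by rewrite finite_setU.
  + by move=> U [/SE|/SE'].
  + move=> P' Q' R'; rewrite inE => /orP[/eqP[-> _ ->]|h] p r Pp Rr.
      by have [U SU hU] := hS' p r Pp Rr; exists U => //; right.
    by have [U SU hU] := hS _ _ _ h p r Pp Rr; exists U => //; left.
have [P [Q [R [g [bPQR Pb PD Rx hg]]]]] := conical cD Db nDx fS (fun U SU => optimal_clopen (SE U SU)).
have [U SU [Ub nUx]] := hS _ _ _ bPQR _ _ Pb Rx.
exists (tr g U); split=> //; first by apply: optimal_act; exact: SE.
have [h|h] := hg U SU; first by case: nUx; exact: (h x nDx).
by move=> y Uy; apply: contrapT => /h.
Qed.

(** Equivalently, the complements of the members of a block are pairwise disjoint: they are the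
    branches at a vertex of the dual tree. *)
Lemma same_end_subset U V V' : EE U -> block EE U V -> block EE U V' -> V <> V' ->
  ~` V `<=` V'.
Proof.
move=> EU [EV UV] [EV' UV'] ne; have hE := optimal_nested_family.
have [//|[[]//]] := same_end_trans hE EV EU EV' (same_end_sym hE UV) UV'.
Qed.

(** The branches at a vertex of infinite valence would accumulate at some [b]. An optimal set [W]
    close to [b] is met by infinitely many branches; nested with them, it can lie strictly between
    two sets of the block only by filling a branch, and it crosses finitely many members of the
    family. *)
Lemma optimal_block_finite U : EE U -> finite_set (block EE U).
Proof.
move=> EU; apply: contrapT => inf; have hE := optimal_nested_family.
have [s [fs cs Es _]] := optimal_translates.
have [b hb] : exists b, forall D, clopen D -> D b ->
    infinite_set [set V | block EE U V /\ ~` V `&` D !=set0].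
  apply: contrapT => no; apply: inf.
  suff h : finite_set [set V | block EE U V /\ ~` V `&` [set: B] !=set0].
    apply: sub_finite_set h => V bV; split=> //; rewrite setIT.
    by apply: (nest_neq0 hE); apply: (nestC hE); case: bV.
  apply: (@compact_ind B (fun S => finite_set [set V | block EE U V /\ ~` V `&` S !=set0]));
    last exact: (ca_compact ca).
  - by apply: (@sub_finite_set _ _ set0) => [V [_ [x []]]|]; first by [].
  - move=> S S' f f'; have := conj f f'; rewrite -finite_setU; apply: sub_finite_set.
    by move=> V [bV [x [nVx [Sx|Sx]]]]; [left|right]; split=> //; exists x.
  - move=> S S' SS'; apply: sub_finite_set => V [bV [x [nVx Sx]]].
    by split=> //; exists x; split=> //; exact: SS'.
  - move=> b _; apply: contrapT => nb; apply: no; exists b => D cD Db fD; apply: nb.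
    by exists D => //; split=> //; case: cD.
have fb : finite_set [set V | block EE U V /\ ~ V b].
  have [[V0 [bV0 nV0b]]|no] := pselect (exists V, block EE U V /\ ~ V b); last first.
    by apply: (@sub_finite_set _ _ set0) => // V h; case: no; exists V.
  apply: (@sub_finite_set _ _ [set V0]); last exact: finite_set1.
  move=> V [bV nVb]; apply: contrapT => ne; apply: nVb.
  exact: (same_end_subset EU bV0 bV (nesym ne)).
have pick2 (X : set (set B)) : finite_set X -> exists V, block EE U V /\ ~ X V.
  move=> fX; apply: contrapT => no; apply: inf; apply: sub_finite_set fX => V bV.
  by apply: contrapT => nX; apply: no; exists V.
(* Two members of the block are taken so that [W], chosen inside their intersection, cannot equal
   [V1]. *)
have [V1 [bV1 nX1]] := pick2 _ fb.
have [|V2 [bV2 nX2]] := pick2 (V1 |` [set V | block EE U V /\ ~ V b]).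
  by rewrite finite_setU; split=> //; exact: finite_set1.
have V1b : V1 b by apply: contrapT => h; apply: nX1.
have V2b : V2 b by apply: contrapT => h; apply: nX2; right.
have V12 : V1 <> V2 by move=> e; apply: nX2; left.
have [EV1 _] := bV1; have [EV2 _] := bV2.
have [y nV1y] := nest_neq0 hE (nestC hE EV1).
have nV12 : ~ V1 `<=` V2.
  move=> h; have [z nV2z] := nest_neq0 hE (nestC hE EV2).
  apply: nV2z; have [/h//|nV1z] := pselect (V1 z).
  exact: (same_end_subset EU bV1 bV2 V12).
have [|W [EW Wb WV]] := @optimal_basis (V1 `&` V2) b y
    (clopenI (optimal_clopen EV1) (optimal_clopen EV2)) (conj V1b V2b).
  by case.
apply: (hb W (optimal_clopen EW) Wb).
have fc : finite_set (crossing (translates s) W) by apply: conv_crosses => //; exact: optimal_clopen.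
apply: (@sub_finite_set _ _ (crossing (translates s) W `|` [set V1; ~` W] `|`
    [set V | block EE U V /\ ~ V b])).
  move=> V [bV [x [nVx Wx]]]; have [EV _] := bV.
  have [[h|h|h|h]|cr] := crossesP V W.
  - left; right; left; apply: contrapT => ne.
    have [z nV1z] := nest_neq0 hE (nestC hE EV1).
    apply: nV1z; have [/h/WV[]//|nVz] := pselect (V z).
    exact: (same_end_subset EU bV bV1 ne).
  - by right; split=> // /h.
  - have [e|ne] := pselect (V = V1); first by left; right; left.
    have [//|[_ hn]] := same_end_trans hE EV EU EV1 (same_end_sym hE bV.2) bV1.2.
    have [|->|e] := hn W EW h; first by move=> z /WV[].
      by left; right; right; rewrite setCK.
    by case: nV12; rewrite -e => z /WV[].
  - by case: nVx; exact: h.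
  - by left; left; split=> //; exact: Es.
rewrite !finite_setU; split=> //; split=> //; exact: finite_set2.
Qed.

End Optimal.

(** Precompactness of the orbits of pairs in combinatorial form: finite unions of products of a
    clopen set with its complement exhaust the space of distinct pairs. *)
Definition bounded_on_pairs (H : {pred G}) := forall a b, a <> b ->
  exists S, [/\ finite_set S, (forall U, S U -> clopen U) &
    forall h, h \in H -> exists2 U, S U & U (A h a) /\ ~ U (A h b)].

Lemma convergence_bass_serre :
  exists (Gam : graph_of_groups) (F : set (edge Gam)),
    [/\ finite_graph Gam, is_tree (spanning_subgraph F),
        finite_index_injections Gam &
        exists2 phi : {multiplicative G -> pi1 F}, bijective phi &
          forall H : {pred G}, group_closed H ->
            (exists x : vertex (bass_serre_tree F),
               forall h, h \in H -> bass_serre_act (phi h) x = x) <->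
            bounded_on_pairs H].
Proof.
have [N hN] := cheap_separates.
have hE := optimal_nested_family hN.
have [s [fs cs Es hs]] := optimal_translates hN.
have [b _] := ca_ne ca.
have [b' _ bb'] := ca_perfect ca clopenT (I : [set: B] b).
have [U0 oU0] := optimal_exists hN bb'.
have E0 : optimal_family N !=set0 by exists U0, b', b.
have [Gam [F [h1 h2 h3 [phi bphi hphi]]]] := nested_bass_serre A1 AM hE
  (@optimal_act N) (optimal_block_finite hN) E0 fs hs.
exists Gam, F; split=> //; exists phi => // H hH; rewrite hphi//; split=> [fin x y xy|bd U EU].
  have [U oU] := optimal_exists hN xy; have [[cU Ux nUy] _] := oU.
  exists (orbit_of A H U); split; first by apply: fin; exists x, y.
    by move=> _ [h _ <-]; exact: (ca_clopen ca).
  move=> h hh; exists (tr h U); first by exists h.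
  by split; [exact/translateP|by move=> /(translateP A1 AM)].
have cU := optimal_clopen EU.
have [x Ux] := nest_neq0 hE EU; have [z nUz] := nest_neq0 hE (nestC hE EU).
(* With two points inside [U] and two outside, the hypothesis supplies finitely many clopen sets
   that split the images of both pairs; these serve as test sets for [ca_conv]. *)
have [y Uy yx] := ca_perfect ca cU Ux.
have [w nUw wz] := ca_perfect ca (clopenC setT cU) nUz.
have [S [fS cS hS]] := bd _ _ (nesym yx).
have [S' [fS' cS' hS']] := bd _ _ (nesym wz).
apply: (@sub_finite_set _ _ (\bigcup_(P in S `*` S') [set V | exists g, [/\ V = tr g U,
      (exists x y, [/\ V x, V y, P.1 x & ~ P.1 y]) &
      (exists x y, [/\ ~ V x, ~ V y, P.2 x & ~ P.2 y])]])).
  move=> _ [h hh <-]; have [X SX [Xx nXy]] := hS h hh; have [X' SX' [Xz nXw]] := hS' h hh.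
  exists (X, X') => //; exists h; split=> //.
    by exists (A h x), (A h y); split=> //; exact/translateP.
  by exists (A h z), (A h w); split=> // /(translateP A1 AM).
apply: bigcup_finite; first exact: finite_setX.
by move=> [X X'] [/= SX SX']; apply: (ca_conv ca) => //; [exact: cS|exact: cS'].
Qed.

End Dynamics.

(** * The realization of a tree and its boundary *)

Import Order.TTheory GRing.Theory Num.Theory numFieldNormedType.Exports.
Local Open Scope ring_scope.

Section TreeRealization.
Variables (R : realType) (T : tree).
Let hT := treeP T.
Implicit Types (u v w : vertex T) (p q : realization R T).

Notation vp := (vertex_point R).
Notation td := (tdist hT).

Lemma tdist_dart (d : dart T) : td (origin d) (terminus d) = 1%N.
Proof. by rewrite /tdist (@geodP _ hT _ [:: d]). Qed.

Lemma mdist_le_string p q l : string p q l -> mdist p q <= l.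
Proof. by move=> s; apply: ge_inf => //; exact: (path_dist_inf p q).2. Qed.

Lemma mdist_vp_spans u v : spans u v -> mdist (vp u) (vp v) <= 1.
Proof.
move=> uv; have := string_cell uv (on_celll R u v) (on_cellr R u v).
move=> /mdist_le_string h; apply: le_trans h _.
rewrite /= !indicE; case: (_ \in _); case: (_ \in _);
  by rewrite ?subrr ?subr0 ?sub0r ?normrN ?normr0 ?normr1.
Qed.

Lemma mdist_vp_le u v : mdist (vp u) (vp v) <= (td u v)%:R.
Proof.
rewrite /tdist; move: (geod hT u v) (geod_walk hT u v) => s.
elim: s u => [|d s IH] u /=.
  by move=> ->; rewrite mdistxx.
move=> [<- /IH h]; apply: le_trans (metric_triangle _ (vp (terminus d)) _) _.
have : mdist (vp (origin d)) (vp (terminus d)) <= 1.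
  by apply: mdist_vp_spans; right; exists d.
by rewrite mulrS; lra.
Qed.

Section Affine.
Variable g : vertex T -> R.
Hypothesis g_lip : forall u v, spans u v -> `|g u - g v| <= 1.

(** The extension of [g] that is affine on cells. The list stands for any finite set of vertices
    containing the supports in play, which keeps the sum finite in an infinite tree. *)
Definition affine (l : seq {classic vertex T}) p := \sum_(w <- l) p w * g w.

Lemma sum_indic (l : seq {classic vertex T}) (u : {classic vertex T}) :
  uniq l -> u \in l ->
  \sum_(w <- l) (\1_[set u] w : R) * g w = g u.
Proof.
move=> ul uin; rewrite (bigD1_seq (u : {classic vertex T}))//= indicE mem_set// mul1r big1 ?addr0//.
by move=> w /eqP wu; rewrite indicE memNset ?mul0r.
Qed.

Lemma affine_cell (l : seq {classic vertex T}) p (u v : {classic vertex T}) (t : R) :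
  uniq l -> u \in l -> v \in l ->
  bary p = (fun w => (1 - t) * \1_[set u] w + t * \1_[set v] w) ->
  affine l p = (1 - t) * g u + t * g v.
Proof.
move=> ul uin vin pE; rewrite /affine pE.
under eq_bigr do rewrite mulrDl -!mulrA.
by rewrite big_split /= -!mulr_sumr !sum_indic.
Qed.

Lemma affine_string p q l : string p q l -> exists s0 : seq {classic vertex T},
  forall s, uniq s -> {subset s0 <= s} -> `|affine s p - affine s q| <= l.
Proof.
elim=> {p q l} [p|p q r u v l uv pu qu _ [s0 hs0]].
  by exists [::] => s _ _; rewrite subrr normr0.
exists (u :: v :: s0) => s us ss.
have us0 : u \in s by apply: ss; rewrite inE eqxx.
have vs0 : v \in s by apply: ss; rewrite !inE eqxx orbT.
have := hs0 s us; have ss' : {subset s0 <= s} by move=> x xs; apply: ss; rewrite !inE xs !orbT.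
move=> /(_ ss') h; apply: le_trans (ler_distD (affine s q) _ _) _.
rewrite lerD//; have [t t01 pE] := pu; have [t' t01' qE] := qu.
rewrite (affine_cell us us0 vs0 pE) (affine_cell us us0 vs0 qE).
have [<-|uv'] := pselect (u = v).
  by rewrite -!mulrDl !subrK subrr normr0.
have -> : (1 - t) * g u + t * g v - ((1 - t') * g u + t' * g v) =
   (t' - t) * (g u - g v) by lra.
have uu : u \in [set u] by exact: mem_set.
have nuv : (u \in [set v]) = false by exact: memNset.
rewrite pE qE /= !indicE uu nuv.
rewrite normrM; apply: le_trans (ler_wpM2l (normr_ge0 _) (g_lip uv)) _.
have -> : (1 - t) * true%:R + t * false%:R - ((1 - t') * true%:R + t' * false%:R) =
  t' - t :> R by rewrite mulr1n mulr0n; lra.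
by rewrite mulr1.
Qed.

Lemma affine_mdist u v : `|g u - g v| <= mdist (vp u) (vp v).
Proof.
apply: lb_le_inf; first exact: (path_dist_inf (vp u) (vp v)).1.
move=> l /affine_string[s0 hs].
pose s : seq {classic vertex T} := undup ((u : {classic vertex T}) :: (v : {classic vertex T}) :: s0).
have us : uniq s by exact: undup_uniq.
have := hs s us.
rewrite /affine (sum_indic us) ?(sum_indic us) ?mem_undup ?inE ?eqxx ?orbT//; apply.
by move=> x xs; rewrite mem_undup !inE xs !orbT.
Qed.
End Affine.

(** For the lower bound, the distance to [v] is 1-Lipschitz on vertices, and by [affine_mdist] such
    a function bounds the path metric from below. *)
Lemma mdist_vp u v : mdist (vp u) (vp v) = (td u v)%:R.
Proof.
apply/eqP; rewrite eq_le mdist_vp_le /=.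
have := @affine_mdist (fun w => (td w v)%:R) _ u v.
rewrite tdistxx subr0 ger0_norm ?ler0n//; apply.
move=> x y [->|[d [<- <-]]]; first by rewrite subrr normr0 ler01.
have h1 := tdist_triangle hT (terminus d) (origin d) v.
have h2 := tdist_triangle hT (origin d) (terminus d) v.
rewrite (tdistC hT (terminus d) (origin d)) tdist_dart in h2; rewrite tdist_dart in h1.
move: h1 h2; rewrite -!(ler_nat R) !natrD ler_norml => h1 h2.
by apply/andP; split; lra.
Qed.

(** An end of some cell containing [p], not necessarily the nearest vertex. It is at distance at
    most 1, the source of the additive constants below. *)
Definition near_vertex p : vertex T := projT1 (cid (baryP p)).

Lemma mdist_near_vertex p : mdist p (vp (near_vertex p)) <= 1.
Proof.
rewrite /near_vertex; case: cid => u [v [uv pu]] /=.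
have := string_cell uv pu (on_celll R u v) => /mdist_le_string h; apply: le_trans h _.
have [t /andP[t0 t1] pE] := pu; rewrite pE /= !indicE mem_set//.
case: (_ \in _); rewrite ler_norml ?mulr1n ?mulr0n; apply/andP; split; lra.
Qed.

Lemma near_vertex_dist p q :
  `|mdist p q - (td (near_vertex p) (near_vertex q))%:R| <= 2.
Proof.
rewrite -mdist_vp; set a := vp _; set b := vp _.
have h1 := mdist_near_vertex p; have h2 := mdist_near_vertex q; rewrite -/a -/b in h1 h2.
have := metric_triangle p a q; have := metric_triangle a b q.
have := metric_triangle a p b; have := metric_triangle p q b.
rewrite (metric_sym a p) (metric_sym b q) ler_norml => k1 k2 k3 k4.
by apply/andP; split; lra.
Qed.

Lemma near_vertex_dist1 o p :
  `|mdist p (vp o) - (td o (near_vertex p))%:R| <= 1.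
Proof.
rewrite -mdist_vp; set a := vp (near_vertex p).
have h1 := mdist_near_vertex p; rewrite -/a in h1.
have := metric_triangle p a (vp o); have := metric_triangle (vp o) p a.
rewrite (metric_sym a) (metric_sym (vp o) p) ler_norml => k1 k2.
by apply/andP; split; lra.
Qed.

Lemma gromov_product_near o p q :
  `|gromov_product (vp o) p q - (tgp hT o (near_vertex p) (near_vertex q))%:R| <= 2.
Proof.
rewrite /gromov_product.
have := near_vertex_dist p q; have := near_vertex_dist1 o p; have := near_vertex_dist1 o q.
have e : (td (near_vertex p) (near_vertex q))%:R + 2 * (tgp hT o (near_vertex p) (near_vertex q))%:R =
  (td o (near_vertex p))%:R + (td o (near_vertex q))%:R :> R.
  by rewrite -natrM -!natrD tdist_gp.
rewrite !ler_norml => /andP[? ?] /andP[? ?] /andP[? ?].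
by apply/andP; split; lra.
Qed.

Lemma gromov_product_base (X : metricType R) (o o' x y : X) :
  `|gromov_product o x y - gromov_product o' x y| <= mdist o o'.
Proof.
rewrite /gromov_product.
have := metric_triangle x o o'; have := metric_triangle y o o'.
have := metric_triangle x o' o; have := metric_triangle y o' o.
rewrite (metric_sym o' o) ler_norml => ? ? ? ?.
by apply/andP; split; lra.
Qed.

End TreeRealization.

(** * Boundary points as rays *)

Section TreeBoundary.
Variables (R : realType) (T : tree) (o : vertex T).
Let hT := treeP T.
Notation vp := (vertex_point R).
Notation td := (tdist hT).
Notation gp := (tgp hT o).
Notation X := (realization R T).
Notation nu := (@near_vertex R T).
Implicit Types (s t : nat -> X) (a b c : boundary X) (u v : vertex T).

Lemma bound_nat (x : R) : exists n : nat, x <= n%:R.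
Proof.
exists (Num.bound `|x|); by have /ltW := Num.Theory.archi_boundP (normr_ge0 x); apply: le_trans; exact: ler_norm.
Qed.

Lemma asymptoticP s t : asymptotic s t <->
  forall n, exists N, forall i j, (N <= i)%N -> (N <= j)%N -> (n <= gp (nu (s i)) (nu (t j)))%N.
Proof.
split=> h.
  move=> n; have [N hN] := h (vp o) (n%:R + 2); exists N => i j Ni Nj.
  have := hN i j Ni Nj; have := gromov_product_near o (s i) (t j).
  by rewrite ler_norml -(ler_nat R) => /andP[? ?] ?; lra.
move=> o' M; have [n hn] := bound_nat (M + 2 + mdist o' (vp o)).
have [N hN] := h n; exists N => i j Ni Nj.
have := hN i j Ni Nj; have := gromov_product_near o (s i) (t j).
have := gromov_product_base o' (vp o) (s i) (t j).
by rewrite !ler_norml -(ler_nat R) => /andP[? ?] /andP[? ?] ?; lra.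
Qed.

Lemma asymptotic_sym s t : asymptotic s t -> asymptotic t s.
Proof.
move/asymptoticP => h; apply/asymptoticP => n; have [N hN] := h n.
by exists N => i j Ni Nj; rewrite tgpC; exact: hN.
Qed.

Lemma asymptotic_trans t s s' : asymptotic s t -> asymptotic t s' -> asymptotic s s'.
Proof.
move=> /asymptoticP h /asymptoticP h'; apply/asymptoticP => n.
have [N hN] := h n; have [N' hN'] := h' n.
exists (maxn N N') => i j; rewrite !geq_max => /andP[Ni N'i] /andP[Nj N'j].
have := tgp_ultra hT o (nu (s i)) (nu (t (maxn N N'))) (nu (s' j)).
have := hN i (maxn N N') Ni (leq_maxl _ _); have := hN' (maxn N N') j (leq_maxr _ _) N'j.
by move=> ? ? /(leq_trans _); apply; rewrite leq_min; apply/andP.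
Qed.

Lemma boundaryE a : exists2 r, asymptotic r r &
  forall s, tends_to s a <-> asymptotic s s /\ asymptotic r s.
Proof. by have [r rr e] := boundaryP a; exists r => // s; rewrite /tends_to e. Qed.

Lemma tends_toP s a : tends_to s a -> asymptotic s s.
Proof. by have [r _ ->] := boundaryE a => -[]. Qed.

Lemma tends_to_asymptotic s t a : tends_to s a -> tends_to t a -> asymptotic s t.
Proof.
have [r rr e] := boundaryE a; rewrite !e => -[_ rs] [_ rt].
exact: asymptotic_trans (asymptotic_sym rs) rt.
Qed.

Lemma asymptotic_tends_to s t a : tends_to s a -> asymptotic s t -> tends_to t a.
Proof.
have [r rr e] := boundaryE a; rewrite !e => -[ss rs] st; split; last exact: asymptotic_trans st.
exact: asymptotic_trans (asymptotic_sym st) st.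
Qed.

Lemma tends_to_exists a : exists s, tends_to s a.
Proof. by have [r rr e] := boundaryE a; exists r; rewrite e. Qed.

Lemma boundary_class_inj a b : boundary_class a = boundary_class b -> a = b.
Proof.
case: a b => [C PC] [D PD] /= e; case: _ / e PD => PD.
by congr Boundary; exact: Prop_irrelevance.
Qed.

Lemma tends_to_unique s t a b : tends_to s a -> tends_to t b -> asymptotic s t -> a = b.
Proof.
move=> sa tb st; apply/boundary_class_inj/seteqP; split=> r h.
  exact/(asymptotic_tends_to tb)/(asymptotic_trans (asymptotic_sym st))/(tends_to_asymptotic sa).
exact/(asymptotic_tends_to sa)/(asymptotic_trans st)/(tends_to_asymptotic tb).
Qed.

Lemma boundary_of s : asymptotic s s -> exists a, tends_to s a.
Proof.
move=> ss; have h : exists2 r, asymptotic r r &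
    [set t | asymptotic t t /\ asymptotic s t] = [set t | asymptotic t t /\ asymptotic r t].
  by exists s.
by exists (Boundary h).
Qed.

Lemma prefix_exists a n : exists w, forall s, tends_to s a ->
  exists N, forall i, (N <= i)%N -> size w = n /\ take n (geod hT o (nu (s i))) = w.
Proof.
have [s sa] := tends_to_exists a.
have /asymptoticP/(_ n)[N hN] := tends_toP sa.
exists (take n (geod hT o (nu (s N)))) => t ta.
have /asymptoticP/(_ n)[N' hN'] := tends_to_asymptotic sa ta.
exists N' => i N'i.
have /lcp_leq[h _] := hN N N (leqnn _) (leqnn _).
split; first by rewrite size_takel.
have /lcp_leq[_ e] := hN' (maxn N N') i (leq_maxr _ _) N'i.
have /lcp_leq[_ e'] := hN (maxn N N') N (leq_maxl _ _) (leqnn _).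
by rewrite -e -e'.
Qed.

(** The first [n] darts of the ray from [o] to [a]: every sequence tending to [a] eventually has
    geodesics from [o] that start with them. *)
Definition prefix_at a n : seq (dart T) := projT1 (cid (prefix_exists a n)).
Notation pre := prefix_at.

Lemma prefix_atP a n s : tends_to s a -> exists N, forall i, (N <= i)%N ->
  take n (geod hT o (nu (s i))) = pre a n.
Proof.
by rewrite /pre; case: cid => w hw /hw[N hN]; exists N => i /hN[].
Qed.

Lemma size_prefix_at a n : size (pre a n) = n.
Proof.
rewrite /pre; case: cid => w /= hw; have [s /hw[N /(_ N (leqnn _))[]]] := tends_to_exists a.
by [].
Qed.

Lemma take_prefix_at a m n : (m <= n)%N -> take m (pre a n) = pre a m.
Proof.
move=> mn; have [s sa] := tends_to_exists a.
have [N hN] := prefix_atP n sa; have [N' hN'] := prefix_atP m sa.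
rewrite -(hN (maxn N N') (leq_maxl _ _)) -(hN' (maxn N N') (leq_maxr _ _)).
by rewrite take_takel.
Qed.

Lemma prefix_at_leq a b m n : (m <= n)%N -> pre a n = pre b n -> pre a m = pre b m.
Proof. by move=> mn e; rewrite -(take_prefix_at a mn) e take_prefix_at. Qed.

Lemma prefix_at_tgp a b n s t : tends_to s a -> tends_to t b -> pre a n = pre b n ->
  exists N, forall i j, (N <= i)%N -> (N <= j)%N -> (n <= gp (nu (s i)) (nu (t j)))%N.
Proof.
move=> sa tb e; have [N hN] := prefix_atP n sa; have [N' hN'] := prefix_atP n tb.
exists (maxn N N') => i j; rewrite !geq_max => /andP[Ni N'i] /andP[Nj N'j].
apply/lcp_leq; rewrite hN// hN'//; split=> //.
have := size_prefix_at a n; rewrite -(hN i)// size_take; case: ltnP => //.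
  by move/ltnW.
by move=> _ ->.
Qed.

Lemma tgp_prefix_at a b n s t : tends_to s a -> tends_to t b ->
  (forall N, exists i j, [/\ (N <= i)%N, (N <= j)%N & (n <= gp (nu (s i)) (nu (t j)))%N]) ->
  pre a n = pre b n.
Proof.
move=> sa tb h; have [N hN] := prefix_atP n sa; have [N' hN'] := prefix_atP n tb.
have [i [j [Ni Nj /lcp_leq[_]]]] := h (maxn N N').
by rewrite hN ?hN'//; move: Ni Nj; rewrite !geq_max => /andP[? ?] /andP[? ?].
Qed.

Lemma prefix_at_inj a b : (forall n, pre a n = pre b n) -> a = b.
Proof.
move=> e; have [s sa] := tends_to_exists a; have [t tb] := tends_to_exists b.
apply: (tends_to_unique sa tb); apply/asymptoticP => n.
exact: (prefix_at_tgp sa tb (e n)).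
Qed.

Lemma prefix_at_vertex a n : exists2 v, walk o (pre a n) v & reduced (pre a n).
Proof.
have [s sa] := tends_to_exists a; have [N hN] := prefix_atP n sa.
rewrite -(hN N)// -geod_geod_vertex; exists (geod_vertex hT o (nu (s N)) n).
  exact: geod_walk.
exact: geod_reduced.
Qed.

Lemma tdist_near_vp v : (td v (nu (vp v)) <= 1)%N.
Proof.
have := mdist_near_vertex (vp v); rewrite mdist_vp.
by rewrite -[X in _ <= X](mulr1n 1) ler_nat.
Qed.

Lemma tgp_near_vp v : (td o v <= (gp v (nu (vp v))).+1)%N.
Proof.
have := tdist_gp hT o v (nu (vp v)); have := tdist_near_vp v.
by have := tdist_triangle hT (nu (vp v)) o v; rewrite (tdistC hT (nu (vp v)) v); lia.
Qed.

Definition prefix_vertex a n : vertex T := last o [seq terminus d | d <- pre a n].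
Notation pv := prefix_vertex.

Lemma geod_prefix_vertex a n : geod hT o (pv a n) = pre a n.
Proof.
have [v w r] := prefix_at_vertex a n; apply: geodP => //.
by rewrite /pv (walk_last w).
Qed.

Lemma tdist_prefix_vertex a n : td o (pv a n) = n.
Proof. by rewrite /tdist geod_prefix_vertex size_prefix_at. Qed.

Section Ray.
Variable w : nat -> seq (dart T).
Hypotheses (w_size : forall n, size (w n) = n)
  (w_take : forall m n, (m <= n)%N -> take m (w n) = w m)
  (w_walk : forall n, exists2 v, walk o (w n) v & reduced (w n)).

Let rv n := last o [seq terminus d | d <- w n].

Lemma geod_ray n : geod hT o (rv n) = w n.
Proof. by have [v h r] := w_walk n; apply: geodP => //; rewrite /rv (walk_last h). Qed.

Lemma ray_boundary : exists a, (forall n, pre a n = w n) /\ tends_to (fun n => vp (rv n)) a.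
Proof.
(* The inequalities are strict because [near_vertex] of a vertex point may be a neighbour of that
   vertex. *)
have key m n k : (k < m)%N -> (k < n)%N -> (k <= gp (nu (vp (rv m))) (nu (vp (rv n))))%N.
  move=> km kn.
  have h1 := tgp_near_vp (rv m); have h2 := tgp_near_vp (rv n).
  rewrite /tdist !geod_ray !w_size in h1 h2.
  have h3 : (k <= gp (rv m) (rv n))%N.
    apply/lcp_leq; rewrite !geod_ray w_size; split; first exact: ltnW.
    by rewrite !w_take// ltnW.
  have := tgp_ultra hT o (nu (vp (rv m))) (rv m) (rv n).
  have := tgp_ultra hT o (nu (vp (rv m))) (rv n) (nu (vp (rv n))).
  rewrite (tgpC hT o _ (rv m)); lia.
have ss : asymptotic (fun n => vp (rv n)) (fun n => vp (rv n)).
  by apply/asymptoticP => n; exists n.+1 => i j Ni Nj; exact: key.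
have [a sa] := boundary_of ss; exists a; split=> // n.
have [N hN] := prefix_atP n sa; pose m := maxn N n.+1.
rewrite -(hN m (leq_maxl _ _)).
have nm : (n < m)%N by rewrite leq_maxr.
have : (n <= gp (rv m) (nu (vp (rv m))))%N.
  by have := tgp_near_vp (rv m); rewrite /tdist geod_ray w_size; lia.
by move=> /lcp_leq[_ <-]; rewrite geod_ray w_take// ltnW.
Qed.
End Ray.

Lemma tends_to_prefix_vertex a : tends_to (fun n => vp (pv a n)) a.
Proof.
have [||b [hb tb]] := @ray_boundary (pre a) (size_prefix_at a).
- by move=> m n; exact: take_prefix_at.
- exact: prefix_at_vertex.
by have e := prefix_at_inj hb; rewrite e in tb.
Qed.

(** Gromov products and lengths of common prefixes differ by at most 2, and a change of base point
    costs a constant; so rays with a common prefix form a basis of the topology. *)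
Lemma boundary_openP (U : set (boundary X)) : open U <->
  forall a, U a -> exists n, forall b, pre b n = pre a n -> U b.
Proof.
rewrite -[open U]/(boundary_open U); split=> [oU a Ua|h o' a Ua].
  have [r hr] := oU (vp o) a Ua; have [n hn] := bound_nat (r + 2).
  exists n => b /esym e; apply: hr.
  have [s sa] := tends_to_exists a; have [t tb] := tends_to_exists b.
  exists s, t; split=> //; have [N hN] := prefix_at_tgp sa tb e.
  exists N => i j Ni Nj; have := hN i j Ni Nj.
  have := gromov_product_near o (s i) (t j).
  by rewrite ler_norml -(ler_nat R) => /andP[? ?] ?; lra.
have [n hn] := h a Ua; exists (n%:R + 2 + mdist o' (vp o)) => b [s [t [sa tb [N hN]]]].
apply/hn/esym; apply: (tgp_prefix_at sa tb) => N'.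
exists (maxn N N'), (maxn N N'); split; [exact: leq_maxr|exact: leq_maxr|].
have := hN (maxn N N') (maxn N N') (leq_maxl _ _) (leq_maxl _ _).
have := gromov_product_base o' (vp o) (s (maxn N N')) (t (maxn N N')).
have := gromov_product_near o (s (maxn N N')) (t (maxn N N')).
by rewrite !ler_norml -(ler_nat R) => /andP[? ?] /andP[? ?] ?; lra.
Qed.

Definition saturated n (U : set (boundary X)) :=
  forall a b, pre a n = pre b n -> U a -> U b.

Lemma saturated_clopen n U : saturated n U -> clopen U.
Proof.
move=> sU; split; first by apply/boundary_openP => a Ua; exists n => b /esym e; exact: sU Ua.
rewrite -openC; apply/boundary_openP => a nUa; exists n => b e Ub.
by apply: nUa; exact: sU Ub.
Qed.

Lemma boundary_separation a b : a <> b -> exists U, [/\ clopen U, U a & ~ U b].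
Proof.
move=> ab; have [n hn] : exists n, pre a n <> pre b n.
  apply: contrapT => no; apply: ab; apply: prefix_at_inj => n; apply: contrapT => h.
  by apply: no; exists n.
exists [set c | pre c n = pre a n]; split=> //; last by move=> /esym.
by apply: (@saturated_clopen n) => c d /= <-.
Qed.

Hypothesis T_valence : bounded_valence T.

Lemma finite_darts v : finite_set [set d : dart T | origin d = v].
Proof. by have [n hn] := T_valence; apply/finite_set_leP; exists n. Qed.

Lemma ultra_finite (S : Type) (F : set_system S) (I : Type) (D : set I) (f : I -> set S) :
  UltraFilter F -> finite_set D -> F (\bigcup_(i in D) f i) -> exists2 i, D i & F (f i).
Proof.
move=> UF /(@finite_seqP {classic I})[l ->]; elim: l => [|i l IH].
  rewrite (_ : \bigcup_(_ in _) _ = set0); first by move/filter_ex => [].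
  by apply/seteqP; split=> // x [].
move=> h; have [Fi|Fi] := in_ultra_setVsetC (f i) UF.
  by exists i => //=; rewrite inE eqxx.
have [|j jl Fj] := IH; last by exists j => //=; move: jl => /=; rewrite inE => ->; rewrite orbT.
apply: filterS (filterI h Fi) => x [[j /= jl fj] nfi]; exists j => //=.
by move: jl; rewrite inE => /orP[/eqP e|//]; rewrite e in fj.
Qed.

(** König's lemma along an ultrafilter: finitely many darts continue a given prefix, so the
    ultrafilter selects one at each level, and the ray so obtained is its limit. *)
Lemma boundary_compact : compact [set: boundary X].
Proof.
rewrite compact_ultra => F UF _.
have step n w : F [set b | pre b n = w] -> exists d, F [set b | pre b n.+1 = rcons w d].
  move=> Fw; pose v := last o [seq terminus d | d <- w].
  have [|d _ Fd] := @ultra_finite _ F (dart T) [set d | origin d = v]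
     (fun d => [set b | pre b n.+1 = rcons w d]) UF (finite_darts v); last by exists d.
  apply: filterS Fw => b /= e.
  have [d ed] : exists d, pre b n.+1 = rcons w d.
    have := take_prefix_at b (leqnSn n); have := size_prefix_at b n.+1.
    case/lastP: (pre b n.+1) => [//|x d] sx; rewrite e -cats1 => h; exists d.
    rewrite -h take_size_cat ?cats1//.
    by move: sx; rewrite size_rcons => -[].
  exists d => //=; have [u] := prefix_at_vertex b n.+1.
  by rewrite ed => /walk_rcons[/walk_last h _] _; rewrite /= /v h.
have [w hw] : exists w : nat -> seq (dart T), forall n, F [set b | pre b n = w n].
  have f n w : {w' | F [set b | pre b n = w] -> F [set b | pre b n.+1 = w']}.
    apply: cid; have [h|h] := pselect (F [set b | pre b n = w]).
      by have [d hd] := step n w h; exists (rcons w d).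
    by exists [::].
  pose w := fix w n := if n is m.+1 then projT1 (f m (w m)) else [::].
  exists w; elim=> [|n IH] /=; last exact: (projT2 (f n (w n)) IH).
  rewrite (_ : [set _ | _] = setT); first exact: filterT.
  by apply/seteqP; split=> // b _ /=; apply/size0nil/size_prefix_at.
have wa n : exists b, pre b n = w n by have [b] := filter_ex (hw n); exists b.
have [|||a [pa _]] := @ray_boundary w.
- by move=> n; have [b <-] := wa n; exact: size_prefix_at.
- move=> m n mn; have [b [<- <-]] := filter_ex (filterI (hw m) (hw n)).
  exact: take_prefix_at.
- by move=> n; have [b <-] := wa n; exact: prefix_at_vertex.
exists a; split=> // U /nbhs_interior; rewrite nbhsE => -[V [oV Va] VU].
have [n hn] := (boundary_openP V).1 oV a Va.
apply: filterS (hw n) => b /= e; apply: interior_subset; apply/VU/hn.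
by rewrite e pa.
Qed.

Lemma clopen_saturated (U : set (boundary X)) : clopen U -> exists n, saturated n U.
Proof.
move=> [oU cU].
suff [n hn] : exists n, forall a b, [set: boundary X] a ->
    pre a n = pre b n -> U a -> U b by exists n => a b; exact: hn.
apply: (@compact_ind _ (fun K => exists n, forall a b, K a ->
  pre a n = pre b n -> U a -> U b)) boundary_compact.
- by exists 0%N.
- move=> K K' [n hn] [n' hn']; exists (maxn n n') => a b [Ka|K'a] e.
    by apply: hn => //; apply: prefix_at_leq e; exact: leq_maxl.
  by apply: hn' => //; apply: prefix_at_leq e; exact: leq_maxr.
- by move=> K K' KK' [n hn]; exists n => a b /KK'; exact: hn.
- move=> c _; have [Uc|nUc] := pselect (U c).
    have [n hn] := (boundary_openP U).1 oU c Uc.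
    exists [set b | pre b n = pre c n].
      split=> //; apply: proj1 (@saturated_clopen n _ _) => a b /= <- //.
    by exists n => a b /= e e' _; apply: hn; rewrite -e'.
  have onU : open (~` U) by rewrite openC.
  have [n hn] := (boundary_openP (~` U)).1 onU c nUc.
  exists [set b | pre b n = pre c n].
    split=> //; apply: proj1 (@saturated_clopen n _ _) => a b /= <- //.
  by exists n => a b /= e e' Ua; case: (hn a e).
Qed.

(* Length of the common part of the rays from [o] to [a] and [b]; the junk
   value is [0] when [a = b]. *)
Definition branching a b : nat :=
  if pselect (exists n, `[< pre a n.+1 <> pre b n.+1 >]) is left e then ex_minn e else 0%N.

Lemma branchingP a b n : a <> b -> pre a n = pre b n <-> (n <= branching a b)%N.
Proof.
move=> ab; rewrite /branching; case: pselect => [e|no]; last first.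
  case: ab; apply: prefix_at_inj => -[|k].
    by rewrite !(size0nil (size_prefix_at _ 0)).
  by apply: contrapT => h; apply: no; exists k; apply/asboolP.
case: ex_minnP => m /asboolP hm min; split=> [h|nm].
  by rewrite leqNgt; apply/negP => mn; apply: hm; exact: prefix_at_leq h.
case: n nm => [|n] nm; first by rewrite !(size0nil (size_prefix_at _ 0)).
apply: contrapT => h; have : (m <= n)%N by apply: min; apply/asboolP.
by rewrite leqNgt nm.
Qed.

Lemma branchingC a b : branching a b = branching b a.
Proof.
have [->//|ab] := pselect (a = b); apply/eqP; rewrite eqn_leq; apply/andP; split.
  exact: ((branchingP _ (nesym ab)).1 (esym ((branchingP _ ab).2 (leqnn _)))).
exact: ((branchingP _ ab).1 (esym ((branchingP _ (nesym ab)).2 (leqnn _)))).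
Qed.

Lemma branching_ultra a b c : a <> b -> b <> c -> a <> c ->
  (minn (branching a b) (branching b c) <= branching a c)%N.
Proof.
move=> ab bc ac; apply/(branchingP _ ac); rewrite ((branchingP _ ab).2 (geq_minl _ _)).
exact: ((branchingP _ bc).2 (geq_minr _ _)).
Qed.

Lemma branching_limit a b s t : a <> b -> tends_to s a -> tends_to t b ->
  exists N, forall i j, (N <= i)%N -> (N <= j)%N ->
    gp (nu (s i)) (nu (t j)) = branching a b.
Proof.
move=> ab sa tb.
have [N hN] := prefix_at_tgp sa tb ((branchingP _ ab).2 (leqnn _)).
have [N1 hN1] := prefix_atP (branching a b).+1 sa.
have [N2 hN2] := prefix_atP (branching a b).+1 tb.
exists (maxn N (maxn N1 N2)) => i j; rewrite !geq_max => /and3P[? ? ?] /and3P[? ? ?].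
apply/eqP; rewrite eqn_leq hN// andbT leqNgt; apply/negP => /lcp_leq[_].
by rewrite hN1// hN2// => /branchingP => /(_ ab); rewrite ltnn.
Qed.

End TreeBoundary.

(** * Branches at a vertex and bushiness *)

Section Components.
Variables (R : realType) (T : tree).
Let hT := treeP T.
Notation vp := (vertex_point R).
Notation td := (tdist hT).
Notation X := (realization R T).
Implicit Types (u v : vertex T) (p q : X).

Section Segment.
Variables (u u' : vertex T).
Hypothesis uu' : spans u u'.

Let clamp (t : R) : R := if t <= 0 then 0 else if t <= 1 then t else 1.

Lemma segment_point_subproof (t : R) : exists w w', spans w w' /\
  on_cell (fun x => (1 - clamp t) * \1_[set u] x + clamp t * \1_[set u'] x) w w'.
Proof.
exists u, u'; split=> //; exists (clamp t) => //.
by rewrite /clamp; case: (leP t 0) => h; last case: (leP t 1) => h'; apply/andP; split; lra.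
Qed.

(** The parameter is clamped to the unit interval, which makes the path 1-Lipschitz on the whole
    line. *)
Definition segment_point t : X := Realization (segment_point_subproof t).

Lemma segment_point_cell t : on_cell (segment_point t) u u'.
Proof.
exists (clamp t) => //.
by rewrite /clamp; case: (leP t 0) => h; last case: (leP t 1) => h'; apply/andP; split; lra.
Qed.

Lemma segment_pointE (t : R) : 0 <= t <= 1 ->
  bary (segment_point t) = (fun x => (1 - t) * \1_[set u] x + t * \1_[set u'] x).
Proof.
move=> /andP[t0 t1] /=; rewrite /clamp.
by case: (leP t 0) => h; rewrite ?t1//; have -> : t = 0 by lra.
Qed.

Lemma segment_point_lip t s : mdist (segment_point t) (segment_point s) <= `|t - s|.
Proof.
have := string_cell uu' (segment_point_cell t) (segment_point_cell s).
move=> /mdist_le_string h; apply: le_trans h _.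
have cl : `|clamp t - clamp s| <= `|t - s|.
  rewrite /clamp; have := ler_norm (t - s); have := ler_norm (s - t).
  rewrite (distrC s t) => ? ?; case: (leP t 0) => h1; case: (leP s 0) => h2;
    try (case: (leP t 1) => h3); try (case: (leP s 1) => h4);
    rewrite ler_norml; apply/andP; split; lra.
rewrite /= !indicE; have uu : u \in [set u] by exact: mem_set.
apply: le_trans cl; rewrite uu mulr1n; move: (clamp t) (clamp s) => x y.
case: (u \in [set u']); rewrite ?mulr1n ?mulr0n.
  have -> : (1 - x) * 1 + x * 1 - ((1 - y) * 1 + y * 1) = 0 :> R by lra.
  by rewrite normr0.
have -> : (1 - x) * 1 + x * 0 - ((1 - y) * 1 + y * 0) = y - x :> R by lra.
by rewrite distrC.
Qed.

Lemma segment_point_continuous : continuous segment_point.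
Proof.
move=> t; apply/metricType_numDomainType.cvgrPdist_lt => e e0.
apply/nbhs_ballP; exists e => //= s; rewrite /ball /= => h.
by apply: le_lt_trans h; exact: segment_point_lip.
Qed.

Lemma segment_component v t s : 0 <= t -> t <= s -> s <= 1 ->
  (forall r, t <= r <= s -> segment_point r <> vp v) ->
  connected_component (~` [set vp v]) (segment_point t) =
  connected_component (~` [set vp v]) (segment_point s).
Proof.
move=> t0 ts s1 h; apply: same_connected_component.
pose I : set R := [set` `[t, s]].
have cI : connected I by apply/connected_intervalP; exact: interval_is_interval.
have cS : connected [set segment_point r | r in I].
  apply: connected_continuous_connected => //.
  by apply: continuous_subspaceT; exact: segment_point_continuous.
apply: (connected_component_max _ _ cS).
- by exists t => //; rewrite /I /= in_itv /= lexx ts.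
- by move=> _ [r /= rI <-]; apply: h; move: rI; rewrite /I /= in_itv.
- by exists s => //; rewrite /I /= in_itv /= ts lexx.
Qed.

Lemma segment_point_bary v t : 0 <= t <= 1 -> segment_point t = vp v ->
  (1 - t) * \1_[set u] v + t * \1_[set u'] v = 1 :> R.
Proof.
move=> t01 /(congr1 (fun p : X => bary p v)); rewrite segment_pointE// => ->.
by rewrite /= indicE mem_set.
Qed.

End Segment.

Notation comp v := (connected_component (~` [set vp v])).

Lemma component_edge v u u' : spans u u' -> u <> v -> u' <> v ->
  comp v (vp u) = comp v (vp u').
Proof.
move=> uu' uv u'v.
have e0 : segment_point uu' 0 = vp u.
  apply: bary_inj; rewrite segment_pointE ?lexx ?ler01//; apply/funext => x.
  by rewrite /= subr0 mul1r mul0r addr0.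
have e1 : segment_point uu' 1 = vp u'.
  apply: bary_inj; rewrite segment_pointE ?lexx ?ler01//; apply/funext => x.
  by rewrite /= subrr mul0r mul1r add0r.
rewrite -e0 -e1; apply: segment_component; rewrite ?ler01 ?lexx//.
move=> r r01 /(segment_point_bary r01).
have -> : (\1_[set u] v : R) = 0 by rewrite indicE memNset// => /esym.
have -> : (\1_[set u'] v : R) = 0 by rewrite indicE memNset// => /esym.
by rewrite !mulr0 addr0 => /esym/eqP; rewrite oner_eq0.
Qed.

Lemma component_vertex v p : p <> vp v -> exists w,
  [/\ w <> v, comp v p = comp v (vp w) & mdist p (vp w) <= 1].
Proof.
move=> pv; have [u [u' [uu' pc]]] := baryP p; have [t t01 pE] := pc.
have /andP[t0 t1] := t01.
have ep : segment_point uu' t = p by apply: bary_inj; rewrite segment_pointE.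
have e0 : segment_point uu' 0 = vp u.
  apply: bary_inj; rewrite segment_pointE ?lexx ?ler01//; apply/funext => x.
  by rewrite /= subr0 mul1r mul0r addr0.
have e1 : segment_point uu' 1 = vp u'.
  apply: bary_inj; rewrite segment_pointE ?lexx ?ler01//; apply/funext => x.
  by rewrite /= subrr mul0r mul1r add0r.
have iv x : x <> v -> (\1_[set x] v : R) = 0 by move=> xv; rewrite indicE memNset// => /esym.
have ivv : (\1_[set v] v : R) = 1 by rewrite indicE mem_set.
have [uv|uv] := pselect (u = v).
  have t_gt0 : 0 < t.
    rewrite lt_neqAle t0 andbT; apply/eqP => te; apply: pv.
    by rewrite -ep -te e0 uv.
  have u'v : u' <> v.
    move=> u'v; apply: pv; apply: bary_inj; rewrite pE uv u'v; apply/funext => x /=.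
    by rewrite -mulrDl subrK mul1r.
  exists u'; split=> //.
    rewrite -ep -e1; apply: segment_component => // r /andP[tr r1].
    have r01 : 0 <= r <= 1 by apply/andP; split=> //; exact: le_trans tr.
    by move=> /(segment_point_bary r01); rewrite uv ivv (iv _ u'v); lra.
  rewrite -ep -e1; apply: le_trans (segment_point_lip _ _ _) _.
  by rewrite ler_norml; apply/andP; split; lra.
exists u; split=> //.
  rewrite -ep -e0; apply/esym/segment_component => // r /andP[r0 rt].
  have r01 : 0 <= r <= 1 by apply/andP; split=> //; exact: le_trans rt t1.
  move=> /(segment_point_bary r01); rewrite (iv _ uv) mulr0 add0r.
  have [u'v|u'v] := pselect (u' = v); last by rewrite (iv _ u'v); lra.
  rewrite u'v ivv mulr1 => r1; have tt : t = 1 by apply/eqP; rewrite eq_le t1 -r1.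
  by apply: pv; rewrite -ep tt e1 u'v.
rewrite -ep -e0; apply: le_trans (segment_point_lip _ _ _) _.
by rewrite ler_norml; apply/andP; split; lra.
Qed.

(** A geodesic from [v] does not return to [v], so a component of the complement of [v] is
    identified by a first dart. *)
Lemma component_branch v (w : vertex T) d s : geod hT v w = d :: s ->
  comp v (vp w) = comp v (vp (terminus d)).
Proof.
elim/last_ind: s w => [|s e IH] w gw.
  have := geod_walk hT v w; rewrite gw => -[_ /= <-] //.
have w' : walk v (rcons (d :: s) e) w by rewrite rcons_cons -gw; exact: geod_walk.
have [wo te] := (walk_rcons _ _ _ _).1 w'.
have r : reduced (rcons (d :: s) e) by rewrite rcons_cons -gw; exact: geod_reduced.
have go : geod hT v (origin e) = d :: s.
  by apply: geodP => //; move: r; rewrite -cats1 => /reduced_catl.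
rewrite -(IH _ go); apply/esym/component_edge.
- by right; exists e.
- by move=> ov; move: go; rewrite ov geodxx.
- by move=> wv; move: gw; rewrite wv geodxx.
Qed.

Hypothesis T_valence : bounded_valence T.

Lemma finite_dart_bound (P : dart T -> nat -> Prop) v :
  (forall d m n, (m <= n)%N -> P d m -> P d n) ->
  (forall d, origin d = v -> exists M, P d M) -> exists M, forall d, origin d = v -> P d M.
Proof.
move=> mono h; have /(@finite_seqP {classic dart T})[l le] := finite_darts T_valence v.
have : forall d : {classic dart T}, d \in l -> exists M, P d M.
  by move=> d dl; apply: h; have : [set` l] d by []; rewrite -le.
suff : (forall d : {classic dart T}, d \in l -> exists M, P d M) ->
   exists M, forall d : {classic dart T}, d \in l -> P d M.
  by move=> k /k[M hM]; exists M => d dv; apply: hM; have : [set d | origin d = v] d by []; rewrite le.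
elim: l {le} => [|d l IH] hl; first by exists 0%N.
have [|M hM] := IH; first by move=> e el; apply: hl; rewrite inE el orbT.
have [|M' hM'] := hl d; first by rewrite inE eqxx.
exists (maxn M M') => e; rewrite inE => /orP[/eqP ->|/hM].
  by apply: mono hM'; exact: leq_maxr.
by apply: mono; exact: leq_maxl.
Qed.

Definition unbounded_branch v d := forall M : nat, exists w s,
  geod hT v w = d :: s /\ (M <= size s)%N.

(** If each of the finitely many darts leading into the component had bounded geodesics behind it,
    the component would lie in a ball around [v]. *)
Lemma unbounded_component_branch v x : unbounded (comp v x) ->
  exists d, [/\ origin d = v, unbounded_branch v d & comp v (vp (terminus d)) = comp v x].
Proof.
move=> ub; apply: contrapT => no.
pose P d M := comp v (vp (terminus d)) = comp v x ->
  forall w s, geod hT v w = d :: s -> (size s < M)%N.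
have [||M hM] := @finite_dart_bound P v.
- by move=> d m n mn Pm e w s g; apply: leq_trans (Pm e w s g) mn.
- move=> d dv; apply: contrapT => noM; apply: no; exists d.
  have e : comp v (vp (terminus d)) = comp v x.
    by apply: contrapT => e; apply: noM; exists 0%N => /e.
  split=> // M; apply: contrapT => noM'; apply: noM; exists M => _ w s g.
  by rewrite ltnNge; apply/negP => Ms; apply: noM'; exists w, s.
have bd p : comp v x p -> mdist p (vp v) <= M%:R + 1.
  move=> cp; have pv : p <> vp v by exact: connected_component_sub cp.
  have [w [wv cw dw]] := component_vertex pv.
  case g: (geod hT v w) => [|d s]; first by case: wv; rewrite (geod_eq g).
  have dv : origin d = v by have := geod_walk hT v w; rewrite g => -[].
  have := hM d dv; rewrite /P -(component_branch g) -cw (same_connected_component cp) => /(_ erefl w s g) sM.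
  apply: le_trans (metric_triangle _ (vp w) _) _; rewrite mdist_vp tdistC /tdist g /=.
  by rewrite addrC lerD// ler_nat.
have [p [q [cp cq]]] := ub (2 * (M%:R + 1)).
have := metric_triangle p (vp v) q; have := bd p cp; have := bd q cq.
by rewrite (metric_sym q); lra.
Qed.

Section Perfect.
Variable o : vertex T.
Notation pre := (prefix_at o).

Implicit Type w : seq (dart T).

(** A prefix of arbitrarily long geodesics from [o]; by König's lemma it continues to a ray, which
    is [extendable_boundary]. *)
Definition extendable (w : seq (dart T)) := forall M : nat, exists x,
  (M <= tdist hT o x)%N /\ take (size w) (geod hT o x) = w.

Lemma extendable_step w : extendable w -> exists d, extendable (rcons w d).
Proof.
move=> ew; apply: contrapT => no.
pose v := last o [seq terminus d | d <- w].
pose P d M := forall x, take (size w).+1 (geod hT o x) = rcons w d -> (tdist hT o x < M)%N.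
have [||M hM] := @finite_dart_bound P v.
- by move=> d m n mn Pm x h; apply: leq_trans (Pm x h) mn.
- move=> d dv; apply: contrapT => noM; apply: no; exists d => M.
  apply: contrapT => noM'; apply: noM; exists M => x h.
  rewrite ltnNge; apply/negP => Mx; apply: noM'; exists x.
  by rewrite size_rcons.
have [x [Mx tx]] := ew (maxn M (size w).+1).
move: Mx; rewrite geq_max => /andP[Mx wx].
have [d ed] : exists d, take (size w).+1 (geod hT o x) = rcons w d.
  have s1 : size (take (size w).+1 (geod hT o x)) = (size w).+1 by rewrite size_takel.
  have t1 : take (size w) (take (size w).+1 (geod hT o x)) = w by rewrite take_takel.
  move: s1 t1; case/lastP: (take _ _) => [//|y d]; rewrite size_rcons => -[sy].
  by rewrite -cats1 take_size_cat// => ->; exists d; rewrite cats1.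
have dv : origin d = v.
  have := geod_walk hT o x; rewrite -(cat_take_drop (size w).+1 (geod hT o x)) ed.
  by move=> /walk_cat[y /walk_rcons[/walk_last h _] _]; rewrite /v h.
by have := hM d dv x ed; rewrite ltnNge Mx.
Qed.

Lemma extendable_walk w : extendable w -> exists2 v, walk o w v & reduced w.
Proof.
move=> ew; have [x [_ tx]] := ew 0%N; exists (geod_vertex hT o x (size w)).
  by rewrite -{1}tx; exact: geod_vertex_walk.
by rewrite -tx -geod_geod_vertex; exact: geod_reduced.
Qed.

Lemma extendable_boundary w : extendable w ->
  exists a : boundary X, pre a (size w) = w.
Proof.
move=> ew.
have f y : {y' | extendable y -> exists2 d, y' = rcons y d & extendable y'}.
  apply: cid; have [h|h] := pselect (extendable y).
    by have [d hd] := extendable_step h; exists (rcons y d) => _; exists d.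
  by exists [::].
pose g := fix g n := if n is m.+1 then projT1 (f (g m)) else w.
have eg n : extendable (g n).
  by elim: n => [//|n IH] /=; have [d] := projT2 (f (g n)) IH.
have gS n : exists d, g n.+1 = rcons (g n) d.
  by have [d e _] := projT2 (f (g n)) (eg n); exists d.
have sg n : size (g n) = (size w + n)%N.
  elim: n => [|n IH]; first by rewrite addn0.
  by have [d ->] := gS n; rewrite size_rcons IH addnS.
have tg m n : (m <= n)%N -> take (size (g m)) (g n) = g m.
  elim: n => [|n IH]; first by rewrite leqn0 => /eqP ->; rewrite take_size.
  rewrite leq_eqVlt => /orP[/eqP ->|mn]; first by rewrite take_size.
  have [d ->] := gS n; rewrite -cats1 takel_cat ?IH//.
  by rewrite !sg leq_add2l.
have tg' k m n : (k <= size w + m)%N -> (m <= n)%N -> take k (g n) = take k (g m).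
  by move=> km mn; rewrite -[in RHS](tg _ _ mn) take_takel// sg.
have [||| a [pa _]] := @ray_boundary R T o (fun n => take n (g n)).
- by move=> n; rewrite size_takel// sg leq_addl.
- move=> m n mn; rewrite take_takel//; apply: tg' => //; exact: leq_addl.
- move=> n; have [v wv rv] := extendable_walk (eg n).
  move: wv rv; rewrite -{1 2}(cat_take_drop n (g n)) => /walk_cat[u wu _] /reduced_catl.
  by exists u.
exists a; rewrite pa (tg' _ 0%N)//= ?addn0// take_size//.
Qed.

Lemma forward_extendable v d : origin d = v -> unbounded_branch v d ->
  (forall w e, geod hT o v = rcons w e -> d <> reverse e) ->
  extendable (rcons (geod hT o v) d).
Proof.
move=> dv ub nr M; have [x [s [gx sM]]] := ub M.
have gox : geod hT o x = geod hT o v ++ geod hT v x.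
  apply: geodP; first by apply: walk_catI; exact: geod_walk.
  have := geod_reduced hT v x; rewrite gx => r.
  case/lastP E: (geod hT o v) => [//|w e]; rewrite cat_rcons; apply/reduced_cat2.
  split=> //; first by rewrite -E; exact: geod_reduced.
  exact: nr E.
exists x; rewrite /tdist gox gx size_cat /=; split; first by lia.
rewrite size_rcons -cat_rcons take_size_cat// size_rcons//.
Qed.

Hypothesis T_bushy : bushy R T.

(** Of the three unbounded branches at a bushy vertex at most one points back to [o]; the other two
    continue the geodesic from [o]. *)
Lemma bushy_branching : exists k, forall u, exists2 v, (tdist hT u v <= k)%N &
  exists d1 d2, [/\ d1 <> d2, extendable (rcons (geod hT o v) d1) &
    extendable (rcons (geod hT o v) d2)].
Proof.
have [D hD] := T_bushy; have [k hk] := bound_nat D; exists k => u.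
have [v /= [dv [c [injc ubc]]]] := hD (vp u).
exists v.
  by rewrite -(ler_nat R) -mdist_vp; exact: le_trans hk.
have [f hf] : exists f : 'I_3 -> dart T, forall i, [/\ origin (f i) = v, unbounded_branch v (f i) &
    comp v (vp (terminus (f i))) = comp v (c i)].
  have h i := cid (unbounded_component_branch (ubc i)).
  by exists (fun i => projT1 (h i)) => i; exact: projT2 (h i).
have injf : injective f.
  move=> i j fij; apply: injc => /=.
  by have [_ _ <-] := hf i; have [_ _ <-] := hf j; rewrite fij.
pose back d := exists w e, geod hT o v = rcons w e /\ d = reverse e.
have back1 d d' : back d -> back d' -> d = d'.
  by move=> [w [e [g ->]]] [w' [e' [g' ->]]]; move: g; rewrite g' => /rcons_inj[_ ->].
have fwd i : ~ back (f i) -> extendable (rcons (geod hT o v) (f i)).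
  move=> nb; have [ov ub _] := hf i; apply: forward_extendable => //.
  by move=> w e g fe; apply: nb; exists w, e.
have ne (i j : 'I_3) : i != j -> f i <> f j by move=> /eqP ij /injf.
pose i0 : 'I_3 := @Ordinal 3 0 isT; pose i1 : 'I_3 := @Ordinal 3 1 isT.
pose i2 : 'I_3 := @Ordinal 3 2 isT.
have [b0|b0] := pselect (back (f i0)).
  exists (f i1), (f i2); split; [exact: ne| |]; apply: fwd => b; have := back1 _ _ b0 b;
    exact: ne.
have [b1|b1] := pselect (back (f i1)).
  exists (f i0), (f i2); split; [exact: ne|exact: fwd|]; apply: fwd => b; have := back1 _ _ b1 b;
    exact: ne.
by exists (f i0), (f i1); split; [exact: ne|exact: fwd|exact: fwd].
Qed.

Lemma boundary_neq0 : exists a : boundary X, True.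
Proof.
have [k hk] := bushy_branching.
by have [v _ [d1 [d2 [_ /extendable_boundary[a _] _]]]] := hk o; exists a.
Qed.

Lemma boundary_no_isolated (a : boundary X) n : exists b, pre b n = pre a n /\ b <> a.
Proof.
(* A vertex within [k] of depth [n + k] on the ray still shares the first [n] darts with it. Two
   rays pass through that vertex and then part, and at most one of them is [a]. *)
have [k hk] := bushy_branching; pose u := prefix_vertex o a (n + k).
have [v uv [d1 [d2 [d12 /extendable_boundary[b1 hb1] /extendable_boundary[b2 hb2]]]]] := hk u.
have du : tdist hT o u = (n + k)%N by exact: tdist_prefix_vertex.
have g : (n <= tgp hT o u v)%N.
  have := tdist_gp hT o u v; have := tdist_triangle hT v o u.
  by rewrite (tdistC hT v u); lia.
have [nv tv] : (n <= size (geod hT o v))%N /\ take n (geod hT o v) = pre a n.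
  split; first exact: leq_trans g (lcp_sizer _ _).
  have /lcp_leq[_ <-] := g.
  by rewrite geod_prefix_vertex take_prefix_at// leq_addr.
have pb b d : pre b (size (rcons (geod hT o v) d)) = rcons (geod hT o v) d -> pre b n = pre a n.
  move=> h; rewrite -(@take_prefix_at _ _ _ _ n (size (rcons (geod hT o v) d))); last first.
    by rewrite size_rcons; exact: leq_trans nv _.
  by rewrite h -cats1 takel_cat.
have [e1|e1] := pselect (b1 = a); last by exists b1; split=> //; exact: pb hb1.
exists b2; split; first exact: pb hb2.
move=> e2; apply: d12; move: hb1 hb2; rewrite e1 e2 !size_rcons => ->.
by move/rcons_inj => [].
Qed.

End Perfect.
End Components.

(** * The quasiconformality criteria *)

Lemma finite_subsets (I : eqType) (F : set I) : finite_set F ->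
  finite_set [set S | S `<=` F].
Proof.
move=> /finite_seqP[l ->]; elim: l => [|x l IH].
  apply: (@sub_finite_set _ _ [set set0]); last exact: finite_set1.
  by move=> S h; apply/seteqP; split=> // y /h.
have f2 : finite_set ([set S | S `<=` [set` l]] `|` [set x |` S | S in [set S | S `<=` [set` l]]]).
  by rewrite finite_setU; split=> //; exact: finite_image.
apply: sub_finite_set f2 => S hS.
have [Sx|nSx] := pselect (S x); last first.
  left=> y Sy; have := hS y Sy; rewrite /= inE => /orP[/eqP e|//].
  by rewrite e in Sy.
right; exists (S `&` [set` l]); first exact: subIsetr.
apply/seteqP; split=> y; first by move=> [->|[]].
move=> Sy; have := hS y Sy; rewrite /= inE => /orP[/eqP e|yl]; [by left|by right].
Qed.

Section QuasiMobius.
Variables (R : realType) (T : tree) (o : vertex T).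
Let hT := treeP T.
Notation X := (realization R T).
Notation pre := (prefix_at o).
Notation nb := (branching o).
Implicit Types (a b c : boundary X).

Definition distinct4 (B : Type) (a b c d : B) :=
  [/\ a <> b, a <> c, a <> d & [/\ b <> c, b <> d & c <> d]].

(* On the boundary of a tree the logarithm of the cross ratio of [a, b, c, d] is
   [nb a b + nb c d - nb a d - nb b c] up to a bounded error. *)
Definition uniformly_qm (P : set (boundary X -> boundary X)) :=
  forall M, exists J, forall F, P F -> forall a b c d, distinct4 a b c d ->
    (nb (F a) (F b) + nb (F c) (F d) <= nb (F a) (F d) + nb (F b) (F c) + M)%N ->
    (nb a b + nb c d <= nb a d + nb b c + J)%N.

Hypothesis T_valence : bounded_valence T.

Lemma prefix_at_rcons b n : exists d, pre b n.+1 = rcons (pre b n) d /\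
  origin d = prefix_vertex o b n.
Proof.
have [d ed] : exists d, pre b n.+1 = rcons (pre b n) d.
  have := take_prefix_at o b (leqnSn n); have := size_prefix_at o b n.+1.
  case/lastP: (pre b n.+1) => [//|x d] sx; rewrite -cats1 => h; exists d.
  rewrite -h take_size_cat ?cats1//.
  by move: sx; rewrite size_rcons => -[].
exists d; split=> //; have [u] := prefix_at_vertex o b n.+1.
by rewrite ed => /walk_rcons[/walk_last h _] _; rewrite /prefix_vertex h.
Qed.

Lemma prefixes_finite n :
  finite_set [set (pre b n : seq {classic dart T}) | b in [set: boundary X]].
Proof.
elim: n => [|n IH].
  apply: (@sub_finite_set _ _ [set [::]]); last exact: finite_set1.
  by move=> _ [b _ <-]; exact/size0nil/size_prefix_at.
pose D (w : seq (dart T)) : set (seq {classic dart T}) :=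
  [set rcons w d | d in [set d | origin d = last o [seq terminus e | e <- w]]].
apply: (@sub_finite_set _ _ (\bigcup_(w in [set (pre b n : seq {classic dart T}) | b in [set: boundary X]]) D w)).
  move=> _ [b _ <-]; have [d [-> od]] := prefix_at_rcons b n.
  by exists (pre b n); [exists b|exists d].
by apply: bigcup_finite => // w _; apply: finite_image; exact: finite_darts.
Qed.

Lemma saturated_finite n : finite_set [set U : set (boundary X) | saturated o n U].
Proof.
have := finite_subsets (prefixes_finite n).
move=> /(finite_image (fun S : set (seq {classic dart T}) => [set b : boundary X | S (pre b n)])).
apply: sub_finite_set => U sU; exists [set (pre b n : seq {classic dart T}) | b in U].
  by move=> _ [b Ub <-]; exists b.
apply/seteqP; split=> b; last by move=> Ub; exists b.
by move=> [a Ua e]; apply: sU Ua.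
Qed.

Lemma saturated_nb n U a b : saturated o n U -> U a -> ~ U b -> (nb a b < n)%N.
Proof.
move=> sU Ua nUb; have ab : a <> b by move=> e; apply: nUb; rewrite -e.
rewrite ltnNge; apply/negP => /(branchingP _ _ ab) e; apply: nUb; exact: sU Ua.
Qed.

Lemma far_nb n a b : pre a n <> pre b n -> a <> b /\ (nb a b < n)%N.
Proof.
move=> ne; have ab : a <> b by move=> e; apply: ne; rewrite e.
by split=> //; rewrite ltnNge; apply/negP => /(branchingP _ _ ab).
Qed.

Variables (G : groupType) (A : G -> boundary X -> boundary X).
Hypotheses (A1 : forall b, A 1%g b = b)
  (AM : forall g h b, A (g * h)%g b = A g (A h b)).
Hypothesis A_qm : uniformly_qm (range A).

(** The two pairs of test points are in bounded position, and so are their images under the inverse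
    of [g], since the latter are separated by [W]. This bounds the level at which the translate is
    saturated, and finitely many sets are saturated at a given level. *)
Lemma qm_convergence (W A1' A2 : set (boundary X)) :
  clopen W -> clopen A1' -> clopen A2 ->
  finite_set [set V | exists g, [/\ V = translate A g W,
      (exists x y, [/\ V x, V y, A1' x & ~ A1' y]) &
      (exists x y, [/\ ~ V x, ~ V y, A2 x & ~ A2 y])]].
Proof.
move=> /(clopen_saturated o T_valence)[n1 sW].
move=> /(clopen_saturated o T_valence)[m1 sA1].
move=> /(clopen_saturated o T_valence)[m2 sA2].
pose n0 := maxn m1 m2.
have [J1 hJ1] := A_qm (2 * n0); have [J2 hJ2] := A_qm (2 * n1).
pose K := (2 * n0 + 2 * n1 + J1 + J2)%N.
(* [K] will bound all branching heights among the four points and among their images; [n2] exceeds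
   what the last application of [A_qm] allows for [nb p q]. *)
have [J3 hJ3] := A_qm (n1 + K); pose n2 := (2 * K + J3).+1.
apply: sub_finite_set (saturated_finite n2) => _ [g [->]].
move=> [x [y [Vx Vy A1x A1y]]] [z [w [Vz Vw A2z A2w]]].
have xy : (nb x y < n0)%N by apply: leq_trans (saturated_nb sA1 A1x A1y) (leq_maxl _ _).
have zw : (nb z w < n0)%N by apply: leq_trans (saturated_nb sA2 A2z A2w) (leq_maxr _ _).
pose A' := A g^-1%g.
have Aiv p : A g (A' p) = p by rewrite /A' -AM mulgV A1.
have A'inj p q : p <> q -> A' p <> A' q.
  by move=> pq e; apply: pq; rewrite -(Aiv p) -(Aiv q) e.
have sep p q : translate A g W p -> ~ translate A g W q -> (nb (A' p) (A' q) < n1)%N /\ p <> q.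
  by move=> Vp Vq; split; [exact: saturated_nb sW Vp Vq|move=> e; apply: Vq; rewrite -e].
have [xz' xz] := sep _ _ Vx Vz; have [xw' xw] := sep _ _ Vx Vw.
have [yz' yz] := sep _ _ Vy Vz; have [yw' yw] := sep _ _ Vy Vw.
have nxy : x <> y by move=> e; apply: A1y; rewrite -e.
have nzw : z <> w by move=> e; apply: A2w; rewrite -e.
have zyC := branchingC o z y; have wzC := branchingC o w z; have wyC := branchingC o w y.
have zyC' := branchingC o (A' z) (A' y); have wzC' := branchingC o (A' w) (A' z).
have wyC' := branchingC o (A' w) (A' y).
(* Applying [g] bounds the heights within each pair of preimages; the next two applications, to the
   inverse of [g], bound the mixed heights of the original points. *)
have src : (nb (A' x) (A' y) + nb (A' z) (A' w) <= 2 * n1 + J1)%N.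
  have D : distinct4 (A' x) (A' y) (A' z) (A' w).
    by split; [exact: A'inj|exact: A'inj|exact: A'inj|split; exact: A'inj].
  have := hJ1 (A g) (ex_intro2 _ _ g I erefl) _ _ _ _ D; rewrite !Aiv => h.
  have k : (nb x y + nb z w <= nb x w + nb y z + 2 * n0)%N by lia.
  by have := h k; lia.
have tgt1 : (nb x w + nb y z <= 2 * n0 + J2)%N.
  have D : distinct4 x w z y.
    by split=> //; split; [exact: nesym|exact: nesym|exact: nesym].
  have h := hJ2 A' (ex_intro2 _ _ g^-1%g I erefl) _ _ _ _ D.
  have k : (nb (A' x) (A' w) + nb (A' z) (A' y) <=
    nb (A' x) (A' y) + nb (A' w) (A' z) + 2 * n1)%N by lia.
  by have := h k; lia.
have tgt2 : (nb x z + nb y w <= 2 * n0 + J2)%N.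
  have D : distinct4 x z w y.
    by split=> //; split; [|exact: nesym|exact: nesym].
  have h := hJ2 A' (ex_intro2 _ _ g^-1%g I erefl) _ _ _ _ D.
  have k : (nb (A' x) (A' z) + nb (A' w) (A' y) <=
    nb (A' x) (A' y) + nb (A' z) (A' w) + 2 * n1)%N by lia.
  by have := h k; lia.
move=> p q pq Vp; apply: contrapT => Vq.
have [pq' npq] := sep _ _ Vp Vq.
(* The points [p] and [q] agree beyond level [K], so they are close to at most one of the four
   points; the pair not containing that point serves as [s] and [t]. *)
have [s [t [[ps qs] [pt qt] st st']]] : exists s t,
  [/\ pre p K.+1 <> pre s K.+1 /\ pre q K.+1 <> pre s K.+1,
      pre p K.+1 <> pre t K.+1 /\ pre q K.+1 <> pre t K.+1,
      s <> t & (nb (A' s) (A' t) <= K)%N].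
  have pqK : pre p K.+1 = pre q K.+1 by apply: prefix_at_leq pq; rewrite /n2; lia.
  have far r r' : pre p K.+1 = pre r K.+1 -> r <> r' -> (nb r r' <= K)%N ->
      pre p K.+1 <> pre r' K.+1.
    by move=> pr rr' le e; move: le; rewrite leqNgt => /negP; apply; apply/branchingP; rewrite -?pr.
  have [px|px] := pselect (pre p K.+1 = pre x K.+1).
    exists z, w; rewrite -!pqK; split=> //; try by lia.
      by split; apply: far px _ _ => //; rewrite /K; lia.
    by split; apply: far px _ _ => //; rewrite /K; lia.
  have [py|py] := pselect (pre p K.+1 = pre y K.+1).
    exists z, w; rewrite -!pqK; split=> //; try by lia.
      by split; apply: far py _ _ => //; rewrite /K; lia.
    by split; apply: far py _ _ => //; rewrite /K; lia.
  by exists x, y; rewrite -!pqK; split=> //; rewrite /K; lia.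
have [nps _] := far_nb ps; have [nqs qsK] := far_nb qs.
have [npt ptK] := far_nb pt; have [nqt _] := far_nb qt.
have D : distinct4 p q s t by split.
have h := hJ3 A' (ex_intro2 _ _ g^-1%g I erefl) _ _ _ _ D.
have k : (nb (A' p) (A' q) + nb (A' s) (A' t) <=
  nb (A' p) (A' t) + nb (A' q) (A' s) + (n1 + K))%N by lia.
have le : (n2 <= nb p q)%N by apply/branchingP.
by have := h k; rewrite /n2 in le; lia.
Qed.

End QuasiMobius.

(** * Quasi-isometries *)

Section VertexMaps.
Variables (T : graph) (hT : is_tree T).
Notation td := (tdist hT).
Implicit Types (x y z t u v m : vertex T).

Lemma tdist_geod_vertexS x y i : (i < td x y)%N ->
  (td (geod_vertex hT x y i) (geod_vertex hT x y i.+1) <= 1)%N.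
Proof.
move=> ixy; have [e1 _] := tdist_geod_vertex (ltnW ixy).
have [e2 _] := tdist_geod_vertex ixy.
have := tdist_gp hT x (geod_vertex hT x y i) (geod_vertex hT x y i.+1).
have : (i <= tgp hT x (geod_vertex hT x y i) (geod_vertex hT x y i.+1))%N.
  apply/lcp_leq; rewrite !geod_geod_vertex size_takel; last exact: ltnW.
  by split=> //; rewrite !take_takel.
by rewrite e1 e2; lia.
Qed.

Variables (f : vertex T -> vertex T) (S K C : nat).
Hypotheses (f_S : forall u v, (td u v <= 1)%N -> (td (f u) (f v) <= S)%N)
  (f_K : forall u v, (td u v <= K * (td (f u) (f v) + C))%N).

(* The easy half of the stability of quasi-geodesics in a tree. *)
Lemma image_near_geod x y m : (td (f x) m + td m (f y) = td (f x) (f y))%N ->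
  exists2 u, (td x u + td u y = td x y)%N & (td (f u) m <= S)%N.
Proof.
move=> hm; pose g i := f (geod_vertex hT x y i).
have g0 : g 0%N = f x by rewrite /g /geod_vertex take0.
have gl : g (td x y) = f y.
  by rewrite /g /geod_vertex /tdist take_size (walk_last (geod_walk hT x y)).
pose ys := [seq g i.+1 | i <- iota 0 (td x y)].
have sy : size ys = td x y by rewrite size_map size_iota.
have nthE i : (i <= td x y)%N -> nth (f x) (f x :: ys) i = g i.
  case: i => [|i] ixy /=; first by rewrite g0.
  by rewrite (nth_map 0%N) ?size_iota// nth_iota.
have lastE : last (f x) ys = f y.
  by rewrite (last_nth (f x)) sy nthE.
have [||i] := @coarse_path_near _ hT S m (f x) ys.
- move=> i; rewrite sy => ixy; rewrite !nthE// ?(ltnW ixy)//.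
  exact/f_S/tdist_geod_vertexS.
- by rewrite lastE.
rewrite sy => ixy; rewrite nthE// => gi; exists (geod_vertex hT x y i) => //.
by have [-> ->] := tdist_geod_vertex ixy; rewrite subnKC.
Qed.

Lemma vertex_map_qm x y z t M :
  (td (f x) (f t) + td (f y) (f z) <= td (f x) (f y) + td (f z) (f t) + 2 * M)%N ->
  (td x t + td y z <= td x y + td z t + 2 * (K * (M + 2 * S + C)))%N.
Proof.
move=> h; have [m [n [hm hn mn]]] := geodesics_bridge hT (f x) (f y) (f z) (f t).
have [u hu fu] := image_near_geod hm; have [v hv fv] := image_near_geod hn.
have uv : (td u v <= K * (M + 2 * S + C))%N.
  apply: leq_trans (f_K u v) _; rewrite leq_mul2l leq_add2r; apply/orP; right.
  have h1 := tdist_triangle hT m (f u) (f v); have h2 := tdist_triangle hT n m (f v).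
  by rewrite (tdistC hT n) in h2; lia.
have h1 := tdist_triangle hT u x t; have h2 := tdist_triangle hT v u t.
have h3 := tdist_triangle hT u y z; have h4 := tdist_triangle hT v u z.
rewrite (tdistC hT y u) in h3; rewrite (tdistC hT v z) in h4; lia.
Qed.

End VertexMaps.

Section QuasiIsometries.
Variables (R : realType) (T : tree) (o : vertex T).
Let hT := treeP T.
Notation X := (realization R T).
Notation pre := (prefix_at o).
Notation nb := (branching o).
Notation vp := (vertex_point R).
Notation nu := (@near_vertex R T).
Notation td := (tdist hT).

Lemma tgp_prefix_vertex (a b : boundary X) n : a <> b -> (nb a b < n)%N ->
  tgp hT o (prefix_vertex o a n) (prefix_vertex o b n) = nb a b.
Proof.
move=> ab nab; rewrite /tgp !geod_prefix_vertex; apply/eqP; rewrite eqn_leq.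
apply/andP; split.
  rewrite leqNgt; apply/negP => /lcp_leq[_]; rewrite !take_prefix_at//.
  by move/(branchingP _ _ ab); rewrite ltnn.
apply/lcp_leq; rewrite size_prefix_at; split; first exact: ltnW.
by rewrite !take_prefix_at ?(ltnW nab)//; apply/(branchingP _ _ ab).
Qed.

Definition qi_extension (K C : R) (F : boundary X -> boundary X) :=
  injective F /\ exists2 f : X -> X, quasi_isometry K C f & extends_to_boundary f F.

Lemma qi_uniformly_qm (K C : R) : 1 <= K -> 0 <= C ->
  uniformly_qm o (qi_extension K C).
Proof.
move=> K1 C0 M.
have [S hS] := bound_nat (K + C + 2); have [K' hK] := bound_nat K.
have [C' hC] := bound_nat (C + 2).
exists (K' * (M + 2 * S + C'))%N => F [injF [f [qf _] ext]] a b c d.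
move=> [ab ac ad [bc bd cd]] hF.
pose g u := nu (f (vp u)).
have g_S u v : (td u v <= 1)%N -> (td (g u) (g v) <= S)%N.
  rewrite -!(ler_nat R) => uv; have := near_vertex_dist (f (vp u)) (f (vp v)).
  rewrite ler_norml => /andP[h _]; have /andP[_] := qf (vp u) (vp v); rewrite mdist_vp => h'.
  have : K * (td u v)%:R <= K * 1 by rewrite ler_wpM2l//; lra.
  by lra.
have g_K u v : (td u v <= K' * (td (g u) (g v) + C'))%N.
  have := near_vertex_dist (f (vp u)) (f (vp v)).
  rewrite ler_norml => /andP[_ h]; have /andP[h' _] := qf (vp u) (vp v); rewrite mdist_vp in h'.
  have K0 : 0 < K by lra.
  have : (td u v)%:R <= K * ((td (g u) (g v))%:R + C'%:R).
    by rewrite mulrC -ler_pdivrMr// mulrC; lra.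
  move=> le; rewrite -(ler_nat R) natrM natrD; apply: le_trans le _.
  by rewrite ler_wpM2r// addr_ge0.
have dF x y : x <> y -> F x <> F y by move=> xy /injF.
have lim x y (xy : x <> y) := branching_limit o (dF x y xy)
  (ext _ _ (tends_to_prefix_vertex o x)) (ext _ _ (tends_to_prefix_vertex o y)).
have [N1 h1] := lim _ _ ab; have [N2 h2] := lim _ _ cd.
have [N3 h3] := lim _ _ ad; have [N4 h4] := lim _ _ bc.
(* Past all thresholds the Gromov products of the prefix vertices and of their images are the
   branching heights. Rewritten in terms of distances, the inequality no longer involves the
   distances from [o]. *)
pose n := (N1 + N2 + N3 + N4 + nb a b + nb c d + nb a d + nb b c).+1.
have {}h1 := h1 n n ltac:(rewrite /n; lia) ltac:(rewrite /n; lia).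
have {}h2 := h2 n n ltac:(rewrite /n; lia) ltac:(rewrite /n; lia).
have {}h3 := h3 n n ltac:(rewrite /n; lia) ltac:(rewrite /n; lia).
have {}h4 := h4 n n ltac:(rewrite /n; lia) ltac:(rewrite /n; lia).
have k1 := @tgp_prefix_vertex a b n ab ltac:(rewrite /n; lia).
have k2 := @tgp_prefix_vertex c d n cd ltac:(rewrite /n; lia).
have k3 := @tgp_prefix_vertex a d n ad ltac:(rewrite /n; lia).
have k4 := @tgp_prefix_vertex b c n bc ltac:(rewrite /n; lia).
move: h1 h2 h3 h4 k1 k2 k3 k4; rewrite /= -!/(g _).
move: (prefix_vertex o a n) (prefix_vertex o b n) (prefix_vertex o c n) (prefix_vertex o d n).
move=> x y z t h1 h2 h3 h4 k1 k2 k3 k4.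
have := @vertex_map_qm _ hT g S K' C' g_S g_K x y z t M.
have := tdist_gp hT o (g x) (g t); have := tdist_gp hT o (g y) (g z).
have := tdist_gp hT o (g x) (g y); have := tdist_gp hT o (g z) (g t).
have := tdist_gp hT o x t; have := tdist_gp hT o y z.
have := tdist_gp hT o x y; have := tdist_gp hT o z t.
rewrite h1 h2 h3 h4 k1 k2 k3 k4 => e1 e2 e3 e4 e5 e6 e7 e8 h.
have {}h := h ltac:(lia); lia.
Qed.

End QuasiIsometries.

Lemma limn_einf_ge (R : realType) (u : (\bar R)^nat) (x : \bar R) N :
  (forall i, (N <= i)%N -> (x <= u i)%E) -> (x <= limn_einf u)%E.
Proof.
move=> h; rewrite limn_einf_lim; apply: lime_ge; first exact: is_cvg_einfs.
exists N => // n /= Nn; apply: le_ereal_inf_tmp => _ [i /= ni <-].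
by apply: h; exact: leq_trans ni.
Qed.

Lemma limn_einf_le (R : realType) (u : (\bar R)^nat) (x : \bar R) N :
  (forall i, (N <= i)%N -> (u i <= x)%E) -> (limn_einf u <= x)%E.
Proof.
move=> h; rewrite limn_einf_lim; apply: lime_le; first exact: is_cvg_einfs.
exists N => // n /= Nn; apply: le_trans (h n Nn).
by apply: ereal_inf_lbound; exists n => //=.
Qed.

Lemma distinct4_uniq (B : eqType) (a b c d : B) :
  distinct4 a b c d -> uniq [:: a; b; c; d].
Proof.
move=> [/eqP ab /eqP ac /eqP ad [/eqP bc /eqP bd /eqP cd]].
by rewrite /= !inE !negb_or ab ac ad bc bd cd.
Qed.

(** * Cross-ratios *)

Section CrossRatio.
Variables (R : realType) (T : tree) (o : vertex T).
Let hT := treeP T.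
Notation X := (realization R T).
Notation nb := (branching o).
Notation nu := (@near_vertex R T).
Implicit Types (a b c d : boundary X).

(** Each of the four distances is within 2 of a distance between vertices, hence the 8; in the
    alternating sum the distances from [o] cancel. *)
Lemma mdist_cross_difference a b c d x y z t : distinct4 a b c d ->
  tends_to x a -> tends_to y b -> tends_to z c -> tends_to t d ->
  exists N, forall i, (N <= i)%N ->
    `|mdist (x i) (t i) - mdist (t i) (z i) + mdist (z i) (y i) -
      mdist (y i) (x i) -
      2 * ((nb a b)%:R + (nb c d)%:R - (nb a d)%:R - (nb b c)%:R)| <= 8.
Proof.
move=> [ab _ ad [bc _ cd]] xa yb zc td.
have [N1 h1] := branching_limit o ab xa yb; have [N2 h2] := branching_limit o cd zc td.
have [N3 h3] := branching_limit o ad xa td; have [N4 h4] := branching_limit o bc yb zc.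
exists (N1 + N2 + N3 + N4)%N => i Ni.
have := h1 i i ltac:(lia) ltac:(lia); have := h2 i i ltac:(lia) ltac:(lia).
have := h3 i i ltac:(lia) ltac:(lia); have := h4 i i ltac:(lia) ltac:(lia).
have := near_vertex_dist (x i) (t i); have := near_vertex_dist (t i) (z i).
have := near_vertex_dist (z i) (y i); have := near_vertex_dist (y i) (x i).
move: (x i) (y i) (z i) (t i) => p q r s.
have E (u v : vertex T) : (tdist hT u v)%:R + 2 * (tgp hT o u v)%:R =
    (tdist hT o u)%:R + (tdist hT o v)%:R :> R.
  by rewrite -natrM -!natrD tdist_gp.
have := E (nu p) (nu s); have := E (nu s) (nu r); have := E (nu r) (nu q); have := E (nu q) (nu p).
rewrite (tgpC hT o (nu s)) (tgpC hT o (nu r) (nu q)) (tgpC hT o (nu q) (nu p)).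
rewrite !ler_norml => e1 e2 e3 e4 /andP[? ?] /andP[? ?] /andP[? ?] /andP[? ?].
move=> g1 g2 g3 g4; rewrite g1 g2 g3 g4 in e1 e2 e3 e4 *.
by apply/andP; split; lra.
Qed.

(** All lower limits lie between [2 * (L - 4)] and [2 * (L + 4)], so the supremum is finite and
    [fine] discards nothing. *)
Lemma cross_ratio_branching a b c d (L : R) : distinct4 a b c d ->
  L = (nb a b)%:R + (nb c d)%:R - (nb a d)%:R - (nb b c)%:R ->
  expR (L - 4) <= cross_ratio a b c d <= expR (L + 4).
Proof.
move=> abcd LE; rewrite /cross_ratio; set S := [set l | _]; set s := ereal_sup S.
have S_ub : ubound S (2 * (L + 4))%:E.
  move=> _ [x [y [z [t [[xa yb zc td] ->]]]]].
  have [N hN] := mdist_cross_difference abcd xa yb zc td.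
  apply: (@limn_einf_le _ _ _ N) => i /hN; rewrite -LE lee_fin ler_norml => /andP[_ ?].
  by lra.
have s_le : (s <= (2 * (L + 4))%:E)%E by exact: ge_ereal_sup.
have s_ge : ((2 * (L - 4))%:E <= s)%E.
  have [x xa] := tends_to_exists a; have [y yb] := tends_to_exists b.
  have [z zc] := tends_to_exists c; have [t td] := tends_to_exists d.
  have [N hN] := mdist_cross_difference abcd xa yb zc td.
  apply: (@le_trans _ _ (limn_einf (fun i => (mdist (x i) (t i) - mdist (t i) (z i) +
                               mdist (z i) (y i) - mdist (y i) (x i))%:E))).
    apply: (@limn_einf_ge _ _ _ N) => i /hN; rewrite -LE lee_fin ler_norml => /andP[? _].
    by lra.
  by apply: ereal_sup_ubound; exists x, y, z, t.
case: s s_le s_ge => [r||] //; rewrite !lee_fin /= => le ge.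
by rewrite !ler_expR; apply/andP; split; lra.
Qed.

Lemma quasimobius_uniformly_qm (I : R -> R) : proper_increasing I ->
  uniformly_qm o [set F : boundary X -> boundary X | injective F /\ quasimobius I F].
Proof.
(* From [1 + x <= expR x] at [x = L - 4], a bound on the cross-ratio bounds [L] with an extra 3. *)
move=> [I0 Imono _] M; have [J hJ] := bound_nat (I (expR (M%:R + 4)) + 3).
exists J => F [injF qmF] a b c d abcd; rewrite -2!(ler_nat R) !natrD => LM.
have Fabcd : distinct4 (F a) (F b) (F c) (F d).
  have dF x y : x <> y -> F x <> F y by move=> xy /injF.
  by have [ab ac ad [bc bd cd]] := abcd; split; [exact: dF..|split; exact: dF].
have /andP[lo _] := cross_ratio_branching abcd erefl.
have /andP[lo' hi'] := cross_ratio_branching Fabcd erefl.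
have [le _] := qmF _ _ _ _ (distinct4_uniq abcd).
set cr := cross_ratio _ _ _ _ in lo' hi' le.
have crI : I cr <= I (expR (M%:R + 4)).
  have : cr <= expR (M%:R + 4) by apply: le_trans hi' _; rewrite ler_expR; lra.
  rewrite le_eqVlt => /orP[/eqP ->//|/Imono]; move/(_ _)/ltW; apply.
  by apply: le_trans lo'; exact: expR_ge0.
have := expR_ge1Dx ((nb a b)%:R + (nb c d)%:R - (nb a d)%:R - (nb b c)%:R - 4 : R).
by lra.
Qed.

End CrossRatio.

(** * Compactness modulo isometries *)

Section CompactModuloIsometries.
Variables (R : realType) (T : tree) (o : vertex T).
Let hT := treeP T.
Notation X := (realization R T).
Notation isometry := Defs.isometry.
Notation pre := (prefix_at o).
Notation nb := (branching o).
Notation pv := (prefix_vertex o).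
Notation vp := (vertex_point R).
Notation nu := (@near_vertex R T).
Implicit Types (a b c d : boundary X).

Lemma isometry_inverse (f : X -> X) : isometry f ->
  exists2 f', isometry f' & cancel f f' /\ cancel f' f.
Proof.
move=> [[f' fK f'K] df]; exists f' => //; split; first by exists f.
by move=> x y; rewrite -df !f'K.
Qed.

Lemma isometry_extends (f : X -> X) : isometry f ->
  exists F : boundary X -> boundary X, extends_to_boundary f F.
Proof.
move=> f_iso; have [f' f'_iso [fK f'K]] := isometry_inverse f_iso.
have asym s t : asymptotic s t -> asymptotic (f \o s) (f \o t).
  move=> st p M; have [N hN] := st (f' p) M; exists N => i j Ni Nj.
  have := hN i j Ni Nj; rewrite /gromov_product /= f_iso.2.
  by rewrite -(f_iso.2 (s i)) -(f_iso.2 (t j)) f'K.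
have ext a : exists b, forall s, tends_to s a -> tends_to (f \o s) b.
  have [s sa] := tends_to_exists a.
  have [b sb] := boundary_of (asym _ _ (tends_toP sa)); exists b => t ta.
  exact: (asymptotic_tends_to o sb (asym _ _ (tends_to_asymptotic o sa ta))).
by exists (fun a => projT1 (cid (ext a))) => s a; exact: (projT2 (cid (ext a))).
Qed.

Lemma extends_cancel (f f' : X -> X) (F F' : boundary X -> boundary X) :
  extends_to_boundary f F -> extends_to_boundary f' F' -> cancel f f' -> cancel F F'.
Proof.
move=> fF f'F' fK a; have [s sa] := tends_to_exists a.
have h := f'F' _ _ (fF _ _ sa).
have e : f' \o (f \o s) = s by apply/funext => i /=; exact: fK.
by rewrite e in h; exact: (tends_to_unique o h sa (tends_toP sa)).
Qed.

Lemma isometry_boundary_inverse (f : X -> X) (F : boundary X -> boundary X) :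
  isometry f -> extends_to_boundary f F ->
  exists F', [/\ cancel F F', cancel F' F & qi_extension 1 0 F'].
Proof.
move=> f_iso fF; have [f' f'_iso [fK f'K]] := isometry_inverse f_iso.
have [F' f'F'] := isometry_extends f'_iso.
have FK := extends_cancel fF f'F' fK; have F'K := extends_cancel f'F' fF f'K.
exists F'; split=> //; split; first exact: can_inj F'K.
exists f' => //; split=> [x y|y]; last by exists (f y); rewrite fK mdistxx.
by rewrite f'_iso.2 invr1 mul1r subr0 addr0 lexx.
Qed.

(** The Gromov product at [o] equals that of the image points at [f o], which is within [D] of a
    vertex [m] where it vanishes; the 2 comes from passing to near vertices. *)
Lemma branching_isometry (f : X -> X) (F : boundary X -> boundary X) m n D a b :
  isometry f -> extends_to_boundary f F -> a <> b ->
  F a <> F b -> mdist (f (vp o)) (vp m) <= D ->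
  (forall i, (n <= i)%N -> tgp hT m (pv (F a) i) (pv (F b) i) = 0%N) ->
  (nb a b)%:R <= D + 2.
Proof.
move=> f_iso fF ab FaFb fom h; have [f' f'_iso [fK f'K]] := isometry_inverse f_iso.
have [F' f'F'] := isometry_extends f'_iso; have FK := extends_cancel fF f'F' fK.
have ta := f'F' _ _ (tends_to_prefix_vertex o (F a)).
have tb := f'F' _ _ (tends_to_prefix_vertex o (F b)).
rewrite FK in ta; rewrite FK in tb.
have [N hN] := branching_limit o ab ta tb.
pose i := maxn n N; rewrite -(hN i i); [|exact: leq_maxr..] => /=.
have := gromov_product_near o (f' (vp (pv (F a) i))) (f' (vp (pv (F b) i))).
have := gromov_product_base (f (vp o)) (vp m) (vp (pv (F a) i)) (vp (pv (F b) i)).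
have -> : gromov_product (vp o) (f' (vp (pv (F a) i))) (f' (vp (pv (F b) i))) =
    gromov_product (f (vp o)) (vp (pv (F a) i)) (vp (pv (F b) i)).
  by rewrite /gromov_product -!(f_iso.2 _ (vp o)) -(f_iso.2 (f' _) (f' _)) !f'K.
have -> : gromov_product (vp m) (vp (pv (F a) i)) (vp (pv (F b) i)) = 0.
  rewrite /gromov_product !mdist_vp.
  have := tdist_gp hT m (pv (F a) i) (pv (F b) i); rewrite h ?leq_maxl//.
  rewrite muln0 addn0 (tdistC hT m (pv (F a) i)) (tdistC hT m (pv (F b) i)) => ->.
  by rewrite natrD subrr mul0r.
by rewrite !ler_norml => /andP[_ ?] /andP[? _]; lra.
Qed.

Lemma boundary_center a b c : a <> b -> b <> c -> a <> c -> exists m n,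
  forall i, (n <= i)%N -> [/\ tgp hT m (pv a i) (pv b i) = 0%N,
    tgp hT m (pv b i) (pv c i) = 0%N & tgp hT m (pv a i) (pv c i) = 0%N].
Proof.
(* When [nb x y] is the largest of the three heights, the centre is the vertex where the rays to [x]
   and [y] part. *)
have main (x y z : boundary X) : x <> y -> y <> z -> x <> z -> (nb x z <= nb x y)%N ->
    (nb y z <= nb x y)%N -> exists m n,
  forall i, (n <= i)%N -> [/\ tgp hT m (pv x i) (pv y i) = 0%N,
    tgp hT m (pv y i) (pv z i) = 0%N & tgp hT m (pv x i) (pv z i) = 0%N].
  move=> xy yz xz xzy yzx; exists (pv x (nb x y)).
  exists (nb x y).+1 => i ni.
  have e1 : tgp hT o (pv x i) (pv y i) = nb x y by exact: tgp_prefix_vertex.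
  have e2 : tgp hT o (pv y i) (pv z i) = nb y z.
    by apply: tgp_prefix_vertex => //; exact: leq_ltn_trans ni.
  have e3 : tgp hT o (pv x i) (pv z i) = nb x z.
    by apply: tgp_prefix_vertex => //; exact: leq_ltn_trans ni.
  have low w j : pre w (nb x y) = pre x (nb x y) -> (nb x y <= j)%N ->
      tgp hT o (pv x (nb x y)) (pv w j) = nb x y.
    move=> e le; rewrite /tgp !geod_prefix_vertex -e -(take_prefix_at o w le).
    apply/eqP; rewrite eqn_leq; apply/andP; split.
      by apply: leq_trans (lcp_size _ _) _; rewrite size_takel// size_prefix_at.
    apply/lcp_leq; rewrite size_takel ?size_prefix_at//; split=> //.
    by rewrite take_takel.
  have m1 : tgp hT o (pv x (nb x y)) (pv x i) = nb x y by apply: low => //; exact: ltnW.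
  have m2 : tgp hT o (pv x (nb x y)) (pv y i) = nb x y.
    by apply: low; [apply/esym/branchingP|exact: ltnW].
  have m3 : tgp hT o (pv x (nb x y)) (pv z i) = nb x z.
    have u1 := tgp_ultra hT o (pv x (nb x y)) (pv x i) (pv z i).
    have u2 := tgp_ultra hT o (pv x i) (pv x (nb x y)) (pv z i).
    rewrite (tgpC hT o (pv x i) (pv x _)) in u2.
    have le : (tgp hT o (pv x (nb x y)) (pv z i) <= nb x y)%N.
      by rewrite -{2}(tdist_prefix_vertex o x (nb x y)); exact: lcp_size.
    by move: u1 u2; rewrite e3 m1 => u1 u2; lia.
  have yzE : nb y z = nb x z.
    have := tgp_ultra hT o (pv x i) (pv y i) (pv z i).
    have := tgp_ultra hT o (pv y i) (pv x i) (pv z i).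
    by rewrite (tgpC hT o (pv y i) (pv x i)) e1 e2 e3; lia.
  move: (tdist_gp hT o (pv x i) (pv y i)) (tdist_gp hT o (pv y i) (pv z i))
   (tdist_gp hT o (pv x i) (pv z i)) (tdist_gp hT o (pv x (nb x y)) (pv x i))
   (tdist_gp hT o (pv x (nb x y)) (pv y i)) (tdist_gp hT o (pv x (nb x y)) (pv z i)).
  move: (tdist_gp hT (pv x (nb x y)) (pv x i) (pv y i)) (tdist_gp hT (pv x (nb x y)) (pv y i) (pv z i))
     (tdist_gp hT (pv x (nb x y)) (pv x i) (pv z i)).
  rewrite e1 e2 e3 m1 m2 m3 !tdist_prefix_vertex => ? ? ? ? ? ? ? ? ?.
  split; lia.
move=> ab bc ac; have [h1|/ltnW h1] := leqP (nb a c) (nb a b).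
  have [h2|/ltnW h2] := leqP (nb b c) (nb a b); first exact: main.
  have [||m [n h]] := main b c a bc (nesym ac) (nesym ab); rewrite 1?branchingC//.
    exact: leq_trans h2.
  by exists m, n => i /h[u v w]; rewrite ![tgp _ _ (pv a i) _]tgpC.
have [h2|/ltnW h2] := leqP (nb b c) (nb a c).
  have [||m [n h]] := main a c b ac (nesym bc) ab; rewrite 1?[nb c b]branchingC//.
  by exists m, n => i /h[u v w]; split=> //; rewrite tgpC.
have [||m [n h]] := main b c a bc (nesym ac) (nesym ab); rewrite 1?branchingC//.
  exact: leq_trans h2.
by exists m, n => i /h[u v w]; rewrite ![tgp _ _ (pv a i) _]tgpC.
Qed.

Hypothesis T_valence : bounded_valence T.

Definition cylinder a n : set (boundary X) := [set b | pre b n = pre a n].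

Lemma cylinder_clopen a n : clopen (cylinder a n).
Proof. by apply: (@saturated_clopen _ _ o n) => b c e; rewrite /cylinder /= e. Qed.

Lemma cylinder_compact a n : compact (cylinder a n).
Proof.
by apply: subclosed_compact (cylinder_clopen a n).2 (boundary_compact o T_valence) _.
Qed.

Lemma open_nbhs_cylinder a n : open_nbhs a (cylinder a n).
Proof. by split=> //; exact: (cylinder_clopen a n).1. Qed.

Variable K : set {compact-open, boundary X -> boundary X}.
Hypotheses (K_compact : compact K)
  (K_homeo : forall F : boundary X -> boundary X, K F -> homeomorphism F).

(** Cylinders are compact and open, so mapping one into another is an open condition in the
    compact-open topology. *)
Lemma open_nbhs_cylinder_map (F : {compact-open, boundary X -> boundary X}) a m : K F ->
  exists n, open_nbhs F [set F' : {compact-open, boundary X -> boundary X} |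
    forall b, cylinder a n b -> cylinder (F a) m (F' b)].
Proof.
move=> /K_homeo[_ [_ _ F_cont _]].
have /continuousP/(_ _ (cylinder_clopen (F a) m).1)/(boundary_openP o) := F_cont.
move=> /(_ a erefl)[n hn]; exists n; split; last by move=> b /hn.
have := compact_open_open (@cylinder_compact a n) (cylinder_clopen (F a) m).1.
congr open; apply/seteqP; split=> F' h.
  by move=> b ab; apply: h; exists b.
by move=> _ [b ab <-]; exact: h.
Qed.

Lemma compact_equicontinuous m : exists n, forall F, K F -> forall c d,
  pre c n = pre d n -> pre (F c) m = pre (F d) m.
Proof.
pose P (S : set ({compact-open, boundary X -> boundary X} * boundary X)) :=
  exists n, forall p, S p -> forall d, pre p.2 n = pre d n -> pre (p.1 p.2) m = pre (p.1 d) m.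
have [||||| n hn] := @compact_ind _ P (K `*` setT).
- by exists 0%N.
- move=> S S' [n hn] [n' hn']; exists (maxn n n') => p [Sp|Sp] d e.
    by apply: hn => //; apply: prefix_at_leq e; exact: leq_maxl.
  by apply: hn' => //; apply: prefix_at_leq e; exact: leq_maxr.
- by move=> S S' SS' [n hn]; exists n => p /SS'; exact: hn.
- move=> [F c] [KF _]; have [n [oU UF]] := open_nbhs_cylinder_map c m KF.
  exists ([set F' : {compact-open, boundary X -> boundary X} |
    forall b, cylinder c n b -> cylinder (F c) m (F' b)] `*` cylinder c n).
    split; last by split=> //; exact: (open_nbhs_cylinder c n).2.
    by apply: open_setX => //; exact: (cylinder_clopen c n).1.
  exists n => -[F' c'] [/= hF' cc'] d e.
  by rewrite [LHS]hF'// [RHS]hF'//; rewrite /cylinder /= -e.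
- by apply: compact_setX => //; exact: (boundary_compact o T_valence).
by exists n => F KF c d; exact: (hn (F, c)).
Qed.

(** Maps in [K] are injective, so two prefixes that differ have images that differ at some level;
    this persists nearby, and compactness makes the level uniform. *)
Lemma compact_equi_injective n : exists m, forall F, K F -> forall a b,
  pre a n <> pre b n -> pre (F a) m <> pre (F b) m.
Proof.
pose P (S : set ({compact-open, boundary X -> boundary X} * (boundary X * boundary X))) :=
  exists m, forall p, S p -> pre p.2.1 n <> pre p.2.2 n ->
    pre (p.1 p.2.1) m <> pre (p.1 p.2.2) m.
have [||||| m hm] := @compact_ind _ P (K `*` (setT `*` setT)).
- by exists 0%N.
- move=> S S' [m hm] [m' hm']; exists (maxn m m') => p [Sp|Sp] ne e.
    by apply: (hm p) => //; apply: prefix_at_leq e; exact: leq_maxl.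
  by apply: (hm' p) => //; apply: prefix_at_leq e; exact: leq_maxr.
- by move=> S S' SS' [m hm]; exists m => p /SS'; exact: hm.
- move=> [F [a b]] [KF _].
  have [ab|ab] := pselect (pre a n = pre b n).
    exists (setT `*` (cylinder a n `*` cylinder b n)).
      split; last by [].
      apply: open_setX; first exact: openT.
      by apply: open_setX; exact: (cylinder_clopen _ _).1.
    exists 0%N => -[F' [a' b']] [/= _ [aa' bb']] []; by rewrite [LHS]aa' [RHS]bb'.
  have [m Fm] : exists m, pre (F a) m <> pre (F b) m.
    apply: contrapT => no; apply: ab; have [F' [FK _ _ _]] := K_homeo KF.
    congr (pre _ n); rewrite -(FK a) -(FK b); congr F'; apply: (@prefix_at_inj R T o) => m.
    by apply: contrapT => h; apply: no; exists m.
  have [i [oU UF]] := open_nbhs_cylinder_map a m KF.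
  have [j [oV VF]] := open_nbhs_cylinder_map b m KF.
  set U := [set _ | _] in oU UF; set V := [set _ | _] in oV VF.
  exists ((U `&` V) `*` (cylinder a i `*` cylinder b j)).
    split; last by split.
    apply: open_setX; first exact: openI.
    by apply: open_setX; exact: (cylinder_clopen _ _).1.
  exists m => -[F' [a' b']] [/= [UF' VF'] [aa' bb']] _.
  by rewrite [pre (F' a') m]UF'// [pre (F' b') m]VF'.
- by apply: compact_setX => //; apply: compact_setX; exact: (boundary_compact o T_valence).
by exists m => F KF a b; exact: (hm (F, (a, b))).
Qed.

(** An isometry moves the centre of [a], [b] and [c] near [o], and another one brings the map into
    [K]. Isometries distort the comparison of heights boundedly, so it remains to control one map of
    [K] on a triple centred near [o], where only the height of [c] and [d] can be large. *)
Lemma compact_modulo_uniformly_qm : cobounded_isometries X ->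
  uniformly_qm o [set F : boundary X -> boundary X | injective F /\
    forall (f : X -> X) (df : boundary X -> boundary X),
    isometry f -> extends_to_boundary f df ->
    exists (f' : X -> X) (df' : boundary X -> boundary X),
      [/\ isometry f', extends_to_boundary f' df' & K (df' \o F \o df)]].
Proof.
move=> [D0 hD0] M; have [D hD] := bound_nat (D0 + 2).
have qi := @qi_uniformly_qm R T o 1 0 (lexx _) (lexx _).
have [M1 hM1] := qi M; have [m hm] := compact_equi_injective D.+1.
(* If [df1 c] and [df1 d] agreed up to level [n], their images would branch above [2 * m + M1], more
   than the distortion [M1] and two heights below [m] allow. *)
have [n hn] := compact_equicontinuous (2 * m + M1).+1.
have [J hJ] := qi (D + n)%N; exists J => F [injF hF] a b c d abcd LM.
have [ab ac ad [bc bd cd]] := abcd.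
have [q [N hq]] := boundary_center ab bc ac.
have [f f_iso fq] := hD0 (vp o) (vp q).
have [df ext_f] := isometry_extends f_iso.
have [df1 [dfK df1K qi_df1]] := isometry_boundary_inverse f_iso ext_f.
have [h [dh [h_iso ext_h Kh]]] := hF f df f_iso ext_f.
have [dh1 [dhK dh1K qi_dh1]] := isometry_boundary_inverse h_iso ext_h.
apply: (hJ df1 qi_df1 _ _ _ _ abcd).
have df1I x y : x <> y -> df1 x <> df1 y by move=> xy /(can_inj df1K).
have close x y : x <> y ->
    (forall i, (N <= i)%N -> tgp hT q (pv x i) (pv y i) = 0%N) ->
    (nb (df1 x) (df1 y) <= D)%N.
  move=> xy hxy; rewrite -(ler_nat R); apply: le_trans hD.
  apply: (branching_isometry f_iso ext_f (df1I _ _ xy) _ fq); rewrite !df1K //.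
  exact: hxy.
have ab0 := close a b ab (fun i Ni => let: And3 u _ _ := hq i Ni in u).
have bc0 := close b c bc (fun i Ni => let: And3 _ u _ := hq i Ni in u).
have ac0 := close a c ac (fun i Ni => let: And3 _ _ u := hq i Ni in u).
suff : (nb (df1 c) (df1 d) < n)%N by lia.
rewrite ltnNge; apply/negP => /(branchingP _ _ (df1I _ _ cd))/(hn _ Kh).
set F' := dh \o F \o df; rewrite -/(F' (df1 c)) -/(F' (df1 d)) => e.
have FE x : F' (df1 x) = dh (F x) by rewrite /F' /= df1K.
have dF x y : x <> y -> F' (df1 x) <> F' (df1 y).
  by move=> xy; rewrite !FE => /(can_inj dhK)/injF.
have /(branchingP _ _ (dF _ _ cd)) cdF := e.
have far x y : x <> y -> (nb (df1 x) (df1 y) <= D)%N ->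
    (nb (F' (df1 x)) (F' (df1 y)) < m)%N.
  move=> xy le; apply: (far_nb (hm _ Kh _ _ _)).2.
  by move/(branchingP _ _ (df1I _ _ xy)); rewrite ltnNge le.
have abF := far _ _ ab ab0; have bcF := far _ _ bc bc0; have acF := far _ _ ac ac0.
have adF : (nb (F' (df1 a)) (F' (df1 d)) < m)%N.
  have := branching_ultra o (dF _ _ ad) (nesym (dF _ _ cd)) (dF _ _ ac).
  by rewrite (branchingC o (F' (df1 d))); lia.
have := hM1 dh1 qi_dh1 (F' (df1 a)) (F' (df1 b)) (F' (df1 c)) (F' (df1 d)).
rewrite !FE !dhK -!FE => /(_ _ LM) le.
have := le ltac:(by split; [apply: dF..|split; apply: dF]); lia.
Qed.

End CompactModuloIsometries.

(** * Cocompactness and precompactness in terms of clopen sets *)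

Section TopologicalActions.
Variables (G : groupType) (B : topologicalType) (A : G -> B -> B).
Hypothesis B_sep : forall a b : B, a <> b -> exists U, [/\ clopen U, U a & ~ U b].

Lemma cocompact_boxes : cocompact_on_triples A ->
  exists bx : set (set B * set B * set B), [/\ finite_set bx,
    forall P Q R, bx (P, Q, R) -> [/\ clopen P, clopen Q & clopen R] /\
      [/\ P `<=` ~` Q, P `<=` ~` R & Q `<=` ~` R] &
    forall a b c : B, a <> b -> b <> c -> a <> c -> exists P Q R g a0 b0 c0,
      [/\ bx (P, Q, R), P a0 /\ A g a0 = a, Q b0 /\ A g b0 = b & R c0 /\ A g c0 = c]].
Proof.
move=> [K cK hK].
pose isbox (t : set B * set B * set B) := let: (P, Q, R) := t in
  [/\ clopen P, clopen Q & clopen R] /\ [/\ P `<=` ~` Q, P `<=` ~` R & Q `<=` ~` R].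
pose cover (S : set (set_type (@distinct_triples B))) := exists bx, [/\ finite_set bx,
  bx `<=` isbox & forall k, S k -> exists P Q R, [/\ bx (P, Q, R),
    P (set_val k).1.1, Q (set_val k).1.2 & R (set_val k).2]].
have [||||bx [fbx bbx hbx]] := @compact_ind _ cover K _ _ _ _ cK.
- by exists set0; split.
- move=> S S' [bx [fbx bbx hbx]] [bx' [fbx' bbx' hbx']]; exists (bx `|` bx'); split.
  + by rewrite finite_setU.
  + by move=> t [/bbx|/bbx'].
  + move=> k [/hbx|/hbx'] [P [Q [R [h ? ? ?]]]]; exists P, Q, R; split=> //; [by left|by right].
- by move=> S S' SS' [bx [fbx bbx hbx]]; exists bx; split=> // k /SS'/hbx.
- move=> k _; have [ab bc ac] := set_valP k.
  have [U [cU Ua nUb]] := B_sep ab; have [V [cV Va nVc]] := B_sep ac.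
  have [W [cW Wb nWc]] := B_sep bc.
  (* The third box is everything outside [P] and [Q]; it contains the third point because [V] and
     [W] exclude it. *)
  pose P := U `&` V; pose Q := ~` U `&` W; pose D := ~` P `&` ~` Q.
  have cP : clopen P by exact: clopenI.
  have cQ : clopen Q by apply: clopenI => //; exact: clopenC.
  have cD : clopen D by apply: clopenI; exact: clopenC.
  exists (set_val @^-1` (P `*` Q `*` D)).
    split; last by split=> //; split=> [[_ /nVc]|[_ /nWc]].
    exists (P `*` Q `*` D) => //; apply: open_setX cD.1.
    exact: open_setX cP.1 cQ.1.
  exists [set (P, Q, D)]; split; first exact: finite_set1.
    move=> _ ->; split=> //; split=> x; first by move=> [? _] [].
      by move=> Px [].
    by move=> Qx [].
  by move=> k' [[Pk Qk] Dk]; exists P, Q, D.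
exists bx; split=> // [P Q R /bbx //|a b c ab bc ac].
have abc : (a, b, c) \in @distinct_triples B by apply: mem_set.
have [g [k /hbx[P [Q [R [bxk Pk Qk Rk]]]]]] := hK (SigSub abc).
move: Pk Qk Rk; case: (set_val k) => -[a0 b0] c0 /= Pa Qb Rc [-> -> ->].
by exists P, Q, R, g, a0, b0, c0.
Qed.

Hypotheses (B_compact : compact [set: B]) (A_inj : forall g, injective (A g)).

(** A finite union of products of a clopen set with its complement is compact and misses the
    diagonal; conversely such products cover the closure of the orbit. *)
Lemma bounded_on_pairsP (H : {pred G}) :
  bounded_on_pairs A H <-> precompact_pair_orbits A H.
Proof.
split=> [bH [[a b] abD]|pH a b ab].
  have ab : a <> b := set_mem abD.
  have [S [fS cS hS]] := bH a b ab.
  pose C := \bigcup_(U in (S : set {classic set B})) (U `*` ~` U).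
  have clC : closed C.
    apply: closed_bigcup => // U SU.
    rewrite (_ : U `*` _ = fst @^-1` U `&` snd @^-1` (~` U)); last by apply/seteqP; split.
    have [oU clU] := cS U SU; apply: closedI; apply: preimage_closed => //.
    - by move=> x _; exact: cvg_fst.
    - by move=> x _; exact: cvg_snd.
    - exact: open_closedC.
  have CD : C `<=` @distinct_pairs B.
    by move=> [x y] [U _ [/= Ux nUy]] xy; apply: nUy; rewrite -[y]xy.
  exists (set_val @^-1` C).
    move=> q [h hH qE]; have [U SU [Ua nUb]] := hS h hH.
    by by exists U => //; rewrite /= qE.
  split; last by apply: preimage_closed => // x _; exact: initial_continuous.
  apply: compact_subtype => //.
  by apply: subclosed_compact clC (compact_setX B_compact B_compact) _ => -[x y].
pose p : set_type (@distinct_pairs B) := SigSub (mem_set (ab : distinct_pairs (a, b))).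
have := pH p; rewrite precompactE.
pose P (D : set (set_type (@distinct_pairs B))) := exists S : set (set B),
  [/\ finite_set S, (forall U, S U -> clopen U) &
    forall q, D q -> exists2 U, S U & U (set_val q).1 /\ ~ U (set_val q).2].
move=> /(@compact_ind _ P)[||||S [fS cS hS]].
- by exists set0; split.
- move=> D D' [S [fS cS hS]] [S' [fS' cS' hS']]; exists (S `|` S'); split.
  + by rewrite finite_setU.
  + by move=> U [/cS|/cS'].
  + by move=> q [/hS|/hS'] [U SU h]; exists U => //; [left|right].
- by move=> D D' DD' [S [fS cS hS]]; exists S; split=> // q /DD'/hS.
- move=> q _; have [U [cU Ua nUb]] := B_sep (set_valP q).
  exists (set_val @^-1` (U `*` ~` U)).
    split; last by split.
    exists (U `*` ~` U) => //; apply: open_setX cU.1 (clopenC setT cU).1.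
  exists [set U]; split; first exact: finite_set1.
    by move=> _ ->.
  by move=> q' [? ?]; exists U.
exists S; split=> // h hH.
have hab : A h a <> A h b by move=> /A_inj.
have := hS (SigSub (mem_set (hab : distinct_pairs (A h a, A h b)))).
by apply; apply: subset_closure; exists h.
Qed.

End TopologicalActions.

Section Uniformly.
Variables (R : realType) (T : tree) (o : vertex T).
Hypothesis T_valence : bounded_valence T.
Variables (G : groupType).
Variable A : G -> boundary (realization R T) -> boundary (realization R T).

Lemma quasiconformal_uniformly_qm : (forall g, injective (A g)) ->
  uniformly_quasiconformal A -> uniformly_qm o (range A).
Proof.
move=> A_inj; have sub (P Q : set (boundary (realization R T) -> boundary (realization R T))) :
    uniformly_qm o Q -> P `<=` Q -> uniformly_qm o P.
  by move=> h PQ M; have [J hJ] := h M; exists J => F /PQ; exact: hJ.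
case=> [[K [C [K1 C0 h]]]|[I I_inc h]|[cob [K [cK K_homeo h]]]].
- apply: (sub _ _ (qi_uniformly_qm o K1 C0)) => _ [g _ <-]; split=> //; exact: h.
- by apply: (sub _ _ (quasimobius_uniformly_qm o I_inc)) => _ [g _ <-]; split.
apply: (sub _ _ (compact_modulo_uniformly_qm o T_valence cK K_homeo cob)) => _ [g _ <-].
by split=> // f df; exact: h.
Qed.
End Uniformly.

Theorem corollary6 (R : realType) (T : tree) (G : groupType)
    (A : G -> boundary (realization R T) -> boundary (realization R T)) :
  bounded_valence T -> bushy R T ->
  action_by_homeomorphisms A -> uniformly_quasiconformal A ->
  cocompact_on_triples A ->
  exists (Gam : graph_of_groups) (F : set (edge Gam)),
    [/\ finite_graph Gam, is_tree (spanning_subgraph F),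
        finite_index_injections Gam &
        exists2 phi : {multiplicative G -> pi1 F}, bijective phi &
          forall H : {pred G}, group_closed H ->
            (exists x : vertex (bass_serre_tree F),
               forall h, h \in H -> bass_serre_act (phi h) x = x) <->
            precompact_pair_orbits A H].
Proof.
move=> T_valence T_bushy [A1 AM A_homeo] A_qc A_coc.
have [[v] _] := treeP T.
have A_inj g : injective (A g).
  by have [f [fK _ _ _]] := A_homeo g; exact: can_inj fK.
have B_sep := @boundary_separation R T v; have B_compact := @boundary_compact R T v T_valence.
have [bx [bx_fin bx_box bx_cover]] := cocompact_boxes B_sep A_coc.
have ca : convergence_action A bx.
  split=> //.
  - move=> g U cU; apply: preimage_clopen cU _.
    by have [f [_ _ ? _]] := A_homeo g^-1%g.
  - move=> U a /(clopen_saturated v T_valence)[n sU] Ua.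
    have [b [e ba]] := boundary_no_isolated T_valence v T_bushy a n.
    by exists b => //; exact: sU (esym e) Ua.
  - exact: (boundary_neq0 T_valence v T_bushy).
  - move=> a b c ab bc ac.
    have [P [Q [S [g [a0 [b0 [c0 [h [Pa <-] [Qb <-] [Sc <-]]]]]]]]] := bx_cover a b c ab bc ac.
    by exists P, Q, S, g; split=> //; apply/(translateP A1 AM).
  - exact: (qm_convergence T_valence A1 AM
      (quasiconformal_uniformly_qm v T_valence A_inj A_qc)).
have [Gam [F [fG tF fi [phi bij hphi]]]] := convergence_bass_serre ca.
exists Gam, F; split=> //; exists phi => // H /hphi ->.
exact: bounded_on_pairsP.
Qed.
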